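(* Let $m$ be a nonzero Borel measure on $\mathbb{R}$ with $m(\mathbb{R})<\infty$, and consider the Poisson point field on $\mathbb{R}\times\mathbb{R}$ with intensity $dt\times m(dx)$. With probability 1, there is a unique recurrent global minimizer $\gamma$.
   Context: $(\Omega,\mathcal{F},\mathsf{P})$ is a complete probability space; $\Omega$ is identified with the space of locally finite point configurations $\omega=\{(s_i,x_i)\}$ in $\mathbb{R}\times\mathbb{R}$ (first coordinate time, second coordinate space), and $\mathsf{P}$ is the law of the Poisson point field with intensity $dt\times m(dx)$. For $t_0<t_1$ and a path $\gamma$, $N^{t_0,t_1}_\omega(\gamma)$ is the number of points of $\omega$ that $\gamma$ passes through between $t_0$ and $t_1$, and the action is $$\mathcal{A}^{t_0,t_1}_\omega(\gamma)=\frac12\int_{t_0}^{t_1}\dot\gamma^2(s)\,ds-N^{t_0,t_1}_\omega(\gamma).$$ For $x_0,x_1\in\mathbb{R}$, $\Gamma_{t_0,x_0}^{t_1,x_1}$ is the set of continuous piecewise linear paths $\gamma$ on $[t_0,t_1]$ with $\gamma(t_0)=x_0$, $\gamma(t_1)=x_1$, whose switchings from one linear regime to another happen only at points of $\omega$, and $M_{t_0,x_0}^{t_1,x_1}$ is the set of minimizers of $\mathcal{A}^{t_0,t_1}_\omega$ over $\Gamma_{t_0,x_0}^{t_1,x_1}$. A path $\gamma:\mathbb{R}\to\mathbb{R}$ is called a global minimizer if $\gamma|_{[t_0,t_1]}\in M_{t_0,\gamma(t_0)}^{t_1,\gamma(t_1)}$ for all $t_0<t_1$. A global minimizer is called recurrent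 if there are $R>0$ and a two-sided sequence $(t_k)_{k\in\mathbb{Z}}$ with $\lim_{k\to\pm\infty}t_k=\pm\infty$ and $\gamma(t_k)\in[-R,R]$ for all $k$. *)

(* Defs.v *)
From mathcomp Require Import all_boot all_order all_algebra finmap.
From mathcomp Require Import all_classical all_reals all_analysis.

Set Implicit Arguments.
Unset Strict Implicit.
Unset Printing Implicit Defensive.

Import Order.TTheory GRing.Theory Num.Theory.
Import numFieldNormedType.Exports.

Local Open Scope classical_set_scope.
Local Open Scope ring_scope.

(** * Point configurations in space-time: a point is a pair (time, position) *)

Definition locally_finite (R : realType) (S : set (R * R)) : Prop :=
  forall B : set (R * R), bounded_set B -> finite_set (S `&` B).

Record configuration (R : realType) := Configuration {
  points :> set (R * R);
  points_locally_finite : locally_finite points }.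

(* [fset_set] sends infinite sets to the empty set.  [npoints S] is only used
   for sets S of points of a configuration that lie in a bounded region, which
   are finite. *)
Definition npoints (R : realType) (S : set (R * R)) : nat :=
  #|` fset_set S|%fset.

(* The Poisson point field with intensity dt x m(dx), as a random configuration
   on (Omega, P): the numbers of points in bounded Borel sets are Poisson
   random variables, independent over disjoint sets.
   In [poisson_prob rate k] the argument k is not used by the library; unlike
   [poisson_pmf], this law is the right one (Dirac at 0) for rate 0. *)
Section poisson_field.
Context (R : realType) (m : {finite_measure set (measurableTypeR R) -> \bar R}).

Definition intensity (A : set (measurableTypeR R * measurableTypeR R)) : \bar R :=
  (lebesgue_measure \x m)%E A.

Definition bounded_borel (A : set (measurableTypeR R * measurableTypeR R)) :=
  measurable A /\ bounded_set (A : set (R * R)).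

Context d (Omega : measurableType d) (P : probability Omega R).

Definition count_in (xi : Omega -> configuration R) (A : set (R * R))
  (w : Omega) : nat := npoints (xi w `&` A).

Definition poisson_point_field (xi : Omega -> configuration R) : Prop :=
  [/\ forall A, bounded_borel A -> measurable_fun [set: Omega] (count_in xi A),
      forall A, bounded_borel A -> forall U : set nat,
        P (count_in xi A @^-1` U) = poisson_prob (fine (intensity A)) 0 U
    & forall (n : nat) (A : 'I_n -> set (R * R)) (U : 'I_n -> set nat),
        (forall i, bounded_borel (A i)) -> trivIset [set: 'I_n] A ->
        P (\bigcap_(i in [set: 'I_n]) (count_in xi (A i) @^-1` U i)) =
        (\prod_(i < n) P (count_in xi (A i) @^-1` U i))%E].

End poisson_field.

(** * Paths and action.
   A path on [t0, t1] is represented by a function on the whole line; nothing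
   below depends on its values outside [t0, t1]. *)
Section paths.
Context (R : realType).
Implicit Types (w : configuration R) (g : R -> R) (t x : R).

(* Points on the graph of g over [t0, t1].  Including the endpoints only shifts
   the action by a constant on paths with the same endpoints. *)
Definition visits w t0 t1 g : nat :=
  npoints (w `&` [set p | t0 <= p.1 <= t1 /\ g p.1 = p.2]).

(* The derivative of a piecewise linear path exists off a finite set. *)
Definition action w t0 t1 g : R :=
  2^-1 * (\int[lebesgue_measure]_(s in `[t0, t1]) ((derive1 g s) ^+ 2))
  - (visits w t0 t1 g)%:R.

Definition linear_on (A : set R) g : Prop :=
  exists a b : R, forall s, A s -> g s = a * s + b.

Definition piecewise_linear t0 t1 g : Prop :=
  exists2 r : seq R, itv_partition t0 t1 r &
    forall i : nat, (i < size r)%N ->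
      linear_on `[nth t0 (t0 :: r) i, nth t0 (t0 :: r) i.+1] g.

Definition switching_time t0 t1 g (s : R) : Prop :=
  t0 < s < t1 /\ ~ (exists a b : R, \forall u \near s, g u = a * u + b).

(* Gamma_{t0,x0}^{t1,x1} *)
Definition admissible w t0 x0 t1 x1 : set (R -> R) :=
  [set g | [/\ {within `[t0, t1], continuous g},
               piecewise_linear t0 t1 g,
               g t0 = x0, g t1 = x1
             & forall s, switching_time t0 t1 g s -> points w (s, g s)]].

(* M_{t0,x0}^{t1,x1} *)
Definition minimizers w t0 x0 t1 x1 : set (R -> R) :=
  [set g | admissible w t0 x0 t1 x1 g /\
           forall h, admissible w t0 x0 t1 x1 h ->
             action w t0 t1 g <= action w t0 t1 h].

Definition global_minimizer w g : Prop :=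
  forall t0 t1, t0 < t1 -> minimizers w t0 (g t0) t1 (g t1) g.

Definition recurrent g : Prop :=
  exists r : R, 0 < r /\ exists t : int -> R,
    [/\ (fun n : nat => t n%:Z) @ \oo --> +oo,
        (fun n : nat => t (- n%:Z)) @ \oo --> -oo
      & forall k : int, g (t k) \in `[- r, r]].

End paths.

(* Main.v *)
Require Import Defs.
From mathcomp Require Import all_boot all_order all_algebra finmap.
From mathcomp Require Import all_classical all_reals all_analysis.
From mathcomp Require Import measurable_realfun ring lra zify.

Set Implicit Arguments.
Unset Strict Implicit.
Unset Printing Implicit Defensive.

Import Order.TTheory GRing.Theory Num.Theory.
Import numFieldNormedType.Exports.

Local Open Scope classical_set_scope.
Local Open Scope ring_scope.

(** Admissible paths are polygons, so minimizing the action means minimizing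
    kinetic energy minus number of vertices over the chains, the lists of
    points of the configuration with increasing times ([minimizer_minchain],
    [minchain_minimizer]).  The theorem follows from two properties of the
    configuration ([recurrent_exists_unique]), besides the finiteness of its
    restriction to bounded time intervals ([slab_finite_ae]).

    No ties ([no_tie_ae]).  Almost surely, the kinetic energies of two polygons
    with the same ends do not differ by an integer if one of them has a vertex v
    that the other does not have; only vertices with the same position as both
    neighbours must be excepted, and these may be removed.  For such an equality
    is a quadratic equation for the time of v, with coefficients that depend on
    the other points and on the position of v ([bending_time]).  The intensity
    being a product with Lebesgue measure, the time of v is spread uniformly
    given everything else, so that it misses the two roots ([time_null]).
    Cutting space-time into small cells that isolate the points concerned gives
    countably many events of this kind.  Hence there is at most one minimizer
    between two points of the configuration ([minimizer_unique]).

    Attraction ([good_points_ae], [goodpoint_attracts]).  Arbitrarily far in the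
    past and in the future, at a bounded distance from the time axis, there are
    points of the configuration that every minimizer visits if its ends are
    far away in time but not in space.  Fix a short interval I of positive
    mass.  At a good point p0 the strip over I is well furnished with points on
    both sides of p0, and points far from I are rare, at every scale.  If a
    minimizer avoided p0, follow it from the time of p0 in both directions up
    to the first vertex near the axis, and replace this part by a path through
    p0 that collects the points of the strip.  Each of these costs at most 1/8
    and counts for 1, which pays for the vertices lost and for the way back to
    the minimizer; on either side the loss is at most 1/8
    ([halfgood_reroute]), while p0 gains 1.  Being good asks for the right
    number of points in about n regions near p0, which has probability at
    least c / 16^n, and for no accident beyond, which fails with probability
    at most 1 / 64^n ([window_prob], [bad_tail_outer]).  Among a bit more than
    16^n disjoint windows some window succeeds, and no accident happens in any
    of them.

    Granting this, two recurrent global minimizers visit the same attracting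
    points, which occur on both sides of any time, and between two of them they
    agree by uniqueness.  For existence take attracting points p_n in the past
    and q_n in the future, each pair far beyond the previous one.  The minimizer
    from p_n to q_n visits the previous pair, hence extends the previous
    minimizer; the union of all of them is a global minimizer, and it comes
    back near the axis at every p_n and q_n. *)

(** * Kinetic energy of polygons and optimal chains *)

Section energy.
Context {R : realType}.
Implicit Types (p q u v w : R * R) (s l : seq (R * R)).

(** The kinetic energy of uniform motion from p to q. The absolute value makes it
    symmetric, so that time can be reversed. *)
Definition leg p q : R := (q.2 - p.2) ^+ 2 / (2 * `|q.1 - p.1|).

Fixpoint energy p s : R :=
  if s is q :: s' then leg p q + energy q s' else 0.

Definition earlier p q : bool := p.1 < q.1.

Lemma earlier_trans : transitive earlier.
Proof. by move=> q p r; exact: lt_trans. Qed.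

Lemma leg_ge0 p q : 0 <= leg p q.
Proof. by rewrite /leg divr_ge0// ?sqr_ge0// mulr_ge0. Qed.

Lemma legC p q : leg p q = leg q p.
Proof. by rewrite /leg distrC -(opprB p.2) sqrrN. Qed.

Lemma legE p q : p.1 < q.1 -> leg p q = (q.2 - p.2) ^+ 2 / (2 * (q.1 - p.1)).
Proof. by move=> pq; rewrite /leg gtr0_norm// subr_gt0. Qed.

Lemma energy_ge0 p s : 0 <= energy p s.
Proof. by elim: s p => //= q s ih p; rewrite addr_ge0 ?leg_ge0. Qed.

Lemma energy_cat p s1 s2 :
  energy p (s1 ++ s2) = energy p s1 + energy (last p s1) s2.
Proof. by elim: s1 p => [|q s1 ih] p /=; rewrite ?add0r// ih addrA. Qed.

Lemma energy_rcons p s q : energy p (rcons s q) = energy p s + leg (last p s) q.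
Proof. by rewrite -cats1 energy_cat/= addr0. Qed.

Lemma energy_rev p l q : energy p (rcons l q) = energy q (rcons (rev l) p).
Proof.
elim: l p => [|x l ih] p /=; first by rewrite legC.
by rewrite rev_cons [RHS]energy_rcons last_rcons -ih legC addrC.
Qed.

(** Convexity of the square: x^2 / a + y^2 / b - (x + y)^2 / (a + b) is
    (x b - y a)^2 / (a b (a + b)). *)
Lemma leg_triangle u v w : u.1 < v.1 -> v.1 < w.1 ->
  leg u w <= leg u v + leg v w.
Proof.
move=> uv vw; have uw := lt_trans uv vw.
rewrite !legE//.
set a := v.1 - u.1; set b := w.1 - v.1.
have -> : w.1 - u.1 = a + b by rewrite /a /b; ring.
have a0 : 0 < a by rewrite subr_gt0.
have b0 : 0 < b by rewrite subr_gt0.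
set x := v.2 - u.2; set y := w.2 - v.2.
have -> : w.2 - u.2 = x + y by rewrite /x /y; ring.
have -> : x ^+ 2 / (2 * a) + y ^+ 2 / (2 * b) =
  (x + y) ^+ 2 / (2 * (a + b)) + (x * b - y * a) ^+ 2 / (2 * a * b * (a + b)).
  field; rewrite !gt_eqF//; exact: addr_gt0.
by rewrite lerDl divr_ge0 ?sqr_ge0// !mulr_ge0// ltW// addr_gt0.
Qed.

Lemma energy_drop p s1 v s2 : path earlier p (s1 ++ v :: s2) ->
  energy p (s1 ++ s2) <= energy p (s1 ++ v :: s2).
Proof.
rewrite cat_path /= => /andP[_ /andP[lv]].
rewrite !energy_cat lerD2l; case: s2 => [|w s2] /=.
  by rewrite addr0 leg_ge0.
by move=> /andP[vw _]; rewrite addrA lerD2r leg_triangle.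
Qed.

End energy.

Lemma seq_argmin {R : realType} (T : eqType) (f : T -> R) (s : seq T) : s != [::] ->
  exists2 x, x \in s & forall y, y \in s -> f x <= f y.
Proof.
elim: s => // x s ih _; have [->|/ih[y ys ymin]] := eqVneq s [::].
  by exists x; rewrite ?mem_head// => y; rewrite inE => /eqP ->.
have [xy|yx] := leP (f x) (f y).
  exists x; rewrite ?mem_head// => z; rewrite inE => /predU1P[->//|/ymin].
  exact: le_trans.
exists y; rewrite ?inE ?ys ?orbT// => z; rewrite inE => /predU1P[->|/ymin//].
exact: ltW.
Qed.

Fixpoint lists (T : Type) (n : nat) (s : seq T) : seq (seq T) :=
  if n is m.+1 then [::] :: [seq x :: l | x <- s, l <- lists m s] else [:: [::]].

Lemma mem_lists (T : eqType) n (s l : seq T) :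
  (size l <= n)%N -> {subset l <= s} -> l \in lists n s.
Proof.
elim: n l => [|n ih] [|x l]//= ln ls; rewrite inE/=.
apply/allpairsP; exists (x, l); split => //=; first exact/ls/mem_head.
by apply: ih => // y yl; apply: ls; rewrite inE yl orbT.
Qed.

Section chains.
Context {R : realType}.
Implicit Types (S : set (R * R)) (P Q p q u v : R * R) (l : seq (R * R)).

Definition chain S P l Q := path earlier P (rcons l Q) /\ [set` l] `<=` S.

(** Up to a constant depending on the ends, the action of the polygon: each
    vertex is a visited point. *)
Definition cost P l Q : R := energy P (rcons l Q) - (size l)%:R.

Definition minchain S P V Q := chain S P V Q /\
  forall l, chain S P l Q -> cost P V Q <= cost P l Q.

Lemma sorted_rcons_all l Q : sorted earlier (rcons l Q) = sorted earlier l && all (earlier ^~ Q) l.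
Proof.
elim: l => //= x l ih.
rewrite !(path_sortedE earlier_trans) ih all_rcons.
by rewrite -!andbA; do !bool_congr.
Qed.

Lemma path_rcons_time P l Q v :
  path earlier P (rcons l Q) -> v \in l -> P.1 < v.1 < Q.1.
Proof.
rewrite (path_sortedE earlier_trans) sorted_rcons_all all_rcons.
by move=> /andP[/andP[_ /allP Pl] /andP[_ /allP lQ]] vl; rewrite [_ < _]Pl//=; exact: lQ.
Qed.

Lemma earlier_irr : irreflexive (@earlier R).
Proof. by move=> x; rewrite /earlier ltxx. Qed.

Lemma path_earlier_uniq P l : path earlier P l -> uniq l.
Proof.
by move=> /path_sorted; exact: sorted_uniq earlier_trans earlier_irr _.
Qed.

(** The chains from P to Q are among the finitely many lists without repetition
    of points in the slab between them. *)
Lemma minchain_exists S P Q : P.1 < Q.1 ->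
  finite_set (S `&` [set p | P.1 < p.1 < Q.1]) -> exists V, minchain S P V Q.
Proof.
move=> PQ /finite_seqP[F FE].
pose L := [seq l <- lists (size F) F | `[< chain S P l Q >]].
have chL l : chain S P l Q -> l \in L.
  move=> cl; rewrite mem_filter; apply/andP; split; first exact/asboolP.
  have lF : {subset l <= F}.
    move=> v vl; have : (S `&` [set p | P.1 < p.1 < Q.1]) v.
      by split; [exact: cl.2|exact: path_rcons_time cl.1 vl].
    by rewrite FE.
  apply: mem_lists => //; apply: uniq_leq_size => //.
  by have := path_earlier_uniq cl.1; rewrite rcons_uniq => /andP[].
have [|V VL Vmin] := @seq_argmin R _ (fun l => cost P l Q) L.
  have : [::] \in L by apply: chL; split => //=; rewrite /earlier PQ.
  by apply: contraTneq => ->.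
exists V; split => [|l /chL/Vmin//].
by move: VL; rewrite mem_filter => /andP[/asboolP].
Qed.

Lemma sorted_split_time (t : R) l : sorted earlier l ->
  (forall v, v \in l -> v.1 != t) ->
  exists l1 l2, [/\ l = l1 ++ l2, forall v, v \in l1 -> v.1 < t &
    forall v, v \in l2 -> t < v.1].
Proof.
elim: l => [|x l ih] sl lt; first by exists [::], [::].
have [xt|] := ltP x.1 t.
  have [||l1 [l2 [-> h1 h2]]] := ih.
  - exact: path_sorted sl.
  - by move=> v vl; apply: lt; rewrite inE vl orbT.
  by exists (x :: l1), l2; split => // v; rewrite inE => /predU1P[->|/h1].
rewrite le_eqVlt eq_sym (negPf (lt _ (mem_head _ _)))/= => tx.
exists [::], (x :: l); split => // v; rewrite inE => /predU1P[->//|vl].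
apply: lt_trans tx _; move: sl; rewrite /= (path_sortedE earlier_trans).
by move=> /andP[/allP/(_ _ vl)].
Qed.

End chains.

(** * Points that attract optimal chains *)

Section attraction.
Context {R : realType} (i0 K : R) (ell M : nat).
Implicit Types (S : set (R * R)) (P Q p q u v : R * R) (l W : seq (R * R)).

Definition inI (x : R) : bool := i0 <= x < i0 + 2^-1.

Definition slab_end (tau : R) : R := tau + 2 * M%:R + 2.

(** Time windows after a slab that begins at tau. The windows 1 to M have length
    1 and lie in the slab; the later ones are the cells of length ell that follow
    the slab, shrunk by 1/2 on both sides so that points in two different
    windows are at least 1 apart in time. *)
Definition wnd (tau : R) (k : nat) : R * R :=
  if (k <= M)%N then (tau + 2 * k%:R, tau + 2 * k%:R + 1)
  else (slab_end tau + ell%:R * (k - M.+1)%:R + 2^-1,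
        slab_end tau + ell%:R * (k - M.+1)%:R + ell%:R - 2^-1).

Definition hit S (w : R * R) :=
  exists q, [/\ S q, w.1 <= q.1 <= w.2 & inI q.2].

(** What is asked of the configuration after p0. In the slab there are points
    over I in all windows, and no other points. Beyond it, for each j, at least
    half of the first j cells contain a point over I, and the first j cells
    have at most j / 8 points farther than K from the axis. *)
Definition halfgood S (tau : R) (p0 : R * R) : Prop :=
  [/\ tau <= p0.1 <= tau + 1 /\ inI p0.2,
      forall k, (0 < k <= M)%N -> hit S (wnd tau k),
      forall q, S q -> p0.1 < q.1 -> q.1 < slab_end tau ->
        p0.1 + 1 <= q.1 /\ inI q.2,
      forall j, exists s : seq nat,
        [/\ sorted ltn s, all (gtn j) s, (j <= 2 * size s)%N &
            forall i, i \in s -> hit S (wnd tau (M.+1 + i))] &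
      forall j (s : seq (R * R)), (0 < j)%N -> uniq s ->
        (forall q, q \in s -> [/\ S q, slab_end tau <= q.1 <= slab_end tau + ell%:R * j%:R &
           K < `|q.2|]) -> (8 * size s <= j)%N].

Hypothesis ell2 : (2 <= ell)%N.

Lemma ellR2 : 2 <= ell%:R :> R. Proof. by rewrite ler_nat. Qed.

Lemma wnd_gap tau k k' : (k < k')%N -> (wnd tau k).2 + 1 <= (wnd tau k').1.
Proof.
move=> kk'; rewrite /wnd /slab_end.
case: (leqP k M) => kM; case: (leqP k' M) => k'M /=.
- have : k%:R + 1 <= k'%:R :> R by rewrite natr1 ler_nat.
  by lra.
- have : k%:R <= M%:R :> R by rewrite ler_nat.
  have : 0 <= ell%:R * (k' - M.+1)%:R :> R by [].
  by lra.
- by have := ltn_trans kM kk'; rewrite ltnNge k'M.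
- have : (k - M.+1)%:R + 1 <= (k' - M.+1)%:R :> R.
    by rewrite natr1 ler_nat; lia.
  move=> /(ler_wpM2l (ler0n R ell)); rewrite mulrDr mulr1.
  have := ellR2.
  by lra.
Qed.

(** I has length 1/2. *)
Lemma leg_short u v : inI u.2 -> inI v.2 -> u.1 + 1 <= v.1 -> leg u v <= 8^-1.
Proof.
rewrite /inI => /andP[? ?] /andP[? ?] uv.
rewrite legE; last by lra.
rewrite ler_pdivrMr; last by lra.
have : (v.2 - u.2) ^+ 2 <= 4^-1.
  have : - 2^-1 <= v.2 - u.2 <= 2^-1 by lra.
  by move: (v.2 - u.2) => x /andP[]; nra.
lra.
Qed.

Lemma leg_long u v D : `|v.2 - u.2| <= D -> u.1 + 2^-1 <= v.1 -> leg u v <= D ^+ 2.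
Proof.
move=> h uv; rewrite legE; last by lra.
rewrite ler_pdivrMr; last by lra.
have : (v.2 - u.2) ^+ 2 <= D ^+ 2.
  by move: h; rewrite ler_norml; move: (v.2 - u.2) => x /andP[]; nra.
have := sqr_ge0 D; nra.
Qed.

(** The windows being 1 apart, a leg between points over I in two of them costs
    at most 1/8, which leaves a gain of 7/8 for each point collected. *)
Lemma collect S tau k ks p : path ltn k ks ->
  p.1 <= (wnd tau k).2 -> inI p.2 ->
  (forall i, i \in ks -> hit S (wnd tau i)) ->
  exists W, [/\ size W = size ks, path earlier p W, [set` W] `<=` S,
    energy p W <= 8^-1 * (size W)%:R &
    (last p W).1 <= (wnd tau (last k ks)).2 /\ inI (last p W).2].
Proof.
elim: ks k p => [|k' ks ih] k p /=.
  by move=> _ pk pI _; exists [::]; split; rewrite ?mulr0.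
move=> /andP[kk' kks] pk pI hks.
have [q [Sq /andP[q1 q2] qI]] := hks _ (mem_head _ _).
have pq : p.1 + 1 <= q.1 by apply: le_trans q1; apply: le_trans (wnd_gap _ kk'); rewrite lerD2r.
have [|W [sW pW SW eW lW]] := ih k' q kks q2 qI.
  by move=> i iks; apply: hks; rewrite inE iks orbT.
exists (q :: W); split => //=.
- by rewrite sW.
- by rewrite pW andbT /earlier; lra.
- by move=> v /=; rewrite inE => /predU1P[->//|/SW].
- by have := leg_short pI qI pq; rewrite -(natr1 (size W)); lra.
Qed.

Lemma long_leg_bound (a b c : R) : 5 * a <= b -> 0 <= b -> 0 <= c ->
  4 * a <= 7 / 8 * b + 5 / 16 * c.
Proof. by lra. Qed.

Lemma windows_path (n : nat) (s : seq nat) : sorted ltn s ->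
  path ltn 0 (iota 1 n ++ map (addn n.+1) s).
Proof.
move=> ss; rewrite (path_sortedE ltn_trans); apply/andP; split.
  rewrite all_cat; apply/andP; split; apply/allP => k.
    by rewrite mem_iota => /andP[].
  by case/mapP => i _ ->.
rewrite (sorted_pairwise ltn_trans) pairwise_cat; apply/and3P; split.
- apply/allrelP => x y; rewrite mem_iota => /andP[_ xM] /mapP[i _ ->].
  by rewrite (leq_trans xM)// add1n leq_addr.
- by rewrite -(sorted_pairwise ltn_trans) iota_ltn_sorted.
rewrite -(sorted_pairwise ltn_trans) sorted_map; apply: sub_sorted ss.
by move=> x y /=; rewrite ltn_add2l.
Qed.

Hypothesis IK : forall x, inI x -> `|x| <= K.
Hypothesis MK : 5 * K ^+ 2 <= M%:R.

Lemma first_near l Z : exists l1 l2, [/\ l = l1 ++ l2,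
  forall v, v \in l1 -> K < `|v.2| &
  (l2 = [::] \/ `|(head Z l2).2| <= K)].
Proof.
elim: l => [|x l [l1 [l2 [-> h1 h2]]]]; first by exists [::], [::]; split => //; left.
have [xK|xK] := leP `|x.2| K.
  by exists [::], (x :: l1 ++ l2); split => //; right.
by exists (x :: l1), l2; split => // v; rewrite inE => /predU1P[->//|/h1].
Qed.

(** Let u be the first vertex near the axis (or the end Z), and suppose that it
    lies in the j-th cell. Before u the list visits at most (j + 1) / 8 points.
    Collecting one point in each furnished window up to u gives M + j / 2 points
    for an energy of 1/8 each, and the last leg, from the strip to u, costs at
    most (2 K)^2 <= 4/5 M. If u = Z, its distance to the axis is only
    bounded by r, but then j is large. *)
Lemma halfgood_reroute S tau p0 (r : R) : halfgood S tau p0 ->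
  exists T, forall l Z, T <= Z.1 -> `|Z.2| <= r -> path earlier p0 (rcons l Z) ->
    [set` l] `<=` S ->
    exists l1 l2 W, let u := head Z l2 in
    [/\ l = l1 ++ l2, path earlier p0 (rcons W u), [set` W] `<=` S &
        energy p0 (rcons W u) - (size W)%:R <= 8^-1 - (size l1)%:R].
Proof.
move=> [[/andP[tp pt] p0I] hslab hbetween hcells hout].
(* Beyond j1 cells the windows collected pay for a leg of height r + K. *)
have [j1 j1E] : exists j1 : nat, 4 * (r + K) ^+ 2 <= j1%:R.
  exists (Num.truncn (4 * (r + K) ^+ 2)).+1; apply/ltW/truncnS_gt.
exists (slab_end tau + ell%:R * (j1%:R + 1)) => l Z TZ Zr pl lS.
have [l1 [l2 [lE l1K l2K]]] := first_near l Z.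
exists l1, l2.
have K0 : 0 <= K by apply: le_trans (IK p0I).
have ell0 : 0 < ell%:R :> R by have := ellR2; lra.
have slabZ : slab_end tau < Z.1.
  have := mulr_gt0 ell0 (ltr_wpDl (ler0n R j1) ltr01); lra.
have l1out v : v \in l1 -> slab_end tau <= v.1.
  move=> vl1; have vl : v \in l by rewrite lE mem_cat vl1.
  rewrite leNgt; apply/negP => vs.
  have [|_ /IK] := hbetween v (lS _ vl) _ vs.
    by have /andP[] := path_rcons_time pl vl.
  by rewrite leNgt l1K.
set u := head Z l2.
have ul : rcons l Z = l1 ++ u :: behead (rcons l2 Z).
  by rewrite lE rcons_cat /u; case: (l2).
have uT v : v \in l1 -> v.1 < u.1.
  move: pl; rewrite ul => /path_sorted; rewrite (sorted_pairwise earlier_trans).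
  rewrite pairwise_cat => /andP[/allrelP h _] vl1.
  by apply: h => //; exact: mem_head.
have pu : p0.1 < u.1.
  move: pl => /(order_path_min (@earlier_trans _))/allP; apply.
  by rewrite ul mem_cat mem_head orbT.
(* In the slab the points all lie over I: u is within one short leg of p0. *)
have [us|us] := ltP u.1 (slab_end tau).
  have l10 : l1 = [::].
    case: (l1) l1out uT => // x s /(_ _ (mem_head _ _)) h1 /(_ _ (mem_head _ _)) h2.
    by move: (lt_trans (le_lt_trans h1 h2) us); rewrite ltxx.
  exists [::]; rewrite l10 /= addr0 !subr0 andbT; split => //.
    by rewrite lE l10.
  case: l2 => [|x l2] in lE l2K @u ul uT pu us *.
    by move: (lt_trans us slabZ); rewrite ltxx.
  have xl : x \in l by rewrite lE mem_cat mem_head orbT.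
  have [gap xI] := hbetween _ (lS _ xl) pu us.
  exact: leg_short.
(* The cell that contains u. *)
pose j0 := Num.truncn ((u.1 - slab_end tau) / ell%:R).
have [j0l j0u] : slab_end tau + ell%:R * j0%:R <= u.1 /\
    u.1 <= slab_end tau + ell%:R * j0.+1%:R.
  split.
    rewrite -lerBrDl -ler_pdivlMl// mulrC.
    by rewrite truncn_le divr_ge0 ?subr_ge0// ltW.
  by rewrite -lerBlDl -ler_pdivrMl// mulrC; exact/ltW/truncnS_gt.
have sl1 : (8 * size l1 <= j0.+1)%N.
  apply: hout => // [|q ql1].
    have := path_earlier_uniq pl; rewrite lE rcons_cat cat_uniq.
    by case/and3P.
  split; [by apply: lS; rewrite /= lE mem_cat ql1| |exact: l1K].
  by rewrite l1out//= (le_trans _ j0u)// ltW// uT.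
have [s [ss sj js hs]] := hcells j0.
pose ks := iota 1 M ++ map (addn M.+1) s.
have pks : path ltn 0 ks by exact: windows_path.
have [| | |W [sW pW WS eW [lW lWI]]] := @collect S tau 0 ks p0 pks.
- by rewrite /wnd leq0n /=; lra.
- by [].
- move=> k; rewrite mem_cat => /orP[|/mapP[i /hs + ->//]].
  by rewrite mem_iota add1n => kM; apply: hslab.
have lWu : (last p0 W).1 + 2^-1 <= u.1.
  have : last 0%N ks \in 0%N :: ks by exact: mem_last.
  have wslab k : (k <= M)%N -> (wnd tau k).2 + 2^-1 <= slab_end tau.
    move=> kM; have : k%:R <= M%:R :> R by rewrite ler_nat.
    by rewrite /wnd kM /= /slab_end; lra.
  have wu k : (wnd tau k).2 + 2^-1 <= u.1 -> (wnd tau (last 0%N ks)).2 <= (wnd tau k).2 ->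
    (last p0 W).1 + 2^-1 <= u.1.
    by lra.
  rewrite inE mem_cat => /predU1P[lk|/orP[lk|/mapP[i /(allP sj) /= ij lk]]].
  - by apply: (wu 0%N); [apply: le_trans us; apply: wslab|rewrite lk].
  - apply: (wu (last 0%N ks)) => //; apply: le_trans us; apply: wslab.
    by move: lk; rewrite mem_iota add1n => /andP[].
  - apply: (wu (last 0%N ks)) => //; apply: le_trans j0l; rewrite lk /wnd.
    rewrite leqNgt leq_addr /= addKn.
    have : i%:R + 1 <= j0%:R :> R by rewrite natr1 ler_nat.
    move=> /(ler_wpM2l (ltW ell0)); lra.
exists W; split => //.
  by rewrite rcons_path pW /earlier; lra.
rewrite energy_rcons.
have sWR : M%:R + j0%:R / 2 <= (size W)%:R :> R.
  rewrite sW size_cat size_iota size_map natrD lerD2l ler_pdivrMr//.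
  by rewrite -natrM ler_nat mulnC.
have sl1R : 8 * (size l1)%:R <= j0%:R + 1 :> R.
  by rewrite natr1 -natrM ler_nat.
have lWK := IK lWI.
suff : leg (last p0 W) u <= 7 / 8 * M%:R + 5 / 16 * j0%:R by lra.
have j00 : 0 <= j0%:R :> R by [].
case: l2 => [|x l2] in lE l2K @u ul uT pu us j0 j0l j0u sl1 sj js lWu sWR sl1R j00 *.
  have D : `|u.2 - (last p0 W).2| <= r + K.
    by apply: le_trans (ler_normB _ _) _; exact: lerD.
  apply: le_trans (leg_long D lWu) _.
  have : j1%:R <= j0%:R :> R.
    rewrite ler_nat -ltnS -(ltr_nat R) -(ltr_pM2l ell0).
    move: TZ j0u; rewrite /u /=; have := ell0; lra.
  have := ler0n R M; lra.
have xK : `|u.2| <= K by case: l2K.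
have D : `|u.2 - (last p0 W).2| <= 2 * K.
  by apply: le_trans (ler_normB _ _) _; rewrite mulr_natl mulr2n; exact: lerD.
apply: le_trans (leg_long D lWu) _.
have -> : (2 * K) ^+ 2 = 4 * K ^+ 2 by ring.
exact: long_leg_bound.
Qed.

Definition flip p : R * R := (- p.1, p.2).

Lemma flipK : involutive flip.
Proof. by move=> [t x]; rewrite /flip opprK. Qed.

Lemma leg_flip p q : leg (flip p) (flip q) = leg p q.
Proof. by rewrite /leg /= -opprD normrN. Qed.

Lemma energy_flip p l : energy (flip p) (map flip l) = energy p l.
Proof. by elim: l p => //= q l ih p; rewrite ih leg_flip. Qed.

(** Reversal of time maps the slab from tau to tau + 1 to the one from
    - (tau + 1) to - tau, hence the base point of the second condition. *)
Definition goodpoint S tau p0 := [/\ S p0, forall q, S q -> q.1 = p0.1 -> q = p0,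
  halfgood S tau p0 & halfgood (flip @^-1` S) (- (tau + 1)) (flip p0)].

Lemma path_flip p l q :
  path earlier (flip q) (rcons (map flip (rev l)) (flip p)) = path earlier p (rcons l q).
Proof.
rewrite -map_rcons path_map -rev_cons.
rewrite (@eq_path _ _ (fun x y => earlier y x)); last first.
  by move=> x y; rewrite /= /earlier /= ltrN2.
rewrite -[q in LHS](last_rcons p l).
by rewrite -[RHS]rev_path belast_rcons.
Qed.

Lemma reroute_left S tau p0 (r : R) :
  halfgood (flip @^-1` S) (- (tau + 1)) (flip p0) ->
  exists T, forall P l, P.1 <= - T -> `|P.2| <= r -> path earlier P (rcons l p0) ->
    [set` l] `<=` S ->
    exists l1 l2 W, let u := last P l1 in
    [/\ l = l1 ++ l2, path earlier u (rcons W p0), [set` W] `<=` S &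
        energy u (rcons W p0) - (size W)%:R <= 8^-1 - (size l2)%:R].
Proof.
move=> /(halfgood_reroute r)[T hT]; exists T => P l PT Pr pl lS.
have [||||l2 [l1 [W [lE pW WS eW]]]] := hT (map flip (rev l)) (flip P).
- by rewrite /= lerNr.
- by [].
- by rewrite path_flip.
- by move=> v /= /mapP[w]; rewrite mem_rev => /lS Sw ->; rewrite /= flipK.
exists (rev (map flip l1)), (rev (map flip l2)), (rev (map flip W)).
have uE : last P (rev (map flip l1)) = flip (head (flip P) l1).
  by case: (l1) => [|x s] /=; rewrite ?flipK// rev_cons last_rcons.
rewrite uE; split.
- by rewrite -rev_cat -map_cat -lE (mapK flipK) revK.
- by rewrite -map_rev -[p0]flipK path_flip.
- by move=> v /=; rewrite mem_rev => /mapP[w /WS Sw ->].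
- by rewrite energy_rev revK !size_rev !size_map -map_rcons -[p0]flipK energy_flip.
Qed.

(** Rerouting on both sides through p0 costs 1/8 + 1/8 more than the optimal
    chain at most, but visits p0, which gains 1. *)
Lemma goodpoint_attracts S tau p0 (r : R) : goodpoint S tau p0 ->
  exists T, forall P Q V, P.1 <= - T -> T <= Q.1 -> `|P.2| <= r -> `|Q.2| <= r ->
    minchain S P V Q -> p0 \in V.
Proof.
move=> [Sp0 p0_only hr hl].
have [T1 hT1] := halfgood_reroute r hr.
have [T2 hT2] := reroute_left r hl.
exists (Num.max (Num.max T1 T2) (`|p0.1| + 1)) => P Q V.
rewrite lerNr !ge_max => /andP[/andP[PT1 PT2] Pp] /andP[/andP[QT1 QT2] Qp] Pr Qr.
move=> [[pV VS] Vmin]; apply/negPn/negP => p0V.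
have [||L1 [L2 [VE L1lt L2gt]]] := @sorted_split_time _ p0.1 V.
- by have := path_sorted pV; rewrite sorted_rcons_all => /andP[].
- move=> v vV; apply: contra p0V => /eqP vp.
  by rewrite -(p0_only v)//; exact: VS.
have Pp0 : P.1 < p0.1 by have := ler_norm (- p0.1); rewrite normrN; lra.
have Qp0 : p0.1 < Q.1 by have := ler_norm p0.1; lra.
have pL1 : path earlier P (rcons L1 p0).
  rewrite rcons_path; move: pV; rewrite VE rcons_cat cat_path => /andP[-> _]/=.
  case/lastP: (L1) L1lt => // s x /(_ x); rewrite mem_rcons mem_head last_rcons.
  exact.
have pL2 : path earlier p0 (rcons L2 Q).
  move: pV; rewrite VE rcons_cat cat_path => /andP[_].
  case: (L2) L2gt => [|x s] h; rewrite /= /earlier ?Qp0//.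
  by move=> /andP[_ ->]; rewrite h// mem_head.
have L1S : [set` L1] `<=` S by move=> v vl; apply: VS; rewrite /= VE mem_cat vl.
have L2S : [set` L2] `<=` S by move=> v vl; apply: VS; rewrite /= VE mem_cat vl orbT.
have [A1 [A2 [WL [L1E pWL WLS eWL]]]] := hT2 P L1 ltac:(lra) Pr pL1 L1S.
have [B2 [B1 [WR [L2E pWR WRS eWR]]]] := hT1 L2 Q ltac:(lra) Qr pL2 L2S.
have B1Q : rcons B1 Q = head Q B1 :: behead (rcons B1 Q) by case: (B1).
(* A1 and B1 are kept; the new chain goes through p0 between them. *)
pose N := A1 ++ WL ++ p0 :: WR ++ B1.
have NE : rcons N Q = A1 ++ (rcons WL p0) ++ (rcons WR (head Q B1)) ++ behead (rcons B1 Q).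
  by rewrite /N !(rcons_cat, rcons_cons) B1Q -!cats1 -!catA.
have : chain S P N Q.
  split.
    rewrite NE cat_path cat_path last_rcons cat_path last_rcons pWL pWR /=.
    move: pL1; rewrite L1E rcons_cat cat_path => /andP[-> _] /=.
    by move: pL2; rewrite L2E rcons_cat cat_path B1Q /= => /andP[_ /andP[]].
  move=> v /=; rewrite !(mem_cat, inE) => /or4P[vA|/WLS//|/eqP->//|/orP[/WRS//|vB]].
    by apply: L1S; rewrite /= L1E mem_cat vA.
  by apply: L2S; rewrite /= L2E mem_cat vB orbT.
move=> /Vmin; apply/negP; rewrite -ltNge /cost NE VE L1E L2E.
set hq := head Q B1 in B1Q pWR eWR *; set tl := behead _ in B1Q *.
have -> : energy P (A1 ++ rcons WL p0 ++ rcons WR hq ++ tl) =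
    energy P A1 + (energy (last P A1) (rcons WL p0) +
      (energy p0 (rcons WR hq) + energy hq tl)).
  by rewrite !energy_cat !last_rcons.
set a := last P A1 in pWL eWL *; set b := last a A2.
have -> : energy P (rcons ((A1 ++ A2) ++ B2 ++ B1) Q) =
    energy P A1 + energy a A2 + (energy b B2 + (leg (last b B2) hq + energy hq tl)).
  by rewrite rcons_cat energy_cat energy_cat last_cat rcons_cat B1Q energy_cat.
have -> : (size N)%:R = (size A1)%:R + (size WL)%:R + (size WR)%:R + (size B1)%:R + 1 :> R.
  by rewrite /N !size_cat /= !size_cat !addnS -natr1 !natrD !addrA.
rewrite !size_cat !natrD.
have := energy_ge0 a A2; have := energy_ge0 b B2; have := leg_ge0 (last b B2) hq.
move: eWL eWR; clear.
lra.
Qed.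

End attraction.

(** * Functions that are linear along a polygon *)

Section polygons.
Context {R : realType}.
Implicit Types (g h : R -> R) (p q u v P Q : R * R) (s l : seq (R * R)) (t a b c d x y : R) (r : seq R).

(** This determines the function only between the times of p and of the last
    vertex. *)
Fixpoint along g p s : Prop := g p.1 = p.2 /\
  (if s is q :: s' then linear_on `[p.1, q.1] g /\ along g q s' else True).

Lemma alongP g p s : along g p s -> forall v, v \in p :: s -> g v.1 = v.2.
Proof.
elim: s p => [|q s ih] p /= [gp].
  by move=> _ v; rewrite inE => /eqP ->.
by move=> [_ /ih h] v; rewrite inE => /predU1P[->//|/h].
Qed.

Lemma along_ext g h p s : path earlier p s ->
  (forall t, p.1 <= t <= (last p s).1 -> g t = h t) -> along g p s -> along h p s.
Proof.
elim: s p => [|q s ih] p /=.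
  by move=> _ gh [gp _]; rewrite -gh ?lexx.
move=> /andP[pq qs] gh [gp [[a [b gl]] gs]].
have ql : q.1 <= (last q s).1.
  have := order_path_min (@earlier_trans _) qs.
  case/lastP: (s) => // s' z; rewrite last_rcons all_rcons => /andP[+ _].
  exact: ltW.
split; first by rewrite -gh// lexx/= ltW// (lt_le_trans pq).
split.
  exists a, b => t /=; rewrite in_itv/= => tpq; rewrite -gh; last first.
    by move: tpq => /andP[-> tq]; rewrite (le_trans tq).
  by apply: gl; rewrite /= in_itv.
by apply: ih => // t /andP[qt tl]; apply: gh; rewrite tl andbT (le_trans _ qt)// ltW.
Qed.

Lemma last_earlier p s : path earlier p s -> p.1 <= (last p s).1.
Proof.
move=> /(order_path_min (@earlier_trans _)).
by case/lastP: s => // s z; rewrite last_rcons all_rcons => /andP[+ _]; exact: ltW.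
Qed.

Definition line p q t : R := (q.2 - p.2) / (q.1 - p.1) * (t - p.1) + p.2.

Lemma line_right p q : p.1 < q.1 -> line p q q.1 = q.2.
Proof. by move=> pq; rewrite /line divfK ?subrK// subr_eq0 gt_eqF. Qed.

Lemma line_left p q : line p q p.1 = p.2.
Proof. by rewrite /line subrr mulr0 add0r. Qed.

Lemma linear_lineP g p q : p.1 < q.1 -> g p.1 = p.2 -> g q.1 = q.2 ->
  linear_on `[p.1, q.1] g <-> forall t, p.1 <= t <= q.1 -> g t = line p q t.
Proof.
move=> pq gp gq; split => [[a [b gl]]|gl].
  have pE : g p.1 = a * p.1 + b by apply: gl; rewrite /= in_itv/= lexx ltW.
  have qE : g q.1 = a * q.1 + b by apply: gl; rewrite /= in_itv/= lexx ltW.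
  move=> t tpq; rewrite gl ?inE ?in_itv//.
  have aE : (q.2 - p.2) / (q.1 - p.1) = a.
    by rewrite -gp -gq pE qE; field; rewrite subr_eq0 gt_eqF.
  by rewrite /line aE -gp pE; ring.
exists ((q.2 - p.2) / (q.1 - p.1)), (p.2 - (q.2 - p.2) / (q.1 - p.1) * p.1) => t.
by rewrite /= in_itv/= => /gl ->; rewrite /line; ring.
Qed.

Fixpoint interp p s t : R :=
  if s is q :: s' then if t <= q.1 then line p q t else interp q s' t else p.2.

Lemma interp_left p s : path earlier p s -> interp p s p.1 = p.2.
Proof. by case: s => //= q s /andP[pq _]; rewrite ltW//= line_left. Qed.

Lemma along_interp p s : path earlier p s -> along (interp p s) p s.
Proof.
elim: s p => [|q s ih] p; first by [].
move=> ps; have ips := interp_left ps; move: ps => /= /andP[pq qs].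
split; first by rewrite -[RHS]ips.
split.
  exists ((q.2 - p.2) / (q.1 - p.1)), (p.2 - (q.2 - p.2) / (q.1 - p.1) * p.1) => t.
  by rewrite /= in_itv/= => /andP[_ ->]; rewrite /line; ring.
apply: along_ext (ih _ qs) => // t /andP[]; rewrite le_eqVlt => /predU1P[<- _|qt _].
  by rewrite lexx line_right// interp_left.
by rewrite leNgt qt.
Qed.

Notation mu := (@lebesgue_measure R).

Lemma linear_derive1 g a b c d t : (forall x, a < x < b -> g x = c * x + d) ->
  a < t < b -> derive1 g t = c.
Proof.
move=> gE tab; rewrite derive1E.
have tI : t \in `]a, b[ by rewrite in_itv.
have /near_eq_derive <- : \forall u \near t, c * u + d = g u.
  by move: (near_in_itvoo tI); apply: filterS => u; rewrite in_itv /= => /gE ->.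
have H : is_derive t 1 ((c *: (@id R)) + cst d) (c *: 1 + 0).
  exact: is_deriveD.
have -> : (fun x => c * x + d) = ((c *: (@id R)) + cst d) by [].
by rewrite derive_val addr0 /GRing.scale/= mulr1.
Qed.

Definition speed2 g (t : R) : \bar R := ((derive1 g t) ^+ 2)%:E.

(** The derivative is only known in the open interval, which has full measure. *)
Lemma linear_kinetic g p q : p.1 < q.1 -> g p.1 = p.2 -> g q.1 = q.2 ->
  linear_on `[p.1, q.1] g ->
  measurable_fun `[p.1, q.1] (speed2 g) /\
  (\int[mu]_(t in `[p.1, q.1]) speed2 g t = (2 * leg p q)%:E)%E.
Proof.
move=> pq gp gq /(linear_lineP pq gp gq) gl.
set f := speed2 g.
set k := (q.2 - p.2) / (q.1 - p.1).
have fE t : p.1 < t < q.1 -> f t = (k ^+ 2)%:E.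
  move=> tpq; rewrite /f /speed2; congr ((_ ^+ 2)%:E).
  apply: (@linear_derive1 g p.1 q.1 k (p.2 - k * p.1)) => // x /andP[px xq].
  by rewrite gl ?(ltW px) ?(ltW xq)// /line -/k; ring.
have moo : measurable_fun `]p.1, q.1[ f.
  apply: (eq_measurable_fun (cst (k ^+ 2)%:E)) => [t|].
    by rewrite inE/= in_itv/= => /fE ->.
  exact: measurable_cst.
have moc : measurable_fun `]p.1, q.1] f by apply/emeasurable_fun_itv_bndo_bndcP.
have mcc : measurable_fun `[p.1, q.1] f by apply/emeasurable_fun_itv_obnd_cbndP.
split => //.
rewrite -integral_itv_obnd_cbnd// -integral_itv_bndo_bndc//.
under eq_integral => t.
  rewrite inE/= in_itv/= => /fE ->; over.
rewrite integral_cst//= lebesgue_measure_itv/= lte_fin pq -EFinD -EFinM.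
congr (_%:E); rewrite legE// /k.
by field; rewrite subr_eq0 gt_eqF.
Qed.

Lemma along_kinetic_ereal g p s : path earlier p s -> along g p s ->
  measurable_fun `[p.1, (last p s).1] (speed2 g) /\
  (\int[mu]_(t in `[p.1, (last p s).1]) speed2 g t = (2 * energy p s)%:E)%E.
Proof.
elim: s p => [|q s ih] p.
  move=> _ _ /=; rewrite set_itv1; split; first exact: measurable_fun_set1.
  by rewrite integral_set1 mulr0.
move=> /= /andP[pq qs] [gp [gl gs]].
have ql := last_earlier qs.
have gq : g q.1 = q.2 by apply: alongP gs _ (mem_head _ _).
have [m1 i1] := linear_kinetic pq gp gq gl.
have [m2 i2] := ih _ qs gs.
have m3 : measurable_fun `]q.1, (last q s).1] (speed2 g).
  exact/emeasurable_fun_itv_obnd_cbndP.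
have E : `[p.1, (last q s).1]%classic = `[p.1, q.1] `|` `]q.1, (last q s).1] :> set R.
  by apply: itv_bndbnd_setU; rewrite bnd_simp// ltW.
rewrite E; split; first exact/measurable_funU.
rewrite ge0_integral_setU//=.
- by rewrite i1 integral_itv_obnd_cbnd// i2 mulrDr.
- exact/measurable_funU.
- by move=> x _; rewrite lee_fin sqr_ge0.
- apply/disj_setPS => y [/=]; rewrite 2!in_itv/= => /andP[_ yx] /andP[].
  by rewrite ltNge yx.
Qed.

Lemma along_kinetic g p s : path earlier p s -> along g p s ->
  2^-1 * (\int[mu]_(t in `[p.1, (last p s).1]) ((derive1 g t) ^+ 2)) = energy p s.
Proof.
move=> ps gs; rewrite /Rintegral -/(speed2 g) (along_kinetic_ereal ps gs).2 /=.
by rewrite mulrA mulVf ?mul1r.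
Qed.

(** Where a path does not switch. *)
Definition affine_at g t := exists a b : R, \forall u \near t, g u = a * u + b.

Fixpoint pieces g a r : Prop :=
  if r is b :: r' then linear_on `[a, b] g /\ pieces g b r' else True.

Lemma piecesP g a r : pieces g a r <-> forall i, (i < size r)%N ->
  linear_on `[nth a (a :: r) i, nth a (a :: r) i.+1] g.
Proof.
suff H d : pieces g a r <-> forall i, (i < size r)%N ->
  linear_on `[nth d (a :: r) i, nth d (a :: r) i.+1] g by exact: H.
elim: r a => [|b r ih] a /=; first by split.
split=> [[gab /ih gr] [|i]//|h]; first exact: gr.
split; first exact: (h 0%N).
by apply/ih => i ir; exact: (h i.+1).
Qed.

Lemma affine_eq2 (a b a' b' x y : R) : x != y -> a * x + b = a' * x + b' ->
  a * y + b = a' * y + b' -> a = a' /\ b = b'.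
Proof.
move=> xy ex ey.
have : (a - a') * (x - y) = 0 by lra.
move/eqP; rewrite mulf_eq0 !subr_eq0 (negPf xy) orbF => /eqP aa'.
by split => //; move: ex; rewrite aa' => /addrI.
Qed.

(** If the function is affine near the common end of two pieces, then both have
    the same slope there and merge into one. *)
Lemma pieces_affine g a r c d : path <%R a r -> pieces g a r ->
  (forall t, c < t < d -> affine_at g t) ->
  exists k m, forall t, a <= t <= last a r -> c <= t <= d -> g t = k * t + m.
Proof.
elim: r a => [|b r ih] a /=.
  move=> _ _ _; exists 0, (g a) => t; rewrite -eq_le => /eqP <- _.
  by rewrite mul0r add0r.
move=> /andP[ab br] [[k1 [m1 g1]] gr] aff.
have {}g1 t : a <= t <= b -> g t = k1 * t + m1 by move=> tab; apply: g1; rewrite /= in_itv.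
have [k2 [m2 g2]] := ih _ br gr aff.
have bl : b <= last b r.
  have := order_path_min (@lt_trans _ R) br.
  by case/lastP: (r) => // s z; rewrite last_rcons all_rcons => /andP[+ _]; exact: ltW.
have [bc|cb] := leP b c.
  exists k2, m2 => t /andP[at_ tl] /andP[ct td]; apply: g2; rewrite ?ct ?td//.
  by rewrite tl andbT (le_trans bc).
have [db|bd] := leP d b.
  exists k1, m1 => t /andP[at_ tl] /andP[ct td]; apply: g1.
  by rewrite at_ (le_trans td).
move: bl; rewrite le_eqVlt => /predU1P[bl|bl].
  by exists k1, m1 => t; rewrite -bl => /g1.
have [|k [m /nbhs_ballP[e /= e0 he]]] := aff b; first by rewrite cb bd.
have near_b t : `|b - t| < e -> g t = k * t + m by move=> h; apply: he.
pose x := Num.max (Num.max a c) (b - e / 2).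
pose y := Num.min (Num.min (last b r) d) (b + e / 2).
have [xa xc xe xb] : [/\ a <= x, c <= x, b - e / 2 <= x & x < b].
  by rewrite /x !le_max !lexx !orbT !gt_max ab cb/=; split => //; lra.
have [yl yd ye yb] : [/\ y <= last b r, y <= d, y <= b + e / 2 & b < y].
  by rewrite /y !ge_min !lexx !orbT !lt_min bl bd/=; split => //; lra.
have [k1k m1m] : k1 = k /\ m1 = m.
  apply: (@affine_eq2 _ _ _ _ x b); rewrite ?lt_eqF//.
    by rewrite -g1 ?near_b//; [rewrite gtr0_norm; lra|rewrite xa ltW].
  by rewrite -g1 ?near_b//; [rewrite subrr normr0|rewrite lexx ltW].
have [k2k m2m] : k2 = k /\ m2 = m.
  apply: (@affine_eq2 _ _ _ _ y b); rewrite ?gt_eqF//.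
    rewrite -g2 ?near_b//; first by rewrite ltr0_norm; lra.
    - by rewrite yl ltW.
    - by rewrite yd (le_trans _ (ltW yb))// ltW.
  rewrite -g2 ?near_b//; first by rewrite subrr normr0.
  - by rewrite lexx ltW.
  - by rewrite !ltW.
exists k, m => t /andP[at_ tl] tcd.
have [tb|bt] := leP t b; first by rewrite g1 ?at_// k1k m1m.
by rewrite g2 ?k2k ?m2m// tl ltW.
Qed.

End polygons.

(** * Admissible paths as chains *)

Section visited.
Context {R : realType}.
Implicit Types (w : configuration R) (g h : R -> R) (p q u v P Q : R * R) (s l V : seq (R * R)) (t a b c d x y : R) (r : seq R).

Lemma bounded_setP (B : set (R * R)) (M : R) :
  (forall p, B p -> `|p.1| <= M /\ `|p.2| <= M) -> bounded_set B.
Proof.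
move=> BM; exists M; split; first exact: num_real.
move=> y My p Bp; have [h1 h2] := BM p Bp.
by rewrite /= prod_normE ge_max !(le_trans _ (ltW My)).
Qed.

Lemma npoints_seq s : uniq s -> npoints [set` s] = size s.
Proof.
move=> us; rewrite /npoints.
have -> : [set` s] = [set` [fset x in s]%fset] by apply/seteqP; split => x /=; rewrite inE.
by rewrite set_fsetK card_fseq undup_id.
Qed.

Lemma along_continuous g p s : path earlier p s -> along g p s -> s != [::] ->
  {within `[p.1, (last p s).1], continuous g}.
Proof.
elim: s p => // q s ih p /= /andP[pq qs] [gp [[a [b gl]] gs]] _.
have cont1 : {within `[p.1, q.1], continuous g}.
  apply: (@subspace_eq_continuous _ _ _ (fun t => a * t + b)).
    by move=> t; rewrite inE => /gl.
  apply: continuous_subspaceT => t; apply: cvgD; last exact: cvg_cst.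
  by apply: cvgM; [exact: cvg_cst|exact: cvg_id].
case: s => [|q' s] in ih qs gs *; first by [].
have -> : `[p.1, (last q (q' :: s)).1]%classic =
    `[p.1, q.1] `|` `[q.1, (last q (q' :: s)).1] :> set R.
  have ql := last_earlier qs.
  apply/seteqP; split=> t /=; rewrite !in_itv/=.
    by move=> /andP[-> ->]; rewrite andbT; apply/orP/le_total.
  move=> [/andP[-> tq]|/andP[qt ->]]; first by rewrite (le_trans tq).
  by rewrite andbT (le_trans _ qt)// ltW.
by apply: withinU_continuous; [exact: itv_closed|exact: itv_closed|exact: cont1|exact: ih].
Qed.

Lemma affine_at_itv g a b t : linear_on `[a, b] g -> a < t < b -> affine_at g t.
Proof.
move=> [k [m gl]] tab; exists k, m.
have tI : t \in `]a, b[ by rewrite in_itv.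
move: (near_in_itvoo tI); apply: filterS => u; rewrite in_itv /= => /andP[au ub].
by apply: gl; rewrite /= in_itv/= !ltW.
Qed.

Lemma along_switching g p s t : path earlier p s -> along g p s ->
  p.1 < t < (last p s).1 -> ~ affine_at g t -> t \in map fst s.
Proof.
elim: s p => [|q s ih] p /=.
  by move=> _ _ /andP[/lt_trans h /h]; rewrite ltxx.
move=> /andP[pq qs] [gp [gl gs]] /andP[pt tl] naff; rewrite inE.
case: (ltgtP t q.1) => //= [tq|qt]; last by apply: ih qs gs _ naff; rewrite qt.
by exfalso; apply: naff; apply: affine_at_itv gl _; rewrite pt.
Qed.

Lemma along_pieces g p s : along g p s -> pieces g p.1 (map fst s).
Proof. by elim: s p => //= q s ih p [_ [gl /ih]]. Qed.

Lemma along_partition p s : path earlier p s ->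
  itv_partition p.1 (last p s).1 (map fst s).
Proof. by move=> ps; split; [rewrite path_map|rewrite last_map]. Qed.

Lemma along_admissible w P l Q g : chain w P l Q -> along g P (rcons l Q) ->
  admissible w P.1 P.2 Q.1 Q.2 g.
Proof.
move=> [pl lw] gl; have lQ : last P (rcons l Q) = Q by rewrite last_rcons.
have gv := alongP gl.
split.
- by rewrite -[in Q.1]lQ; apply: along_continuous => //; case: (l).
- exists (map fst (rcons l Q)); first by rewrite -[in Q.1]lQ; exact: along_partition.
  by apply/piecesP/along_pieces.
- by apply: gv; rewrite mem_head.
- by apply: gv; rewrite inE mem_rcons mem_head orbT.
- move=> t [/andP[Pt tQ] naff].
  have := @along_switching g P (rcons l Q) t pl gl.
  rewrite last_rcons Pt tQ => /(_ isT naff) /mapP[v].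
  rewrite mem_rcons inE => /predU1P[->|vl ->]; first by move=> tE; rewrite tE ltxx in tQ.
  rewrite gv; last by rewrite inE mem_rcons inE vl !orbT.
  by rewrite -surjective_pairing; exact: lw.
Qed.

(** A piecewise linear function that switches only at some of the vertices is
    linear on each leg; extra vertices in the middle of a piece do no harm. *)
Lemma along_noswitch g t0 r p s : path <%R t0 r -> pieces g t0 r ->
  t0 <= p.1 -> (last p s).1 <= last t0 r -> path earlier p s ->
  (forall v, v \in p :: s -> g v.1 = v.2) ->
  (forall t, p.1 < t < (last p s).1 -> ~ affine_at g t -> t \in map fst s) ->
  along g p s.
Proof.
move=> t0r gr; elim: s p => [|q s ih] p t0p lr /=.
  by move=> _ gv _; split => //; apply: gv; exact: mem_head.
move=> /andP[pq qs] gv sw; split; first by apply: gv; exact: mem_head.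
have ql := last_earlier qs.
split; last first.
  apply: ih => //; first by rewrite (le_trans t0p)// ltW.
    by move=> v vs; apply: gv; rewrite inE vs orbT.
  move=> t /andP[qt tl] naff; have := sw t.
  by rewrite tl (lt_trans pq qt) => /(_ isT naff); rewrite inE gt_eqF.
have [t /andP[pt tq]|k [m gE]] := pieces_affine (c := p.1) (d := q.1) t0r gr.
  apply: contrapT => naff; have := sw t.
  rewrite pt (lt_le_trans tq ql) => /(_ isT naff); rewrite inE lt_eqF//=.
  move=> /mapP[v vs tE]; move: tq; rewrite tE ltNge ltW//.
  by have := order_path_min (@earlier_trans _) qs; move=> /allP/(_ _ vs).
exists k, m => t; rewrite /= in_itv/= => /andP[pt tq]; apply: gE; last by rewrite pt.
by rewrite (le_trans t0p pt) (le_trans tq)// (le_trans ql).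
Qed.

(** The visits at the ends, the same for all paths with these ends. *)
Definition end_points w P Q : nat := `[< points w P >] + `[< points w Q >].

Lemma visitsE w P Q V g : path earlier P (rcons V Q) -> g P.1 = P.2 -> g Q.1 = Q.2 ->
  (forall v, v \in V <-> [/\ points w v, P.1 < v.1 < Q.1 & g v.1 = v.2]) ->
  visits w P.1 Q.1 g = (size V + end_points w P Q)%N.
Proof.
move=> pV gP gQ VE; rewrite /visits.
have uV := path_earlier_uniq pV.
have PQ : P.1 < Q.1.
  by have := order_path_min (@earlier_trans _) pV; rewrite all_rcons => /andP[].
pose s := (if `[< points w P >] then [:: P] else [::]) ++ V ++
  (if `[< points w Q >] then [:: Q] else [::]).
have -> : w `&` [set p | P.1 <= p.1 <= Q.1 /\ g p.1 = p.2] = [set` s].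
  apply/seteqP; split => [v /= [wv [/andP[Pv vQ] gv]]|v /=].
    rewrite /s !mem_cat.
    move: Pv vQ; rewrite !le_eqVlt => /predU1P[Pv _|Pv /predU1P[vQ|vQ]].
    - have vP : v = P by rewrite [v]surjective_pairing [P]surjective_pairing -Pv -gP -gv Pv.
      by rewrite -vP; case: asboolP => // _; rewrite mem_head.
    - have -> : v = Q by rewrite [v]surjective_pairing [Q]surjective_pairing -gQ -gv vQ.
      case: (asboolP (points w Q)) => [_|]; first by rewrite mem_head !orbT.
      by case; rewrite [Q]surjective_pairing -gQ -vQ gv -surjective_pairing.
    - by apply/or3P/Or32/VE; split => //; rewrite Pv.
  rewrite /s !mem_cat => /or3P[|/VE[? /andP[? ?] ?]|].
  - by case: asboolP => // wP; rewrite inE => /eqP ->; rewrite lexx ltW.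
  - by split => //; split => //; rewrite !ltW.
  - by case: asboolP => // wQ; rewrite inE => /eqP ->; rewrite lexx ltW.
rewrite npoints_seq; last first.
  rewrite /s; move: uV; rewrite rcons_uniq => /andP[QV uV].
  have PV : P \notin V by apply/negP => /VE[_]; rewrite ltxx.
  have PQ' : P != Q by apply: contraTneq PQ => ->; rewrite ltxx.
  case: asboolP => _; case: asboolP => _;
  by rewrite ?cats0 ?cats1 /= ?rcons_uniq ?mem_rcons ?inE ?negb_or ?PQ' ?PV ?QV ?uV.
rewrite /s !size_cat /end_points addnCA; congr addn.
by case: asboolP => _; case: asboolP => _.
Qed.

Lemma visited_finite w t0 t1 g : t0 <= t1 -> {within `[t0, t1], continuous g} ->
  finite_set (w `&` [set p | t0 < p.1 < t1 /\ g p.1 = p.2]).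
Proof.
move=> t01 gc; apply: points_locally_finite.
have [c _ gmax] := EVT_max t01 gc; have [d _ gmin] := EVT_min t01 gc.
apply: (@bounded_setP _ (Num.max (Num.max `|t0| `|t1|) (Num.max `|g c| `|g d|))).
move=> p [/andP[/ltW pt0 /ltW pt1] gp].
have pI : p.1 \in `[t0, t1] by rewrite in_itv/= pt0.
rewrite -gp !le_max; have := gmax _ pI; have := gmin _ pI.
have aux a b x : a <= x <= b -> (`|x| <= `|a|) || (`|x| <= `|b|).
  move=> /andP[ax xb]; have [x0|x0] := leP 0 x.
    by rewrite (ger0_norm x0) (le_trans xb (ler_norm _)) orbT.
  by rewrite (ltr0_norm x0) ltr0_norm ?lerN2 ?ax// (le_lt_trans ax).
move=> gd gc'; split; first by rewrite aux// pt0.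
by have := @aux (g d) (g c) (g p.1); rewrite gd gc' orbC => ->; rewrite ?orbT.
Qed.

(** An admissible path is followed through all the points that it visits, not
    only those where it switches: this makes its action a cost. They are finitely
    many, since the path stays in a bounded set. *)
Lemma visited_chain_sub w a x b y g t0 t1 : admissible w a x b y g ->
  a <= t0 -> t0 < t1 -> t1 <= b ->
  exists V, [/\ chain w (t0, g t0) V (t1, g t1),
    along g (t0, g t0) (rcons V (t1, g t1)) &
    forall v, v \in V <-> [/\ points w v, t0 < v.1 < t1 & g v.1 = v.2]].
Proof.
move=> [gc [r [ar /eqP rl] /piecesP gr] ga gb sw] at0 t01 t1b.
have gc' : {within `[t0, t1], continuous g}.
  apply: continuous_subspaceW gc => t /=; rewrite !in_itv/= => /andP[t0t tt1].
  by rewrite (le_trans at0)// (le_trans tt1).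
have /finite_seqP[F FE] := visited_finite w (ltW t01) gc'.
pose T := sort <=%R (undup (map fst F)).
pose V := [seq (t, g t) | t <- T].
have VE v : v \in V <-> [/\ points w v, t0 < v.1 < t1 & g v.1 = v.2].
  have FP u : (w `&` [set p | t0 < p.1 < t1 /\ g p.1 = p.2]) u <-> u \in F by rewrite FE.
  split=> [/mapP[t]|[wv vt gv]].
    rewrite mem_sort mem_undup => /mapP[u /FP[wu [ut gu]] ->] ->.
    by rewrite gu -surjective_pairing; split.
  apply/mapP; exists v.1; last by rewrite gv -surjective_pairing.
  by rewrite mem_sort mem_undup map_f//; apply/FP.
have sT : sorted <%R T.
  by rewrite lt_sorted_uniq_le sort_uniq undup_uniq sort_sorted//; exact: le_total.
have pV : path earlier (t0, g t0) (rcons V (t1, g t1)).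
  rewrite (path_sortedE (@earlier_trans R)) sorted_rcons_all all_rcons {1}/earlier /= t01/=.
  apply/and3P; split.
  - by apply/allP => v /VE[_ /andP[]].
  - by rewrite sorted_map.
  - by apply/allP => v /VE[_ /andP[]].
exists V; split => //; first by split => // v /VE[].
apply: (along_noswitch ar gr) => //=.
- by rewrite last_rcons rl.
- by move=> v; rewrite inE mem_rcons inE => /or3P[/eqP->//|/eqP->//|/VE[]].
rewrite last_rcons => t /andP[t0t tt1] naff.
have wt : points w (t, g t).
  by apply: sw; split => //; rewrite (le_lt_trans at0)// (lt_le_trans tt1).
apply/mapP; exists (t, g t) => //; rewrite mem_rcons inE; apply/orP; right.
by apply/VE; split => //; rewrite t0t.
Qed.

Lemma visited_chain w t0 x0 t1 x1 g : t0 < t1 -> admissible w t0 x0 t1 x1 g ->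
  exists V, [/\ chain w (t0, x0) V (t1, x1), along g (t0, x0) (rcons V (t1, x1)) &
    forall v, v \in V <-> [/\ points w v, t0 < v.1 < t1 & g v.1 = v.2]].
Proof.
move=> t01 adm; have := visited_chain_sub adm (lexx _) t01 (lexx _).
by case: adm => _ _ -> -> _.
Qed.

Lemma action_along w P l Q g : path earlier P (rcons l Q) -> along g P (rcons l Q) ->
  action w P.1 Q.1 g = energy P (rcons l Q) - (visits w P.1 Q.1 g)%:R.
Proof.
move=> pl gl; rewrite /action; congr (_ - _).
by have := along_kinetic pl gl; rewrite last_rcons.
Qed.

Lemma action_visited w P Q V g :
  path earlier P (rcons V Q) -> along g P (rcons V Q) ->
  (forall v, v \in V <-> [/\ points w v, P.1 < v.1 < Q.1 & g v.1 = v.2]) ->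
  action w P.1 Q.1 g = cost P V Q - (end_points w P Q)%:R.
Proof.
move=> pV gV VE; rewrite (action_along _ pV gV).
have gv := alongP gV.
rewrite (visitsE pV _ _ VE); first by rewrite natrD /cost; ring.
- by apply: gv; rewrite mem_head.
- by apply: gv; rewrite inE mem_rcons mem_head orbT.
Qed.

(** Only an inequality, since the polygon may pass through further points of
    the configuration between its vertices. *)
Lemma action_le_cost w P l Q g : chain w P l Q -> along g P (rcons l Q) ->
  action w P.1 Q.1 g <= cost P l Q - (end_points w P Q)%:R.
Proof.
move=> cl gl; have adm := along_admissible cl gl.
have PQ : P.1 < Q.1.
  by have := order_path_min (@earlier_trans _) cl.1; rewrite all_rcons => /andP[].
have [V [[]]] := visited_chain PQ adm.
rewrite -!surjective_pairing => pV _ gV VE.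
have gv := alongP gV.
rewrite (action_along _ cl.1 gl) (visitsE pV _ _ VE); last 2 first.
- by apply: gv; rewrite mem_head.
- by apply: gv; rewrite inE mem_rcons mem_head orbT.
rewrite natrD /cost opprD addrA lerD2r lerD2l lerN2 ler_nat.
apply: uniq_leq_size.
  by have := path_earlier_uniq cl.1; rewrite rcons_uniq => /andP[].
move=> v vl; apply/VE; split; first exact: cl.2.
- exact: path_rcons_time cl.1 vl.
- by apply: (alongP gl); rewrite inE mem_rcons inE vl !orbT.
Qed.

Lemma minimizer_minchain w t0 x0 t1 x1 g : t0 < t1 -> minimizers w t0 x0 t1 x1 g ->
  exists V, [/\ minchain w (t0, x0) V (t1, x1), along g (t0, x0) (rcons V (t1, x1)) &
    forall v, v \in V <-> [/\ points w v, t0 < v.1 < t1 & g v.1 = v.2]].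
Proof.
move=> t01 [adm gmin]; have [V [cV gV VE]] := visited_chain t01 adm.
exists V; split => //; split => // l cl.
have gi := along_interp cl.1.
have := gmin _ (along_admissible cl gi).
rewrite (action_visited cV.1 gV VE) => /le_trans/(_ (action_le_cost cl gi)).
by rewrite lerD2r.
Qed.

Lemma minchain_minimizer w P V Q g : minchain w P V Q -> along g P (rcons V Q) ->
  minimizers w P.1 P.2 Q.1 Q.2 g.
Proof.
move=> [cV Vmin] gV; split; first exact: along_admissible gV.
have PQ : P.1 < Q.1.
  by have := order_path_min (@earlier_trans _) cV.1; rewrite all_rcons => /andP[].
move=> h adm; apply: le_trans (action_le_cost cV gV) _.
have [V' [cV' gV' VE']] := visited_chain PQ adm.
rewrite (action_visited cV'.1 gV' VE') -!surjective_pairing lerD2r.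
by apply: Vmin; move: cV'; rewrite -!surjective_pairing.
Qed.

End visited.

(** * Restriction and uniqueness of minimizers *)

Section restriction.
Context {R : realType}.
Implicit Types (w : configuration R) (g h : R -> R) (p q u v P Q T : R * R) (s l V : seq (R * R)) (t a b x y : R).

Lemma along_cat g p s1 s2 :
  along g p (s1 ++ s2) <-> along g p s1 /\ along g (last p s1) s2.
Proof.
elim: s1 p => [|q s1 ih] p /=; last by rewrite ih; tauto.
by split=> [h|[]//]; split => //; split => //; case: s2 h => [|? ?] [].
Qed.

Lemma chain_lt w P l Q : chain w P l Q -> P.1 < Q.1.
Proof.
by move=> [pl _]; have := order_path_min (@earlier_trans _) pl; rewrite all_rcons => /andP[].
Qed.

(** At a junction T of two chains T becomes a vertex if it belongs to the
    configuration; otherwise the polygon takes the chord. *)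
Definition through w T : seq (R * R) := if `[< points w T >] then [:: T] else [::].

Lemma chain_cat w P l1 T l2 Q : chain w P l1 T -> chain w T l2 Q ->
  chain w P (l1 ++ through w T ++ l2) Q /\
  cost P (l1 ++ through w T ++ l2) Q <=
    cost P l1 T + cost T l2 Q - (size (through w T))%:R.
Proof.
move=> [p1 w1] [p2 w2].
have pp : path earlier P (l1 ++ T :: rcons l2 Q).
  by rewrite -cat_rcons cat_path p1 last_rcons.
have ee : energy P (l1 ++ T :: rcons l2 Q) = energy P (rcons l1 T) + energy T (rcons l2 Q).
  by rewrite -cat_rcons energy_cat last_rcons.
rewrite /through; case: asboolP => wT /=.
  split; first split.
  - by rewrite rcons_cat.
  - by move=> v /=; rewrite mem_cat inE => /or3P[/w1|/eqP->|/w2].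
  by rewrite /cost rcons_cat /= ee size_cat /= natrD -(natr1 (size l2)); lra.
split; first split.
- rewrite rcons_cat; apply: subseq_path pp; first exact: earlier_trans.
  by rewrite cat_subseq// subseq_cons.
- by move=> v /=; rewrite mem_cat => /orP[/w1|/w2].
rewrite /cost rcons_cat size_cat natrD.
by have := energy_drop pp; rewrite ee; lra.
Qed.

(** Replacing one of the two halves by a cheaper chain would make the whole
    cheaper: the costs add up, with the same correction for a visit at T as for
    the given minimizer. *)
Lemma minchain_split w P V Q T g l1 l2 : minchain w P V Q ->
  along g P (rcons V Q) ->
  (forall v, v \in V <-> [/\ points w v, P.1 < v.1 < Q.1 & g v.1 = v.2]) ->
  g T.1 = T.2 ->
  chain w P l1 T -> along g P (rcons l1 T) ->
  (forall v, v \in l1 <-> [/\ points w v, P.1 < v.1 < T.1 & g v.1 = v.2]) ->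
  chain w T l2 Q -> along g T (rcons l2 Q) ->
  (forall v, v \in l2 <-> [/\ points w v, T.1 < v.1 < Q.1 & g v.1 = v.2]) ->
  minchain w P l1 T /\ minchain w T l2 Q.
Proof.
move=> [cV Vmin] gV VE gT c1 g1 E1 c2 g2 E2.
have PT := chain_lt c1; have TQ := chain_lt c2.
have cost_eq : cost P V Q = cost P l1 T + cost T l2 Q - (size (through w T))%:R.
  have EE : energy P (rcons V Q) = energy P (rcons l1 T) + energy T (rcons l2 Q).
    have pp : path earlier P (rcons l1 T ++ rcons l2 Q).
      by rewrite cat_path c1.1 last_rcons c2.1.
    have gg : along g P (rcons l1 T ++ rcons l2 Q).
      by apply/along_cat; rewrite last_rcons.
    have := along_kinetic pp gg; have := along_kinetic cV.1 gV.
    by rewrite last_cat !last_rcons => -> ->; rewrite energy_cat last_rcons.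
  have [cL _] := chain_cat c1 c2.
  have SS : size V = (size l1 + size (through w T) + size l2)%N.
    rewrite -addnA -!size_cat; apply/eqP; rewrite -uniq_size_uniq.
    - by have := path_earlier_uniq cV.1; rewrite rcons_uniq => /andP[].
    - by have := path_earlier_uniq cL.1; rewrite rcons_uniq => /andP[].
    move=> v; apply/idP/idP.
      rewrite !mem_cat => /or3P[/E1[wv /andP[Pv vT] gv]||/E2[wv /andP[Tv vQ] gv]].
      - by apply/VE; split => //; rewrite Pv (lt_trans vT).
      - rewrite /through; case: asboolP => // wT; rewrite inE => /eqP ->.
        by apply/VE; split => //; rewrite PT.
      - by apply/VE; split => //; rewrite vQ (lt_trans PT).
    move=> /VE[wv /andP[Pv vQ] gv]; rewrite !mem_cat; apply/or3P.
    case: (ltgtP v.1 T.1) => [vT|Tv|vT].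
    - by apply/Or31/E1; rewrite Pv.
    - by apply/Or33/E2; rewrite Tv.
    - have vE : v = T by rewrite [v]surjective_pairing [T]surjective_pairing -gT -gv vT.
      by apply: Or32; rewrite /through -vE; case: asboolP => // _; rewrite mem_head.
  by rewrite /cost EE SS !natrD; lra.
split; split => // l cl.
  have [cL eL] := chain_cat cl c2; have := Vmin _ cL; lra.
have [cL eL] := chain_cat c1 cl; have := Vmin _ cL; lra.
Qed.

Lemma minimizers_split w a x b y g t : minimizers w a x b y g -> a < t < b ->
  minimizers w a (g a) t (g t) g /\ minimizers w t (g t) b (g b) g.
Proof.
move=> mg /andP[at_ tb].
have ab := lt_trans at_ tb.
have [gx gy] : g a = x /\ g b = y by case: mg => -[].
have [V [mV gV VE]] := minimizer_minchain ab mg.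
have [l1 [c1 g1 E1]] := visited_chain_sub mg.1 (lexx a) at_ (ltW tb).
have [l2 [c2 g2 E2]] := visited_chain_sub mg.1 (ltW at_) tb (lexx b).
rewrite -gx -gy in mV gV.
have [m1 m2] := minchain_split (T := (t, g t)) mV gV VE erefl c1 g1 E1 c2 g2 E2.
by split; [exact: (minchain_minimizer m1)|exact: (minchain_minimizer m2)].
Qed.

Lemma minimizers_restrict w a x b y g t0 t1 : minimizers w a x b y g ->
  a <= t0 -> t0 < t1 -> t1 <= b -> minimizers w t0 (g t0) t1 (g t1) g.
Proof.
move=> mg.
have {mg} : minimizers w a (g a) b (g b) g.
  by case: (mg) => -[_ _ -> ->].
rewrite le_eqVlt => mg /predU1P[<-|at0] t01 t1b.
  move: t1b; rewrite le_eqVlt => /predU1P[->//|t1b].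
  by apply: (minimizers_split mg _).1; rewrite t01.
have {}mg : minimizers w t0 (g t0) b (g b) g.
  by apply: (minimizers_split mg _).2; rewrite at0 (lt_le_trans t01).
move: t1b; rewrite le_eqVlt => /predU1P[->//|t1b].
by apply: (minimizers_split mg _).1; rewrite t01.
Qed.

Lemma minimizers_ext w t0 t1 g h : t0 < t1 ->
  (forall t, t0 <= t <= t1 -> g t = h t) ->
  minimizers w t0 (g t0) t1 (g t1) g -> minimizers w t0 (h t0) t1 (h t1) h.
Proof.
move=> t01 gh /(minimizer_minchain t01)[V [mV gV _]].
have hV : along h (t0, g t0) (rcons V (t1, g t1)).
  by apply: along_ext gV; [exact: mV.1.1|rewrite last_rcons].
have := minchain_minimizer mV hV.
by rewrite !gh// ?lexx ?(ltW t01).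
Qed.

End restriction.

Section uniqueness.
Context {R : realType}.
Implicit Types (w : configuration R) (g h : R -> R) (p q u v P Q T : R * R) (s l V : seq (R * R)) (t a b x y : R).

Definition flat_at P l1 v l2 Q := (last P l1).2 = v.2 /\ v.2 = (head Q l2).2.

(** The differences between numbers of visited points are integers, so two
    minimizers with different vertices would be a tie. A vertex with the same
    position as both neighbours has to be excepted: if m has atoms such vertices
    occur, and the energy does not depend on their times. *)
Definition no_tie w := forall P Q l1 v l2 l', points w P -> points w Q ->
  chain w P (l1 ++ v :: l2) Q -> chain w P l' Q -> v \notin l' ->
  ~ flat_at P l1 v l2 Q -> forall z : int,
  energy P (rcons (l1 ++ v :: l2) Q) - energy P (rcons l' Q) <> z%:~R.

Lemma along_drop_flat g u v q s : u.1 < v.1 -> v.1 < q.1 -> u.2 = v.2 -> v.2 = q.2 ->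
  along g u (v :: q :: s) -> along g u (q :: s).
Proof.
move=> uv vq uv2 vq2 [gu [guv [gv [gvq gq]]]].
have gq1 : g q.1 = q.2 by apply: (alongP gq); exact: mem_head.
split => //; split => //.
move/(linear_lineP uv gu gv): guv => guv.
move/(linear_lineP vq gv gq1): gvq => gvq.
exists 0, u.2 => t; rewrite /= in_itv/= mul0r add0r => /andP[ut tq].
have [tv|vt] := leP t v.1.
  by rewrite guv ?ut// /line uv2 subrr mul0r mul0r add0r.
by rewrite gvq ?tq ?(ltW vt)// /line -vq2 subrr mul0r mul0r add0r.
Qed.

(** Removing flat vertices one at a time does not change the path. *)
Lemma bending_vertices w P V Q g : chain w P V Q -> along g P (rcons V Q) ->
  exists l, [/\ chain w P l Q, along g P (rcons l Q) &
    forall l1 v l2, l = l1 ++ v :: l2 -> ~ flat_at P l1 v l2 Q].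
Proof.
have [n] := ubnP (size V); elim: n V => // n ih V Vn cV gV.
have [|H] := pselect (exists l1 v l2, V = l1 ++ v :: l2 /\ flat_at P l1 v l2 Q); last first.
  by exists V; split => // l1 v l2 VE fl; apply: H; exists l1, v, l2.
move=> [l1 [v [l2 [VE fl]]]].
have E0 : rcons l2 Q = head Q l2 :: behead (rcons l2 Q) by case: (l2).
apply: (ih (l1 ++ l2)).
- by move: Vn; rewrite VE !size_cat /= addnS !ltnS.
- case: cV => pV wV; split.
    apply: subseq_path pV; first exact: earlier_trans.
    by rewrite VE !rcons_cat cat_subseq// subseq_cons.
  by move=> u /=; rewrite mem_cat => ul; apply: wV; rewrite /= VE mem_cat inE orbCA ul orbT.
- move: gV; rewrite VE !rcons_cat !along_cat rcons_cons E0 => -[g1 g2]; split => //.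
  have := cV.1; rewrite VE rcons_cat cat_path rcons_cons E0 => /andP[_ /and3P[uv vq _]].
  by case: fl => fl1 fl2; apply: along_drop_flat g2.
Qed.

Lemma along_eq g h p s t : path earlier p s -> along g p s -> along h p s ->
  p.1 <= t <= (last p s).1 -> g t = h t.
Proof.
elim: s p => [|q s ih] p.
  by move=> _ [gp _] [hp _] /=; rewrite -eq_le => /eqP <-; rewrite gp hp.
move=> /= /andP[pq qs] [gp [gl gs]] [hp [hl hs]] /andP[pt tl].
have gq := alongP gs (mem_head _ _); have hq := alongP hs (mem_head _ _).
have [tq|qt] := leP t q.1; last by apply: ih qs gs hs _; rewrite (ltW qt).
move/(linear_lineP pq gp gq): gl => ->; last by rewrite pt.
by move/(linear_lineP pq hp hq): hl => ->; rewrite ?pt.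
Qed.

(** Both minimizers have the same cost, so their energies differ by an integer.
    By the absence of ties each vertex of either reduced chain belongs to the other
    one. *)
Lemma minimizer_unique w P Q g h : no_tie w -> points w P -> points w Q -> P.1 < Q.1 ->
  minimizers w P.1 P.2 Q.1 Q.2 g -> minimizers w P.1 P.2 Q.1 Q.2 h ->
  forall t, P.1 <= t <= Q.1 -> g t = h t.
Proof.
move=> nt wP wQ PQ mg mh.
have [V [mV gV _]] := minimizer_minchain PQ mg.
have [V' [mV' hV' _]] := minimizer_minchain PQ mh.
rewrite -!surjective_pairing in mV gV mV' hV'.
have [l [cl gl nl]] := bending_vertices mV.1 gV.
have [l' [cl' hl' nl']] := bending_vertices mV'.1 hV'.
have el : energy P (rcons l Q) = energy P (rcons V Q).
  by have := along_kinetic cl.1 gl; rewrite last_rcons => <-; have := along_kinetic mV.1.1 gV; rewrite last_rcons => <-.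
have el' : energy P (rcons l' Q) = energy P (rcons V' Q).
  by have := along_kinetic cl'.1 hl'; rewrite last_rcons => <-; have := along_kinetic mV'.1.1 hV'; rewrite last_rcons => <-.
have cc : cost P V Q = cost P V' Q by apply: le_anti; rewrite mV.2 ?mV'.2//; [exact: mV.1|exact: mV'.1].
have ee : energy P (rcons l Q) - energy P (rcons l' Q) = ((size V)%:Z - (size V')%:Z)%:~R.
  by rewrite el el' intrB -!pmulrn; move: cc; rewrite /cost; lra.
have sub1 v : v \in l -> v \in l'.
  move=> vl; apply/negPn/negP => vl'; have := cl; have := nl; have := ee.
  case/splitPr: vl => l1 l2 e1 n1 c1.
  exact: (nt _ _ _ _ _ _ wP wQ c1 cl' vl' (n1 _ _ _ erefl) _ e1).
have sub2 v : v \in l' -> v \in l.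
  move=> vl; apply/negPn/negP => vl'; have := cl'; have := nl'; have := ee.
  case/splitPr: vl => l1 l2 e1 n1 c1.
  apply: (nt _ _ _ _ _ _ wP wQ c1 cl vl' (n1 _ _ _ erefl) ((size V')%:Z - (size V)%:Z)).
  by rewrite -opprB e1 -mulrNz opprB.
have ll' : l = l'.
  apply: (irr_sorted_eq (@earlier_trans R) (@earlier_irr R)).
  - by have := path_sorted cl.1; rewrite sorted_rcons_all => /andP[].
  - by have := path_sorted cl'.1; rewrite sorted_rcons_all => /andP[].
  by move=> v; apply/idP/idP; [exact: sub1|exact: sub2].
move=> t tPQ; rewrite -ll' in hl'.
by apply: (along_eq cl.1 gl hl'); rewrite last_rcons.
Qed.

End uniqueness.

(** * Recurrent global minimizers from attracting points *)

Section deterministic.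
Context {R : realType}.
Implicit Types (w : configuration R) (g h : R -> R) (p q u v P Q : R * R) (s l V : seq (R * R)) (t a b x y r : R).

(** The time T may depend on the bound r for the ends, which is unknown for a
    recurrent minimizer. *)
Definition attracting w p := points w p /\ forall r, exists T, forall P Q V,
  P.1 <= - T -> T <= Q.1 -> `|P.2| <= r -> `|Q.2| <= r ->
  minchain w P V Q -> p \in V.

Definition slab_finite w := forall a b, finite_set (w `&` [set p | a < p.1 < b]).

Lemma cvg_int_pinfty (t : int -> R) : (fun n : nat => t n%:Z) @ \oo --> +oo ->
  forall T, exists k, T <= t k.
Proof.
move=> /cvgryPge h T; have [N _ hN] := h T.
by exists N%:Z; apply: (hN N) => /=.
Qed.

Lemma cvg_int_ninfty (t : int -> R) : (fun n : nat => t (- n%:Z)) @ \oo --> -oo ->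
  forall T, exists k, t k <= T.
Proof.
move=> /cvgrNyPle h T; have [N _ hN] := h T.
by exists (- N%:Z); apply: (hN N) => /=.
Qed.

Lemma global_through w g p r : attracting w p -> global_minimizer w g ->
  (forall T, exists t, T <= t /\ `|g t| <= r) ->
  (forall T, exists t, t <= T /\ `|g t| <= r) -> g p.1 = p.2.
Proof.
move=> [_ att] gm hp hm; have [T hT] := att r.
have [t1 [Tt1 g1]] := hp (Num.max T (`|p.1| + 1)).
have [t0 [Tt0 g0]] := hm (Num.min (- T) (- (`|p.1| + 1))).
move: Tt1 Tt0; rewrite ge_max le_min => /andP[Tt1 p1] /andP[Tt0 p0].
have t01 : t0 < t1 by have := normr_ge0 p.1; lra.
have [V [mV gV _]] := minimizer_minchain t01 (gm _ _ t01).
have pV := hT (t0, g t0) (t1, g t1) V Tt0 Tt1 g0 g1 mV.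
by apply: (alongP gV); rewrite inE mem_rcons inE pV !orbT.
Qed.

Lemma recurrentP g : recurrent g -> exists r,
  (forall T, exists t, T <= t /\ `|g t| <= r) /\
  (forall T, exists t, t <= T /\ `|g t| <= r).
Proof.
move=> [r [_ [t [tp tm tr]]]]; exists r.
have gr k : `|g (t k)| <= r by rewrite ler_norml; have := tr k; rewrite in_itv.
by split=> T; [have [k] := cvg_int_pinfty tp T|have [k] := cvg_int_ninfty tm T]; exists (t k).
Qed.

Section existence.
Variables (w : configuration R) (K : R).
Hypotheses (wfin : slab_finite w) (wnt : no_tie w).
Hypothesis att_right : forall T, exists p, [/\ attracting w p, T < p.1 & `|p.2| <= K].
Hypothesis att_left : forall T, exists p, [/\ attracting w p, p.1 < - T & `|p.2| <= K].

Lemma recurrent_unique g h : global_minimizer w g -> recurrent g ->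
  global_minimizer w h -> recurrent h -> g = h.
Proof.
move=> gm /recurrentP[r [gp gn]] hm /recurrentP[r' [hp hn]]; apply/funext => t.
have [p [attp pt _]] := att_left `|t|; have [q [attq tq _]] := att_right `|t|.
have gpE := global_through attp gm gp gn; have gqE := global_through attq gm gp gn.
have hpE := global_through attp hm hp hn; have hqE := global_through attq hm hp hn.
have pt' : p.1 < t by have := ler_norm (- t); rewrite normrN; lra.
have tq' : t < q.1 by have := ler_norm t; lra.
have pq := lt_trans pt' tq'.
apply: (minimizer_unique wnt attp.1 attq.1 pq).
- by rewrite -gpE -gqE; exact: gm.
- by rewrite -hpE -hqE; exact: hm.
by rewrite !ltW.
Qed.

(** The points being within K of the axis, it suffices to choose each pair
    beyond the time at which the previous pair starts to attract minimizers with ends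
    within K. *)
Lemma nested_pairs : exists z : nat -> (R * R) * (R * R), forall n,
  [/\ points w (z n).1, points w (z n).2,
      (z n).1.1 < - n%:R /\ n%:R < (z n).2.1,
      `|(z n).1.2| <= K /\ `|(z n).2.2| <= K &
      forall V, minchain w (z n.+1).1 V (z n.+1).2 ->
        (z n).1 \in V /\ (z n).2 \in V].
Proof.
have [fr hr] := choice att_right; have [fl hl] := choice att_left.
have rng p : exists T, attracting w p -> forall P Q V,
    P.1 <= - T -> T <= Q.1 -> `|P.2| <= K -> `|Q.2| <= K ->
    minchain w P V Q -> p \in V.
  have [attp|] := pselect (attracting w p); last by exists 0.
  by have [T hT] := attp.2 K; exists T.
have [tau htau] := choice rng.
pose next (n : nat) (c : (R * R) * (R * R)) :=
  let T := Num.max (Num.max (tau c.1) (tau c.2)) n.+1%:R in (fl T, fr T).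
pose z := fix z n := if n is m.+1 then next m (z m) else (fl 0, fr 0).
have zT n : exists2 T, n%:R <= T & z n = (fl T, fr T).
  case: n => [|n]; first by exists 0.
  by exists (Num.max (Num.max (tau (z n).1) (tau (z n).2)) n.+1%:R); rewrite // le_max lexx orbT.
exists z => n; have [T nT zE] := zT n.
have [al lt lk] := hl T; have [ar rt rk] := hr T.
split; rewrite ?zE //=; first exact: al.1.
- exact: ar.1.
- by split; lra.
move=> V; rewrite /= zE /=.
set T' := Num.max _ _ => mV.
have [_ lt' lk'] := hl T'; have [_ rt' rk'] := hr T'.
have [T1 T2] : tau (fl T) <= T' /\ tau (fr T) <= T' by rewrite /T' !le_max !lexx !orbT.
by split; [apply: (htau _ al) mV|apply: (htau _ ar) mV] => //; lra.
Qed.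

(** The minimizers g n between the n-th pair of points extend each other, since
    g n.+1 visits the n-th pair and is the unique minimizer in between. *)
Lemma recurrent_exists : exists g, global_minimizer w g /\ recurrent g.
Proof.
have [z hz] := nested_pairs.
have lt12 n : (z n).1.1 < (z n).2.1.
  by have [_ _ [h1 h2] _ _] := hz n; have := ler0n R n; lra.
have gex n : exists g : R -> R, exists V, minchain w (z n).1 V (z n).2 /\
    along g (z n).1 (rcons V (z n).2).
  have [V mV] := minchain_exists (lt12 n) (wfin (z n).1.1 (z n).2.1).
  by exists (interp (z n).1 (rcons V (z n).2)), V; split => //; exact/along_interp/mV.1.1.
have [g gP] := choice gex.
have gmin n : minimizers w (z n).1.1 (z n).1.2 (z n).2.1 (z n).2.2 (g n).
  by have [V [mV gV]] := gP n; exact: minchain_minimizer gV.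
have gz n : g n (z n).1.1 = (z n).1.2 /\ g n (z n).2.1 = (z n).2.2.
  have [V [mV gV]] := gP n.
  by split; apply: (alongP gV); rewrite inE ?mem_rcons ?mem_head ?orbT// eqxx.
pose I n t := (z n).1.1 <= t <= (z n).2.1.
have step n t : I n t -> I n.+1 t /\ g n.+1 t = g n t.
  have [w1 w2 _ _ hV] := hz n; have [V [mV gV]] := gP n.+1.
  have [V1 V2] := hV V mV.
  have /andP[a1 b1] := path_rcons_time mV.1.1 V1.
  have /andP[a2 b2] := path_rcons_time mV.1.1 V2.
  move=> /[dup] It /andP[zt tz]; split.
    by rewrite /I (le_trans (ltW a1))// (le_trans tz)// ltW.
  have e1 : g n.+1 (z n).1.1 = (z n).1.2 by apply: (alongP gV); rewrite inE mem_rcons inE V1 !orbT.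
  have e2 : g n.+1 (z n).2.1 = (z n).2.2 by apply: (alongP gV); rewrite inE mem_rcons inE V2 !orbT.
  have mm := minimizers_restrict (gmin n.+1) (ltW a1) (lt12 n) (ltW b2).
  rewrite e1 e2 in mm.
  exact: (minimizer_unique wnt w1 w2 (lt12 n) mm (gmin n)).
have stab n k t : I n t -> I (k + n)%N t /\ g (k + n)%N t = g n t.
  move=> It; elim: k => [//|k [Ik gk]].
  by have [? gS] := step _ _ Ik; rewrite addSn gS gk.
have agree n m t : I n t -> I m t -> g n t = g m t.
  by move=> /(stab n m t)[_ <-] /(stab m n t)[_ <-]; rewrite addnC.
have In t n : `|t| <= n%:R -> I n t.
  rewrite ler_norml => /andP[t1 t2]; have [_ _ [h1 h2] _ _] := hz n.
  by rewrite /I; lra.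
pose N t := (Num.truncn `|t|).+1.
have IN t : I (N t) t by apply/In/ltW/truncnS_gt.
pose gam t := g (N t) t.
have gamE n t : I n t -> gam t = g n t by move=> It; exact: agree.
exists gam; split.
  move=> t0 t1 t01.
  pose n := maxn (N t0) (N t1).
  have I0 : I n t0.
    by apply: In; apply: le_trans (ltW (truncnS_gt _)) _; rewrite ler_nat leq_maxl.
  have I1 : I n t1.
    by apply: In; apply: le_trans (ltW (truncnS_gt _)) _; rewrite ler_nat leq_maxr.
  move: (I0) (I1) => /andP[z0 _] /andP[_ z1].
  apply: (@minimizers_ext _ _ _ _ (g n)) => //.
    move=> t /andP[t0t tt1]; apply/esym/gamE.
    by rewrite /I (le_trans z0 t0t) (le_trans tt1 z1).
  exact: minimizers_restrict (gmin n) z0 t01 z1.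
have K0 : 0 <= K by have [_ _ _ [h _] _] := hz 0%N; exact: le_trans h.
exists (K + 1); split; first by lra.
exists (fun k : int => match k with Posz n => (z n).2.1 | Negz n => (z n.+1).1.1 end).
split.
- apply/cvgryPge => A; near=> n.
  have [_ _ [_ h] _ _] := hz n; apply/ltW/(le_lt_trans _ h).
  by near: n; exact: nbhs_infty_ger.
- apply/cvgrNyPle => A; near=> n.
  have n0 : (0 < n)%N by near: n; exact: nbhs_infty_gt.
  rewrite -(prednK n0) -NegzE.
  have [_ _ [h _] _ _] := hz n.-1.+1; apply: le_trans (ltW h) _.
  by rewrite prednK// lerNl; near: n; exact: nbhs_infty_ger.
move=> k; have key x : `|x| <= K -> x \in `[- (K + 1), K + 1].
  by rewrite ler_norml in_itv/= => /andP[? ?]; apply/andP; split; lra.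
case: k => n; apply: key.
  have [_ _ _ [_ h] _] := hz n; rewrite (gamE n) ?(gz n).2//.
  by rewrite /I lexx ltW.
have [_ _ _ [h _] _] := hz n.+1; rewrite (gamE n.+1) ?(gz n.+1).1//.
by rewrite /I lexx ltW.
Unshelve. all: by end_near. Qed.

Theorem recurrent_exists_unique : exists! g, global_minimizer w g /\ recurrent g.
Proof.
have [g [gm gr]] := recurrent_exists.
by exists g; split => // h [hm hr]; exact: recurrent_unique.
Qed.

End existence.
End deterministic.

(** * Poisson tails and outer probability *)

Section poisson_law.
Context {R : realType}.
Implicit Types (r a : R).
Local Open Scope ereal_scope.

Lemma poisson_prob_0 r : (0 <= r)%R -> poisson_prob r 0 [set 0%N] = (expR (- r))%:E.
Proof.
rewrite /poisson_prob; case: ifPn => [r0 _|]; last first.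
  rewrite -leNgt => r0 r0'; have -> : r = 0%R by apply/le_anti; rewrite r0.
  by rewrite oppr0 expR0 diracE mem_set.
rewrite esum_set1 ?lee_fin ?poisson_pmf_ge0// /poisson_pmf r0.
by rewrite expr0 fact0 invr1 !mul1r.
Qed.

Lemma poisson_prob_1 r : (0 <= r)%R -> poisson_prob r 0 [set 1%N] = (r * expR (- r))%:E.
Proof.
rewrite /poisson_prob; case: ifPn => [r0 _|]; last first.
  rewrite -leNgt => r0 r0'; have -> : r = 0%R by apply/le_anti; rewrite r0.
  by rewrite mul0r diracE memNset.
rewrite esum_set1 ?lee_fin ?poisson_pmf_ge0// /poisson_pmf r0.
by rewrite expr1 factS fact0 invr1 mulr1.
Qed.

Lemma esum_le_scale (c : R) (U : set nat) (f g : nat -> R) : (0 <= c)%R ->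
  (forall k, 0 <= g k)%R -> (forall k, U k -> f k <= c * g k)%R ->
  \esum_(k in U) (f k)%:E <= c%:E * \esum_(k in U) (g k)%:E.
Proof.
move=> c0 g0 fg.
have E : forall h : nat -> R, (forall k, 0 <= h k)%R ->
    \esum_(k in U) (h k)%:E = \sum_(k <oo | k \in U) (h k)%:E.
  by move=> h h0; rewrite nneseries_esum ?set_mem_set// => n _; rewrite lee_fin.
rewrite (E g)// -nneseriesZl; last by move=> i _; rewrite lee_fin.
under [leRHS]eq_eseriesr do rewrite -EFinM.
rewrite -(E (fun k => c * g k)%R); last by move=> k; rewrite mulr_ge0.
by apply: le_esum => k Uk; rewrite lee_fin fg.
Qed.

(** Exponential Markov bound: tilting the law by a^k turns the rate r into a r. *)
Lemma poisson_prob_tail r a n : (0 <= r)%R -> (1 <= a)%R ->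
  poisson_prob r 0 [set k | (n <= k)%N] <= (expR ((a - 1) * r) / a ^+ n)%:E.
Proof.
move=> r0' a1; have a0 : (0 < a)%R by exact: lt_le_trans a1.
rewrite /poisson_prob; case: ifPn => [r0|]; last first.
  rewrite -leNgt => r0; have -> : r = 0%R by apply/le_anti; rewrite r0.
  rewrite mulr0 expR0 div1r diracE; case: n => [|n].
    by rewrite mem_set// expr0 invr1.
  by rewrite memNset//= lee_fin invr_ge0 exprn_ge0// ltW.
have ar0 : (0 < a * r)%R by exact: mulr_gt0.
apply: (@le_trans _ _ ((expR ((a - 1) * r) / a ^+ n)%:E *
    \esum_(k in [set k | (n <= k)%N]) (poisson_pmf (a * r) k)%:E)).
  apply: esum_le_scale => [|k|k /= nk].
  - by rewrite divr_ge0 ?expR_ge0// exprn_ge0// ltW.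
  - exact: poisson_pmf_ge0.
  rewrite /poisson_pmf r0 ar0 exprMn.
  have -> : (expR ((a - 1) * r) / a ^+ n * (a ^+ k * r ^+ k * k`!%:R^-1 * expR (- (a * r))) =
     (expR ((a - 1) * r) * expR (- (a * r))) * (a ^+ k / a ^+ n) * (r ^+ k * k`!%:R^-1))%R.
    by ring.
  rewrite -expRD (_ : ((a - 1) * r + - (a * r) = - r)%R); last by ring.
  rewrite [leLHS]mulrC ler_wpM2r//.
    by rewrite mulr_ge0// exprn_ge0// ltW.
  rewrite ler_peMr ?expR_ge0// ler_pdivlMr ?exprn_gt0// mul1r.
  exact: ler_weXn2l.
rewrite -[leRHS]mule1; apply: lee_wpmul2l.
  by rewrite lee_fin divr_ge0 ?expR_ge0// exprn_ge0// ltW.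
have h : poisson_prob (a * r) 0 [set k | (n <= k)%N] <= 1 by exact: probability_le1.
by move: h; rewrite /poisson_prob ar0.
Qed.

End poisson_law.

Section outer_bounds.
Context d (Omega : measurableType d) (R : realType) (P : probability Omega R).
Implicit Types (E F : set Omega) (c : R).

(** The events below are often given by quantifiers over configurations, without
    any claim of measurability; only bounds on their probability are used. *)
Definition outer_le E c := exists F, [/\ measurable F, E `<=` F & (P F <= c%:E)%E].

Lemma outer_le_sub E F c : E `<=` F -> outer_le F c -> outer_le E c.
Proof. by move=> EF [G [mG FG PG]]; exists G; split => //; exact: subset_trans FG. Qed.

Lemma outer_le_trans E c c' : c <= c' -> outer_le E c -> outer_le E c'.
Proof. by move=> cc [G [mG FG PG]]; exists G; split => //; rewrite (le_trans PG)// lee_fin. Qed.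

Lemma outer_leU E F c c' : outer_le E c -> outer_le F c' -> outer_le (E `|` F) (c + c').
Proof.
move=> [A [mA EA PA]] [B [mB FB PB]]; exists (A `|` B); split.
- exact: measurableU.
- exact: setUSS.
- by rewrite EFinD (le_trans (measureU2 _ _ _))//; apply: leeD.
Qed.

Lemma outer_le_negligible E : (forall c, 0 < c -> outer_le E c) -> P.-negligible E.
Proof.
move=> h; have h' n : exists F, [/\ measurable F, E `<=` F & (P F <= (n.+1%:R^-1)%:E)%E].
  by apply: h; rewrite invr_gt0.
have [F hF] := choice h'.
exists (\bigcap_n F n); split.
- by apply: bigcap_measurable => // n _; have [] := hF n.
- apply/le_anti/andP; split => //; apply/lee_addgt0Pr => e e0; rewrite add0e.
  have [mF _ PF] := hF (Num.truncn e^-1).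
  apply: (@le_trans _ _ (P (F (Num.truncn e^-1)))).
    by apply: le_measure; rewrite ?inE//; [apply: bigcap_measurable => // n _; have [] := hF n|exact: bigcap_inf].
  apply: (le_trans PF); rewrite lee_fin -[leRHS]invrK lef_pV2 ?posrE ?invr_gt0//.
  exact/ltW/truncnS_gt.
- by move=> w Ew n _; have [_ EF _] := hF n; exact: EF.
Qed.

(** Continuity from below. *)
Lemma outer_le_bigcup_nondecreasing (F : nat -> set Omega) c :
  (forall n, measurable (F n)) -> (forall n, (P (F n) <= c%:E)%E) ->
  {homo F : n m / (n <= m)%N >-> (n <= m)%O} -> outer_le (\bigcup_n F n) c.
Proof.
move=> mF PF Fh; have mU : measurable (\bigcup_n F n) by exact: bigcupT_measurable.
exists (\bigcup_n F n); split => //.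
have h := @nondecreasing_cvg_mu _ _ _ P F mF mU Fh.
rewrite -(cvg_lim _ h)//; apply: lime_le; last by near=> n; exact: PF.
by apply/cvg_ex; eexists; exact: h.
Unshelve. all: by end_near. Qed.

Lemma outer_le_bigU (I : finType) (F : I -> set Omega) (c : I -> R) :
  (forall i, outer_le (F i) (c i)) -> outer_le (\bigcup_i F i) (\sum_i c i).
Proof.
move=> hF.
have H (s : seq I) : outer_le (\bigcup_(i in [set` s]) F i) (\sum_(i <- s) c i).
  elim: s => [|i s ih].
    by rewrite big_nil set_nil bigcup_set0; exists set0; split => //; rewrite measure0.
  rewrite big_cons; apply: outer_le_sub (outer_leU (hF i) ih).
  by move=> w [j /= ]; rewrite inE => /predU1P[->|js] Fw; [left|right; exists j].
apply: outer_le_sub (outer_le_trans _ (H (index_enum I))) => //.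
by move=> w [i _ Fw]; exists i => //=; rewrite mem_index_enum.
Qed.

(** Countable subadditivity against a geometric series. *)
Lemma outer_le_geometric (F : nat -> set Omega) c (x : R) : 0 <= c -> 0 <= x <= 2^-1 ->
  (forall n, outer_le (F n) (c * x ^+ n)) -> outer_le (\bigcup_n F n) (2 * c).
Proof.
move=> c0 /andP[x0 x1] hF; have [G hG] := choice hF.
have mG n : measurable (G n) by have [] := hG n.
exists (\bigcup_n G n); split.
- exact: bigcupT_measurable.
- by apply: subset_bigcup => n _; have [] := hG n.
have mU : measurable (\bigcup_n G n) by exact: bigcupT_measurable.
apply: (le_trans (measure_sigma_subadditive P mG mU (@subset_refl _ _))).
apply: lime_le; first by apply: is_cvg_nneseries => n _ _; exact: measure_ge0.
near=> n; rewrite (@le_trans _ _ (\sum_(0 <= i < n) (c * x ^+ i)%:E)%E)//.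
  by apply: lee_sum => i _; have [] := hG i.
rewrite sumEFin lee_fin -mulr_sumr mulrC ler_wpM2r//.
rewrite big_mkord.
have : (1 - x) * (\sum_(i < n) x ^+ i) <= 1.
  by have := subrX1 x n; rewrite -[X in X = _]opprK opprB; have := exprn_ge0 n x0; lra.
have : 0 <= \sum_(i < n) x ^+ i by apply: sumr_ge0 => i _; exact: exprn_ge0.
by nra.
Unshelve. all: by end_near. Qed.

End outer_bounds.

(** * Counts of the Poisson point field *)

Section independent_events.
Context d (Omega : measurableType d) (R : realType) (P : probability Omega R).

(** Complements are taken one at a time, using
    P (A minus B) = P A - P (A and B). *)
Lemma independent_complements (I : eqType) (E : I -> set Omega) (p : I -> R) :
  (forall i, measurable (E i)) ->
  (forall s, uniq s -> P (\bigcap_(i in [set` s]) E i) = (\prod_(i <- s) p i)%:E) ->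
  forall s, uniq s -> P (\bigcap_(i in [set` s]) ~` E i) = (\prod_(i <- s) (1 - p i))%:E.
Proof.
move=> mE indE.
have mcap (F : I -> set Omega) (s : seq I) : (forall i, measurable (F i)) ->
    measurable (\bigcap_(i in [set` s]) F i).
  by move=> mF; apply: fin_bigcap_measurable => //; apply/finite_seqP; exists s.
have capS (F : I -> set Omega) i (s : seq I) : \bigcap_(j in [set` i :: s]) F j =
    F i `&` \bigcap_(j in [set` s]) F j.
  apply/seteqP; split => [w h|w [Fi h] j /=].
    split; first by apply: h; rewrite /= mem_head.
    by move=> j /= js; apply: h; rewrite /= inE js orbT.
  by rewrite inE => /predU1P[->//|/h].
have mEC i : measurable (~` E i) by exact: measurableC.
have H t : forall s, uniq (s ++ t) ->
    P (\bigcap_(i in [set` s]) E i `&` \bigcap_(i in [set` t]) ~` E i) =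
    (\prod_(i <- s) p i * \prod_(i <- t) (1 - p i))%:E.
  elim: t => [|j t ih] s ust.
    rewrite set_nil bigcap_set0 setIT big_nil mulr1 indE//.
    by rewrite cats0 in ust.
  have ujst : uniq ((j :: s) ++ t) by rewrite (perm_uniq (permEl (perm_catCA [:: j] s t))).
  have ust' : uniq (s ++ t) by move: ujst => /= /andP[].
  set Es := \bigcap_(i in [set` s]) E i; set Et := \bigcap_(i in [set` t]) ~` E i.
  have mX : measurable (Es `&` Et) by apply: measurableI; exact: mcap.
  have mY : measurable ((E j `&` Es) `&` Et) by apply: measurableI; [apply: measurableI => //; exact: mcap|exact: mcap].
  have -> : Es `&` \bigcap_(i in [set` j :: t]) ~` E i =
     (Es `&` Et) `\` ((E j `&` Es) `&` Et).
    rewrite !capS; apply/seteqP; split => [w [hs [hj ht]]|w [[hs ht] hn]].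
      by split => // -[[]].
    by split => //; split => // Ej; apply: hn.
  have YX : (Es `&` Et) `&` ((E j `&` Es) `&` Et) = (E j `&` Es) `&` Et.
    by apply/seteqP; split => [w [_]|w [[? ?] ?]].
  transitivity (P (Es `&` Et) - P ((E j `&` Es) `&` Et))%E.
    rewrite -[in RHS]YX; apply: measureD => //.
    by apply: (@le_lt_trans _ _ 1%E); [exact: probability_le1|exact: ltry].
  by rewrite -capS !ih// !big_cons -EFinB; congr (_%:E); ring.
move=> s us; have := H s [::] us.
by rewrite set_nil bigcap_set0 setTI big_nil mul1r.
Qed.

End independent_events.

Section npoints_facts.
Context {R : realType}.
Implicit Types (S T : set (R * R)).

Lemma npointsP S : finite_set S -> exists s, [/\ uniq s, S = [set` s] & npoints S = size s].
Proof.
move=> /finite_seqP[s ->]; exists (undup s).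
have E : [set` s] = [set` undup s] by apply/seteqP; split => x /=; rewrite mem_undup.
by rewrite E npoints_seq ?undup_uniq.
Qed.

Lemma npoints_ge S s : finite_set S -> uniq s -> [set` s] `<=` S -> (size s <= npoints S)%N.
Proof.
move=> /npointsP[t [ut -> ->]] us st; apply: uniq_leq_size => // x xs; exact: st.
Qed.

Lemma npoints_sub S T : finite_set T -> S `<=` T -> (npoints S <= npoints T)%N.
Proof.
move=> fT ST; have /npointsP[s [us SE ->]] : finite_set S by exact: sub_finite_set fT.
by apply: npoints_ge => //; rewrite -SE.
Qed.

Lemma npoints0 S : finite_set S -> npoints S = 0%N -> S = set0.
Proof. by move=> /npointsP[[|x s] [_ -> ->]]// _; rewrite set_nil. Qed.

Lemma npoints1 S : finite_set S -> npoints S = 1%N -> exists x, S = [set x].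
Proof.
move=> /npointsP[[|x [|y s]] [_ -> ->]]// _; exists x.
by apply/seteqP; split => z /=; rewrite inE => /eqP.
Qed.

Lemma npoints_gt0 S : finite_set S -> (0 < npoints S)%N -> exists x, S x.
Proof. by move=> /npointsP[[|x s] [_ -> ->]]// _; exists x; rewrite /= mem_head. Qed.

End npoints_facts.

Section field.
Context (R : realType) (m : {finite_measure set (measurableTypeR R) -> \bar R}).
Context d (Omega : measurableType d) (P : probability Omega R).
Variable xi : Omega -> configuration R.
Hypothesis xi_poisson : poisson_point_field m P xi.
Implicit Types (A B : set (measurableTypeR R * measurableTypeR R)) (U : set nat).

Local Notation count := (count_in xi).
Definition lam A : R := fine (intensity m A).
(** The law of the counts is only given for bounded sets; unbounded ones are
    exhausted by boxes. *)
Definition box (D : nat) : set (measurableTypeR R * measurableTypeR R) :=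
  `[- D%:R, D%:R]%classic `*` `[- D%:R, D%:R]%classic.

Lemma finite_count A w : bounded_set (A : set (R * R)) -> finite_set (xi w `&` A).
Proof. exact: points_locally_finite. Qed.

Lemma box_bounded D A : A `<=` box D -> bounded_set (A : set (R * R)).
Proof.
move=> AD; apply: (@bounded_setP _ _ D%:R) => p /AD[/=].
by rewrite !in_itv/= !ler_norml.
Qed.

Lemma box_sub D D' : (D <= D')%N -> box D `<=` box D'.
Proof.
move=> DD' p; have DR : D%:R <= D'%:R :> R by rewrite ler_nat.
rewrite /box /= !in_itv/= => -[/andP[? ?] /andP[? ?]].
by split; apply/andP; split; lra.
Qed.

Lemma measurable_box D : measurable (box D).
Proof. by apply: measurableX; exact: measurable_itv. Qed.

Lemma box_borel D A : measurable A -> bounded_borel (A `&` box D).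
Proof.
move=> mA; split; first by apply: measurableI => //; exact: measurable_box.
by apply: (@box_bounded D) => p [].
Qed.

Lemma box_cover (s : seq (R * R)) : exists D, forall p, p \in s -> box D p.
Proof.
elim: s => [|q s [D hD]]; first by exists 0%N.
pose D' := maxn D (maxn (Num.truncn `|q.1|).+1 (Num.truncn `|q.2|).+1).
have up (x : R) (n : nat) : `|x| <= n%:R -> - n%:R <= x <= n%:R by rewrite ler_norml.
exists D' => p; rewrite inE => /predU1P[->|/hD].
  have h (x : R) : ((Num.truncn `|x|).+1 <= D')%N -> `|x| <= D'%:R.
    by move=> h; apply: le_trans (ltW (truncnS_gt _)) _; rewrite ler_nat.
  split; rewrite /= in_itv/=; apply: up; apply: h; rewrite /D' !leq_max leqnn !orbT//.
by apply: box_sub; exact: leq_maxl.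
Qed.

Lemma intensity_ge0 A : (0 <= intensity m A)%E.
Proof. exact: measure_ge0. Qed.

Lemma lam_ge0 A : 0 <= lam A.
Proof. by rewrite /lam fine_ge0// intensity_ge0. Qed.

Lemma le_intensity A B : measurable A -> measurable B -> A `<=` B ->
  (intensity m A <= intensity m B)%E.
Proof. by move=> mA mB AB; apply: le_measure; rewrite ?inE. Qed.

Lemma intensity_rect (I J : set (measurableTypeR R)) : measurable I -> measurable J ->
  intensity m (I `*` J) = (lebesgue_measure I * m J)%E.
Proof. by move=> mI mJ; rewrite /intensity product_measure1E. Qed.

Lemma intensity_itv (a b : R) (J : set (measurableTypeR R)) : a <= b -> measurable J ->
  intensity m (`[a, b]%classic `*` J) = ((b - a) * fine (m J))%:E.
Proof.
move=> ab mJ; rewrite intensity_rect//.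
rewrite lebesgue_measure_itv/= lte_fin EFinM fineK; last first.
  exact: fin_num_measure.
move: ab; rewrite le_eqVlt => /predU1P[->|->]; last by rewrite EFinB.
by rewrite ltxx subrr mul0e.
Qed.

Lemma lam_le A L : (intensity m A <= L%:E)%E -> lam A <= L.
Proof.
move=> AL; rewrite -lee_fin /lam fineK// ge0_fin_numE ?intensity_ge0//.
exact: le_lt_trans AL (ltry _).
Qed.

Lemma measurable_count A U : bounded_borel A -> measurable (count A @^-1` U).
Proof.
move=> bA; have [mc _ _] := xi_poisson.
by rewrite -[_ @^-1` _]setTI; exact: mc.
Qed.

Lemma prob_count A U : bounded_borel A ->
  P (count A @^-1` U) = poisson_prob (lam A) 0 U.
Proof. by move=> bA; have [_ h _] := xi_poisson; exact: h. Qed.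

Lemma prob_count0 A : bounded_borel A -> P (count A @^-1` [set 0%N]) = (expR (- lam A))%:E.
Proof. by move=> bA; rewrite prob_count// poisson_prob_0// lam_ge0. Qed.

Lemma prob_count1 A : bounded_borel A ->
  P (count A @^-1` [set 1%N]) = (lam A * expR (- lam A))%:E.
Proof. by move=> bA; rewrite prob_count// poisson_prob_1// lam_ge0. Qed.

Lemma prob_count_gt0 A : bounded_borel A ->
  P (count A @^-1` [set n | (0 < n)%N]) = (1 - expR (- lam A))%:E.
Proof.
move=> bA; have -> : count A @^-1` [set n | (0 < n)%N] = ~` (count A @^-1` [set 0%N]).
  by apply/seteqP; split => w /=; rewrite lt0n => /eqP.
by rewrite probability_setC ?prob_count0//; exact: measurable_count.
Qed.

(** The independence of counts, indexed by a finite type rather than by an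
    initial segment. *)
Lemma independent_counts (X : finType) (A : X -> set (R * R)) (U : X -> set nat) (J : {set X}) :
  (forall i, bounded_borel (A i)) -> trivIset [set: X] A ->
  P (\bigcap_(i in [set i | i \in J]) (count (A i) @^-1` U i)) =
  (\prod_(i in J) P (count (A i) @^-1` U i))%E.
Proof.
move=> bA tA; have [_ _ ind] := xi_poisson.
have := ind #|J| (fun k => A (enum_val k)) (fun k => U (enum_val k)) (fun k => bA _).
move=> /(_ _); rewrite (_ : \bigcap_(i in [set: 'I_#|J|]) _ =
   \bigcap_(i in [set i | i \in J]) (count (A i) @^-1` U i)); last first.
  apply/seteqP; split => w h i /=.
    move=> iJ; have := h (enum_rank_in iJ i) I; rewrite /= enum_rankK_in//.
  by move=> _; apply: h; exact: enum_valP.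
move=> ->.
  by rewrite [RHS]big_enum_val.
move/trivIsetP in tA; apply/trivIsetP => i j _ _ ij; apply: tA => //.
by apply: contra ij => /eqP/enum_val_inj ->.
Qed.

(** Counts are meaningless on unbounded sets, which may contain infinitely many
    points; this makes sense for all sets. *)
Definition many A (k : nat) : set Omega := [set w | exists s : seq (R * R),
  [/\ uniq s, size s = k & forall q, q \in s -> points (xi w) q /\ A q]].

Lemma many_outer A k a L : measurable A -> (intensity m A <= L%:E)%E -> 1 <= a ->
  outer_le P (many A k) (expR ((a - 1) * L) / a ^+ k).
Proof.
move=> mA AL a1.
pose F D := count (A `&` box D) @^-1` [set j | (k <= j)%N].
have FD : many A k `<=` \bigcup_D F D.
  move=> w [s [us sk sA]]; have [D hD] := box_cover s; exists D => //=.
  rewrite /F /= -sk; apply: npoints_ge => //.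
    by apply: finite_count; apply: (@box_bounded D) => p [].
  by move=> q /= qs; have [] := sA _ qs; split => //; split => //; exact: hD.
apply: outer_le_sub FD _; apply: outer_le_bigcup_nondecreasing.
- by move=> D; apply: measurable_count; exact: box_borel.
- move=> D; rewrite /F prob_count; last exact: box_borel.
  apply: (le_trans (poisson_prob_tail _ (lam_ge0 _) a1)).
  rewrite lee_fin ler_wpM2r ?invr_ge0 ?exprn_ge0//; first exact: le_trans a1.
  rewrite ler_expR ler_wpM2l ?subr_ge0//; apply: lam_le; apply: le_trans AL.
  by apply: (le_intensity (box_borel D mA).1 mA) => p [].
move=> D D' DD'; apply/subsetPset => w /= h; apply: leq_trans h _.
apply: npoints_sub; first by apply: finite_count; apply: (@box_bounded D') => p [].
by move=> p [wp [Ap bp]]; split => //; split => //; exact: box_sub bp.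
Qed.

Lemma hit_outer A L : measurable A -> (intensity m A <= L%:E)%E -> 0 <= L ->
  outer_le P [set w | exists2 q, points (xi w) q & A q] L.
Proof.
move=> mA AL L0.
pose F D := count (A `&` box D) @^-1` [set j | (0 < j)%N].
have FD : [set w | exists2 q, points (xi w) q & A q] `<=` \bigcup_D F D.
  move=> w [q wq Aq]; have [D hD] := box_cover [:: q]; exists D => //=.
  rewrite /F /= -[1%N]/(size [:: q]); apply: npoints_ge => //.
    by apply: finite_count; apply: (@box_bounded D) => p [].
  by move=> p /=; rewrite inE => /eqP ->; do 2 split => //; exact/hD/mem_head.
apply: outer_le_sub FD _; apply: outer_le_bigcup_nondecreasing.
- by move=> D; apply: measurable_count; exact: box_borel.
- move=> D; rewrite /F prob_count_gt0; last exact: box_borel.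
  rewrite lee_fin; have := expR_ge1Dx (- lam (A `&` box D)).
  have : lam (A `&` box D) <= L.
    apply: lam_le; apply: le_trans AL.
    by apply: (le_intensity (box_borel D mA).1 mA) => p [].
  lra.
move=> D D' DD'; apply/subsetPset => w /= h; apply: leq_trans h _.
apply: npoints_sub; first by apply: finite_count; apply: (@box_bounded D') => p [].
by move=> p [wp [Ap bp]]; split => //; split => //; exact: box_sub bp.
Qed.

End field.

(** * A window of space-time around a good point *)

Section windows.
Context {R : realType} (i0 K : R) (ell M : nat).
Implicit Types (S : set (R * R)) (p q : R * R) (tau : R).

Local Notation wnd := (wnd ell M).
Local Notation slab_end := (slab_end M).
Local Notation inI := (inI i0).

(** Both directions of time are treated together: [side s tau] is the base point
    and [fl s] the reflection on the side s. *)
Definition side (s : bool) tau : R := if s then - (tau + 1) else tau.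
Definition fl (s : bool) p : R * R := if s then flip p else p.

(** A product of a time interval, counted on the side s, with a set of positions. *)
Definition region (s : bool) (a b : R) (J : set R) : set (R * R) :=
  [set p | a <= (fl s p).1 <= b /\ J p.2].

Definition tbox (s : bool) tau (k : nat) : set (R * R) :=
  region s (wnd (side s tau) k).1 (wnd (side s tau) k).2 [set x | inI x].

Definition midbox tau : set (R * R) := region false tau (tau + 1) [set x | inI x].

Definition far_strip : set R := [set x | K < `|x|].

(** Where a window with n cells on each side may not have any point: in the slab,
    except for the boxes that should contain points, and far from the axis in all
    cells. *)
Definition forbidden tau (n : nat) : set (R * R) :=
  (region false (- slab_end (side true tau)) (slab_end tau) setT `|`
   region false (- slab_end (side true tau) - ell%:R * n%:R)
     (slab_end tau + ell%:R * n%:R) far_strip) `\`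
  (midbox tau `|` \bigcup_(x in [set x : bool * 'I_(M + n) | true]) tbox x.1 tau x.2.+1).

(** The failure of the condition on furnished cells, up to the cell j. *)
Definition empty_cells S (s : bool) tau (j : nat) := exists J : {set 'I_j},
  (j <= 2 * #|J|)%N /\ forall i, i \in J -> S `&` tbox s tau (M.+1 + i) = set0.

(** The failure of the condition on points far from the axis: more than j / 8 of
    them in the first j cells. *)
Definition crowded S (s : bool) tau (j : nat) := exists l : seq (R * R),
  [/\ uniq l, size l = (j %/ 8).+1 & forall q, q \in l -> S q /\
      region s (slab_end (side s tau)) (slab_end (side s tau) + ell%:R * j%:R) far_strip q].

Hypothesis ell2 : (2 <= ell)%N.
Hypothesis IK : forall x, inI x -> `|x| <= K.

Lemma half_count (a b j : nat) : ~~ (j <= 2 * a)%N -> (a + b = j)%N -> (j <= 2 * b)%N.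
Proof. by lia. Qed.

Lemma flK s : involutive (fl s).
Proof. by case: s => //; exact: flipK. Qed.

Lemma fl2 s p : (fl s p).2 = p.2.
Proof. by case: s. Qed.

Lemma sideN s tau : side (~~ s) tau = - (side s tau + 1).
Proof. by case: s => //=; ring. Qed.

Lemma wnd_ge tau k : (0 < k)%N -> tau + 2 <= (wnd tau k).1.
Proof.
move=> k0; have := wnd_gap M ell2 tau k0; rewrite {1}/wnd leq0n /=; lra.
Qed.

(** For j <= n the conditions on the first j cells hold because each of these
    cells is furnished and has no far point; for j > n they are assumed. *)
Lemma window_half S tau n p0 s :
  S `&` midbox tau = [set p0] ->
  (forall s k, (0 < k <= M + n)%N -> exists q, S q /\ tbox s tau k q) ->
  (forall q, S q -> ~ forbidden tau n q) ->
  (forall j, (n < j)%N -> ~ empty_cells S s tau j) ->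
  (forall j, (n < j)%N -> ~ crowded S s tau j) ->
  halfgood i0 K ell M (fl s @^-1` S) (side s tau) (fl s p0).
Proof.
move=> Sp0 Shit Sforb Semp Scr.
have [Sp00 [/andP[tp pt] p0I]] : (S `&` midbox tau) p0 by rewrite Sp0.
have p0s : side s tau <= (fl s p0).1 <= side s tau + 1.
  by case: (s) => /=; lra.
have Shit' k : (0 < k <= M + n)%N -> hit i0 (fl s @^-1` S) (wnd (side s tau) k).
  move=> /(Shit s)[q [Sq [qt qI]]]; exists (fl s q); split => //.
    by rewrite /= flK.
  by rewrite fl2.
have notin q : S q -> (- slab_end (side true tau) <= q.1 <= slab_end tau \/
    (- slab_end (side true tau) - ell%:R * n%:R <= q.1 <= slab_end tau + ell%:R * n%:R
     /\ K < `|q.2|)) -> q = p0 \/ exists s' k, (0 < k)%N /\ tbox s' tau k q.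
  move=> Sq qz; have := Sforb q Sq => /not_andP[|].
    by case; case: qz => [qz|[qz qK]]; [left|right].
  move=> /contrapT[qc|[[s' k] _ qb]].
    by left; have : (S `&` midbox tau) q by []; rewrite Sp0.
  by right; exists s', k.+1.
have slabs q : (fl s p0).1 <= q.1 <= slab_end (side s tau) ->
    - slab_end (side true tau) <= (fl s q).1 <= slab_end tau.
  move: p0s; rewrite /slab_end; have := ler0n R M.
  by case: (s) => /= ? ?; lra.
split.
- by split => //; rewrite fl2.
- by move=> k /andP[k0 kM]; apply: Shit'; rewrite k0 (leq_trans kM)// leq_addr.
- move=> q Sq pq qs.
  have [|qp|[s' [k [k0 [/andP[kq _] qI]]]]] := notin _ Sq.
  + by left; apply: slabs; rewrite !ltW.
  + by move: pq; rewrite -qp flK ltxx.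
  rewrite fl2 in qI; split => //.
  have := wnd_ge (side s' tau) k0.
  have [ss'|] := eqVneq s s'.
    rewrite -ss' flK in kq *; move: p0s => /andP[_]; lra.
  move=> ss'; have {ss'} ss' : s' = ~~ s by case: (s) (s') ss' => -[].
  rewrite ss' sideN in kq *.
  have : (fl (~~ s) (fl s q)).1 = - q.1 by case: (s) => /=; rewrite ?opprK.
  move: p0s => /andP[]; lra.
- move=> j; have [jn|nj] := leqP j n.
    exists (iota 0 j); split.
    + exact: iota_ltn_sorted.
    + by apply/allP => i; rewrite mem_iota.
    + by rewrite size_iota leq_pmull.
    move=> i; rewrite mem_iota => /andP[_ ij]; apply: Shit'.
    by rewrite addSn /= ltn_add2l (leq_trans ij jn).
  have nemp := Semp j nj.
  pose hitb i := `[< exists q, (S `&` tbox s tau (M.+1 + i)) q >].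
  exists [seq i <- iota 0 j | hitb i]; split.
  + by apply: sorted_filter; [exact: ltn_trans|exact: iota_ltn_sorted].
  + by apply/allP => i; rewrite mem_filter mem_iota => /andP[].
  + have [//|h] := boolP (j <= 2 * size [seq i <- iota 0 j | hitb i])%N.
    exfalso; apply: nemp.
    exists (finset.finset (fun i : 'I_j => ~~ hitb i)); split; last first.
      move=> i; rewrite inE => /asboolPn nh.
      by apply/seteqP; split => // q hq; apply: nh; exists q.
    have : (#|(finset.finset (fun i : 'I_j => hitb i))| + #|(finset.finset (fun i : 'I_j => ~~ hitb i))| = j)%N.
      rewrite -[RHS](card_ord j) -(cardsC ((finset.finset (fun i : 'I_j => hitb i)))); congr (_ + #|pred_of_set _|)%N.
      by apply/setP => i; rewrite !inE.
    have -> : #|(finset.finset (fun i : 'I_j => hitb i))| = size [seq i <- iota 0 j | hitb i].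
      by rewrite -val_enum_ord filter_map size_map cardsE cardE /enum_mem -filter_predI; congr (size _); apply: eq_filter => x; rewrite /= andbT.
    exact: half_count.
  move=> i; rewrite mem_filter => /andP[/asboolP[q [Sq [qt qI]]] _].
  by exists (fl s q); split => //; rewrite ?fl2//= flK.
move=> j l j0 ul hl.
have [jn|nj] := leqP j n.
  case: l ul hl => // q l _ /(_ _ (mem_head _ _))[Sq qt qK].
  have [|qp|[s' [k [k0 [_ qI]]]]] := notin _ Sq.
  - right; split; last by rewrite fl2.
    have : ell%:R * j%:R <= ell%:R * n%:R :> R by rewrite ler_wpM2l ?ler_nat.
    move: qt; rewrite /slab_end; have := ler0n R M.
    by case: (s) => /=; lra.
  - by move: qK; rewrite -(fl2 s) qp ltNge IK.
  - by move: qK; rewrite -(fl2 s) ltNge IK.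
rewrite leqNgt; apply/negP => h; apply: (Scr j nj).
have sl : ((j %/ 8).+1 <= size l)%N.
  by rewrite ltn_divLR// mulnC.
exists (map (fl s) (take (j %/ 8).+1 l)); split.
- by rewrite map_inj_uniq; [exact: take_uniq|exact: inv_inj (flK s)].
- by rewrite size_map size_takel.
move=> q /mapP[q' /mem_take /hl[Sq' qt qK]] ->; split => //.
by split; [rewrite flK|rewrite /far_strip /= fl2].
Qed.

Lemma window_good S tau n p0 :
  S `&` midbox tau = [set p0] ->
  (forall s k, (0 < k <= M + n)%N -> exists q, S q /\ tbox s tau k q) ->
  (forall q, S q -> ~ forbidden tau n q) ->
  (forall s j, (n < j)%N -> ~ empty_cells S s tau j) ->
  (forall s j, (n < j)%N -> ~ crowded S s tau j) ->
  goodpoint i0 K ell M S tau p0.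
Proof.
move=> Sp0 Shit Sforb Semp Scr.
have hg s := window_half Sp0 Shit Sforb (Semp s) (Scr s).
have [Sp00 [/andP[tp pt] p0I]] : (S `&` midbox tau) p0 by rewrite Sp0.
split => //; [|exact: (hg false)|exact: (hg true)].
move=> q Sq qp; have := Sforb q Sq => /not_andP[|].
  case; left; split => //; rewrite /fl qp /slab_end /=.
  by have := ler0n R M; lra.
move=> /contrapT[qc|[[s k] _ [/andP[qt _] _]]].
  by have : (S `&` midbox tau) q by []; rewrite Sp0.
exfalso; have := wnd_ge (side s tau) (ltn0Sn k); move: qt tp pt; rewrite -qp /=.
by case: s => /=; lra.
Qed.

End windows.

(** * The tails of a window *)

Section window_probability.
Context (R : realType) (m : {finite_measure set (measurableTypeR R) -> \bar R}).
Context d (Omega : measurableType d) (P : probability Omega R).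
Variable xi : Omega -> configuration R.
Hypothesis xi_poisson : poisson_point_field m P xi.
Variables (i0 K : R) (ell M : nat).

Local Notation count := (count_in xi).
Local Notation wnd := (wnd ell M).
Local Notation slab_end := (slab_end M).
Local Notation inI := (inI i0).
Local Notation tbox := (tbox i0 ell M).
Local Notation midbox := (midbox i0).
Local Notation forbidden := (forbidden i0 K ell M).
Local Notation empty_cells := (empty_cells i0 ell M).
Local Notation crowded := (crowded K ell M).
Local Notation T2 := (measurableTypeR R * measurableTypeR R)%type.

Implicit Types (tau : R) (s : bool) (j k n : nat).

Definition strip : set R := [set x | inI x].

Let mu := fine (m strip).
Let delta := fine (m (far_strip K)).

Lemma regionE s (a b : R) (J : set R) : region s a b J =
  (`[if s then - b else a, if s then - a else b]%classic `*` J) :> set (R * R).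
Proof.
apply/seteqP; split=> -[t x]; rewrite /region /=; case: s => /=; rewrite in_itv/=.
- by move=> [/andP[h1 h2] Jx]; split => //; rewrite lerNl h2 lerNr h1.
- by [].
- by move=> [/andP[h1 h2] Jx]; split => //; rewrite lerNr h2 lerNl h1.
- by [].
Qed.

Lemma measurable_region s (a b : R) (J : set (measurableTypeR R)) : measurable J ->
  measurable (region s a b J : set T2).
Proof. by move=> mJ; rewrite regionE; apply: measurableX => //; exact: measurable_itv. Qed.

Lemma intensity_region s (a b : R) (J : set (measurableTypeR R)) : a <= b -> measurable J ->
  intensity m (region s a b J) = ((b - a) * fine (m J))%:E.
Proof.
move=> ab mJ; rewrite regionE intensity_itv//.
  by congr ((_ * _)%:E); case: s; ring.
by case: s; rewrite ?lerN2.
Qed.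

Lemma region_borel s (a b c : R) (J : set (measurableTypeR R)) : measurable J ->
  (forall x, J x -> `|x| <= c) -> bounded_borel (region s a b J).
Proof.
move=> mJ Jc; split; first exact: measurable_region.
apply: (@bounded_setP _ _ (Num.max (Num.max `|a| `|b|) c)) => p [/andP[ap pb] /Jc pc].
split; last by rewrite le_max pc orbT.
have -> : `|p.1| = `|(fl s p).1| by case: (s) => //=; rewrite normrN.
rewrite !le_max; have [x0|x0] := leP 0 (fl s p).1.
  by rewrite [X in _ || (X <= `|b|)]ger0_norm// [X in (X <= _) || _]ger0_norm// (le_trans pb (ler_norm _)) !orbT.
have a0 : a < 0 by exact: le_lt_trans x0.
by rewrite (ltr0_norm x0) (ltr0_norm a0) lerN2 ap.
Qed.

Lemma measurable_strip : measurable (strip : set (measurableTypeR R)).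
Proof.
rewrite (_ : strip = `[i0, i0 + 2^-1[%classic); first exact: measurable_itv.
by apply/seteqP; split => x /=; rewrite in_itv.
Qed.

Lemma measurable_far : measurable (far_strip K : set (measurableTypeR R)).
Proof.
rewrite (_ : far_strip K = ~` `[- K, K]%classic); first by apply: measurableC; exact: measurable_itv.
by apply/seteqP; split => x; rewrite /far_strip /= in_itv/= -ler_norml ltNge => /negP.
Qed.

Hypothesis ell2 : (2 <= ell)%N.
Hypothesis IK : forall x, inI x -> `|x| <= K.

Lemma tbox_borel s tau k : @bounded_borel R (tbox s tau k).
Proof. by apply: (@region_borel _ _ _ K); [exact: measurable_strip|move=> x; exact: IK]. Qed.

Lemma midbox_borel tau : @bounded_borel R (midbox tau).
Proof. by apply: (@region_borel _ _ _ K); [exact: measurable_strip|move=> x; exact: IK]. Qed.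

Lemma wnd_length tau k : (wnd tau k).2 - (wnd tau k).1 = if (k <= M)%N then 1 else ell%:R - 1.
Proof. by rewrite /wnd; case: ifP => _ /=; field. Qed.

Lemma wnd_length_ge1 k : 1 <= (if (k <= M)%N then 1 else ell%:R - 1 : R).
Proof.
case: ifP => // _; have : 2 <= ell%:R :> R by rewrite ler_nat.
lra.
Qed.

Lemma lam_tbox s tau k : @lam R m (tbox s tau k) = (if (k <= M)%N then 1 else ell%:R - 1) * mu.
Proof.
rewrite /lam intensity_region ?wnd_length//; last exact: measurable_strip.
by rewrite -subr_ge0 wnd_length (le_trans ler01)// wnd_length_ge1.
Qed.

Lemma lam_midbox tau : @lam R m (midbox tau) = mu.
Proof.
rewrite /lam intensity_region; [|by rewrite lerDl|exact: measurable_strip].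
by rewrite /= addrAC subrr add0r mul1r.
Qed.

Lemma tbox_disjoint s tau k s' k' : (0 < k)%N -> (0 < k')%N -> (s, k) != (s', k') ->
  tbox s tau k `&` tbox s' tau k' = set0.
Proof.
move=> k0 k'0 ne; apply/seteqP; split => // q [[/andP[q1 q2] _] [/andP[q3 q4] _]].
have [ss'|] := eqVneq s s'.
  move: ne q1 q2 q3 q4; rewrite ss' xpair_eqE eqxx /= neq_ltn => /orP[kk'|kk'] q1 q2 q3 q4.
    have := wnd_gap M ell2 (side s' tau) kk'; rewrite /=; lra.
  have := wnd_gap M ell2 (side s' tau) kk'; rewrite /=; lra.
move=> ss'; have {ss'} ss' : s' = ~~ s by case: (s) (s') ss' => -[].
have := wnd_ge M ell2 (side s tau) k0; have := wnd_ge M ell2 (side s' tau) k'0.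
rewrite ss' sideN in q3 *.
have : (fl (~~ s) q).1 = - (fl s q).1 by case: (s) => /=; rewrite ?opprK.
lra.
Qed.

Lemma midbox_tbox_disjoint s tau k : (0 < k)%N -> midbox tau `&` tbox s tau k = set0.
Proof.
move=> k0; apply/seteqP; split => // q [[/andP[q1 q2] _] [/andP[q3 _] _]].
have := wnd_ge M ell2 (side s tau) k0; move: q1 q2 q3.
by case: s => /=; lra.
Qed.

(** There are 2^j sets of cells, and each set of at least j / 2 cells is empty
    with probability at most exp (- mu (ell - 1))^(j / 2). *)
Lemma empties_outer s tau j : outer_le P [set w | empty_cells (xi w) s tau j]
  ((2 * expR (- (mu * (ell%:R - 1) / 2))) ^+ j).
Proof.
set th := expR _.
pose G (J : {set 'I_j}) : set Omega := if (j <= 2 * #|J|)%N then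
  \bigcap_(i in [set i | i \in J]) (count (tbox s tau (M.+1 + i)) @^-1` [set 0%N]) else set0.
apply: (@outer_le_sub _ _ _ _ _ (\bigcup_J G J)).
  move=> w [J [jJ hJ]]; exists J => //; rewrite /G jJ => i iJ /=.
  by rewrite /count_in hJ// /npoints fset_set0 cardfs0.
have -> : (2 * th) ^+ j = \sum_(J : {set 'I_j}) th ^+ j.
  rewrite sumr_const exprMn cardT /= -[RHS]mulr_natl; congr (_ * _).
  by rewrite -cardE -cardsT -powersetT card_powerset cardsT card_ord natrX.
apply: outer_le_bigU => J; rewrite /G; case: ifPn => jJ; last first.
  by exists set0; split => //; rewrite measure0 lee_fin exprn_ge0// expR_ge0.
eexists; split; [|exact: subset_refl|].
  apply: fin_bigcap_measurable => [|i _]; first exact: finite_finset.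
  by apply: (measurable_count xi_poisson); exact: tbox_borel.
rewrite (independent_counts xi_poisson); [|by move=> i; exact: tbox_borel|].
  under eq_bigr do rewrite (prob_count0 xi_poisson (tbox_borel _ _ _)) lam_tbox.
  rewrite prodEFin lee_fin.
  rewrite (eq_bigr (fun=> (th ^+ 2))) => [|i _]; last first.
    rewrite leqNgt ltnS leq_addr /= /th -expRM_natl; congr expR.
    by field.
  rewrite prodr_const -exprM; apply: ler_wiXn2l => //.
    exact: expR_ge0.
  rewrite -[leRHS]expR0 ler_expR oppr_le0 divr_ge0// mulr_ge0//.
    by rewrite fine_ge0.
  by have := wnd_length_ge1 M.+1; rewrite ltnn; lra.
apply/trivIsetP => i i' _ _ ii'; apply: tbox_disjoint => //.
by rewrite xpair_eqE eqxx /= eqn_add2l.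
Qed.

Lemma crowded_outer s tau j a : 1 <= a ->
  outer_le P [set w | crowded (xi w) s tau j]
    (expR ((a - 1) * (ell%:R * j%:R * delta)) / a ^+ (j %/ 8).+1).
Proof.
move=> a1.
have -> : [set w | crowded (xi w) s tau j] =
    many xi (region s (slab_end (side s tau)) (slab_end (side s tau) + ell%:R * j%:R) (far_strip K)) (j %/ 8).+1.
  by [].
apply: (many_outer xi_poisson) => //.
  by apply: measurable_region; exact: measurable_far.
rewrite intensity_region; [|by rewrite lerDl|exact: measurable_far].
by rewrite addrAC subrr add0r.
Qed.

Hypothesis empty_rate : 2 * expR (- (mu * (ell%:R - 1) / 2)) <= 64^-1.
Hypothesis far_rate : (128 ^+ 8 - 1) * (ell%:R * delta) <= 2^-1.

(** Tilting by a = 128^8: the number of far points in j cells exceeds j / 8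
    with probability at most exp (j / 2) / 128^j <= 2^j / 128^j. *)
Lemma crowded_outer_geometric s tau j :
  outer_le P [set w | crowded (xi w) s tau j] (64^-1 ^+ j).
Proof.
have a1 : 1 <= 128 ^+ 8 :> R by rewrite exprn_ege1// ler1n.
apply: outer_le_trans (crowded_outer s tau j a1).
have e2 : expR (2^-1) <= 2 :> R.
  have := expR_ge1Dx (- 2^-1 : R); rewrite expRN.
  have := expR_gt0 (2^-1 : R); set x := expR _ => x0 h.
  have : x^-1 * x = 1 by rewrite mulVf// gt_eqF.
  nra.
rewrite ler_pdivrMr ?exprn_gt0 ?exprn_gt0//.
have -> : (128 ^+ 8 - 1) * (ell%:R * j%:R * delta) = ((128 ^+ 8 - 1) * (ell%:R * delta)) * j%:R :> R by ring.
apply: (@le_trans _ _ (expR (2^-1 * j%:R))).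
  by rewrite ler_expR ler_wpM2r.
rewrite mulrC expRM_natl.
apply: (@le_trans _ _ (2 ^+ j)); first by rewrite lerXn2r// nnegrE// expR_ge0.
apply: (@le_trans _ _ (64^-1 ^+ j * 128 ^+ j)).
  by rewrite -exprMn (_ : 64^-1 * 128 = 2)//; field.
rewrite ler_wpM2l ?exprn_ge0// -exprM ler_weXn2l ?ler1n//.
by rewrite mulnC ltnW// ltn_ceil.
Qed.

Definition bad_tail tau n : set Omega := [set w | exists s j, (n < j)%N /\
  (empty_cells (xi w) s tau j \/ crowded (xi w) s tau j)].

(** A sum over both sides and over j > n of two terms 64^- j. *)
Lemma bad_tail_outer tau n : outer_le P (bad_tail tau n) (64^-1 ^+ n).
Proof.
pose B s i : set Omega := [set w | empty_cells (xi w) s tau (n.+1 + i)] `|`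
  [set w | crowded (xi w) s tau (n.+1 + i)].
apply: (@outer_le_sub _ _ _ _ _ (\bigcup_s \bigcup_i B s i)).
  move=> w [s [j [nj h]]]; exists s => //; exists (j - n.+1)%N => //.
  by rewrite /B /= subnKC.
apply: (@outer_le_trans _ _ _ _ _ (\sum_(s : bool) 2 * (2 * 64^-1 ^+ n.+1))).
  rewrite big_bool /= exprS; set x := 64^-1 ^+ n.
  have : 0 <= x by rewrite /x exprn_ge0.
  by move: x => x; lra.
apply: outer_le_bigU => s; apply: (@outer_le_geometric _ _ _ _ _ _ 64^-1) => //.
- by rewrite invr_ge0 ler0n /= lef_pV2 ?posrE// ler_nat.
move=> i; apply: (@outer_le_trans _ _ _ _ _ (64^-1 ^+ (n.+1 + i) + 64^-1 ^+ (n.+1 + i))).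
  by rewrite -mulrA -exprD; move: (_ ^+ _) => x; lra.
apply: outer_leU; last exact: crowded_outer_geometric.
apply: outer_le_trans (empties_outer s tau _).
by rewrite lerXn2r// nnegrE// mulr_ge0// expR_ge0.
Qed.

End window_probability.

(** * Independent windows *)

Lemma big_option (R : Type) (idx : R) (op : Monoid.com_law idx) (T : finType)
    (F : option T -> R) :
  \big[op/idx]_x F x = op (F None) (\big[op/idx]_(t : T) F (Some t)).
Proof.
rewrite (bigD1 None)//=; congr (op _ _).
rewrite (reindex_omap (@Some T) id) => [|[t|]]//=.
by apply: eq_bigl => t; rewrite eqxx.
Qed.

Lemma eq_weak_le (R : realType) (x y : R) : x = y -> x <= y.
Proof. by move=> ->. Qed.

Lemma slab_window_le (R : realType) (x y z : R) : x <= y -> 0 <= z ->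
  0 + 2 * x + 1 <= 0 + 2 * y + 2 + z.
Proof. by lra. Qed.

Lemma cell_window_le (R : realType) (e x y z : R) : 0 <= e -> x + 1 <= y ->
  z + e * x + e - 2^-1 <= z + e * y.
Proof. by nra. Qed.

Section window_trials.
Context (R : realType) (m : {finite_measure set (measurableTypeR R) -> \bar R}).
Context d (Omega : measurableType d) (P : probability Omega R).
Variable xi : Omega -> configuration R.
Hypothesis xi_poisson : poisson_point_field m P xi.
Variables (i0 K : R) (ell M : nat).

Local Notation count := (count_in xi).
Local Notation wnd := (wnd ell M).
Local Notation slab_end := (slab_end M).
Local Notation inI := (inI i0).
Local Notation tbox := (tbox i0 ell M).
Local Notation midbox := (midbox i0).
Local Notation forbidden := (forbidden i0 K ell M).
Local Notation bad_tail := (bad_tail xi i0 K ell M).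
Local Notation T2 := (measurableTypeR R * measurableTypeR R)%type.
Local Notation mu := (fine (m (strip i0))).
Local Notation delta := (fine (m (far_strip K))).
Local Notation total := (fine (m setT)).
Local Notation lam := (@lam R m).
Implicit Types (tau : R) (s : bool) (j k n D : nat).

Hypothesis ell2 : (2 <= ell)%N.
Hypothesis IK : forall x, inI x -> `|x| <= K.
Hypothesis empty_rate : 2 * expR (- (mu * (ell%:R - 1) / 2)) <= 64^-1.
Hypothesis far_rate : (128 ^+ 8 - 1) * (ell%:R * delta) <= 2^-1.
Hypothesis mu_gt0 : 0 < mu.

Lemma measurable_forbidden tau n : measurable (forbidden tau n : set T2).
Proof.
apply: measurableD.
  apply: measurableU; apply: measurable_region; [exact: measurableT|exact: measurable_far].
apply: measurableU; first exact: (midbox_borel IK tau).1.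
apply: fin_bigcup_measurable => [|x _]; last exact: (tbox_borel ell M IK _ _ _).1.
exact: finite_finset.
Qed.

(** A bound for the expected number of points in the forbidden part of the slab. *)
Definition slab_rate : R := (4 * M%:R + 3) * (total + delta).

Lemma lam_forbidden tau n D : lam (forbidden tau n `&` box D) <=
  slab_rate + 2 * n%:R * (ell%:R * delta).
Proof.
apply: lam_le.
set A := region false (- slab_end (side true tau)) (slab_end tau) setT.
set B := region false (- slab_end (side true tau) - ell%:R * n%:R)
     (slab_end tau + ell%:R * n%:R) (far_strip K).
have mA : measurable (A : set T2) by apply: measurable_region; exact: measurableT.
have mB : measurable (B : set T2) by apply: measurable_region; exact: measurable_far.
have M0 := ler0n R M.
have n0 : 0 <= ell%:R * n%:R :> R by rewrite mulr_ge0.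
have h1 : - slab_end (side true tau) <= slab_end tau by rewrite /slab_end /=; lra.
have h2 : - slab_end (side true tau) - ell%:R * n%:R <= slab_end tau + ell%:R * n%:R by lra.
apply: (@le_trans _ _ (intensity m (A `|` B))).
  apply: le_intensity; [|exact: measurableU|by move=> p [[]]].
  by apply: measurableI; [exact: measurable_forbidden|exact: measurable_box].
have : (intensity m (A `|` B) <= intensity m A + intensity m B)%E by exact: measureU2.
move=> /le_trans; apply.
rewrite /A /B !intensity_region//; [|exact: measurable_far].
rewrite -EFinD lee_fin /slab_rate /slab_end /=.
by apply: eq_weak_le; ring.
Qed.

(** The regions of a window: the forbidden one ([None]), the one around the good
    point ([Some None]), and the boxes on each side. *)
Definition reg_index n : finType := option (option (bool * 'I_(M + n))).

Definition reg tau n D (x : reg_index n) : set (R * R) :=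
  match x with
  | None => forbidden tau n `&` box D
  | Some None => midbox tau
  | Some (Some (s, k)) => tbox s tau k.+1
  end.

Definition reg_count n (x : reg_index n) : set nat :=
  match x with
  | None => [set 0%N]
  | Some None => [set 1%N]
  | Some (Some _) => [set k | (0 < k)%N]
  end.

Lemma reg_borel tau n D x : @bounded_borel R (@reg tau n D x).
Proof.
case: x => [[[s k]|]|] /=.
- exact: (tbox_borel ell M IK s tau k.+1).
- exact: (midbox_borel IK tau).
- by apply: box_borel; exact: measurable_forbidden.
Qed.

Lemma reg_disjoint tau n D : trivIset [set: reg_index n] (@reg tau n D).
Proof.
apply/trivIsetP => x y _ _.
have sym (A B : set (R * R)) : B `&` A = set0 -> A `&` B = set0 by rewrite setIC.
case: x y => [[[s k]|]|] [[[s' k']|]|] //= xy.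
- by apply: tbox_disjoint => //; apply: contra xy => /eqP[-> /val_inj ->].
- by apply: sym; exact: midbox_tbox_disjoint.
- apply/seteqP; split => // q [qk [[_ hn] _]]; apply: hn; right.
  by exists (s, k).
- exact: midbox_tbox_disjoint.
- by apply/seteqP; split => // q [qk [[_ hn] _]]; apply: hn; left.
- apply/seteqP; split => // q [[[_ hn] _] qk]; apply: hn; right.
  by exists (s', k').
- by apply/seteqP; split => // q [[[_ hn] _] qk]; apply: hn; left.
Qed.

(** The box D makes the forbidden region bounded. *)
Definition window tau n D : set Omega :=
  \bigcap_(x in [set: reg_index n]) (count (reg tau D x) @^-1` reg_count x).

Lemma measurable_window tau n D : measurable (window tau n D).
Proof.
apply: fin_bigcap_measurable => [|x _]; first exact: finite_finset.
by apply: (measurable_count xi_poisson); exact: reg_borel.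
Qed.

Lemma window_goodpoint tau n D w : window tau n D w ->
  (forall q, points (xi w) q -> forbidden tau n q -> box D q) ->
  ~ bad_tail tau n w -> exists p0, goodpoint i0 K ell M (xi w) tau p0.
Proof.
move=> W far tail.
have fin A : @bounded_borel R A -> finite_set (xi w `&` A).
  by move=> [_ bA]; exact: points_locally_finite.
have [p0 p0E] : exists p0, points (xi w) `&` midbox tau = [set p0].
  by apply: npoints1; [apply: fin; exact: (midbox_borel IK tau)|exact: (W (Some None))].
exists p0; apply: (@window_good _ _ _ _ _ ell2 IK _ _ n) => //.
- move=> s [|k]//= kM; have := W (Some (Some (s, Ordinal kM))) I => /= /npoints_gt0.
  by move=> /(_ (fin _ (tbox_borel ell M IK _ _ _)))[q [? ?]]; exists q.
- move=> q wq fq; have : (xi w `&` (forbidden tau n `&` box D)) q.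
    by split => //; split => //; exact: far.
  rewrite (npoints0 _ (W None I))//; apply: fin; exact: (reg_borel tau D None).
- by move=> s j nj h; apply: tail; exists s, j; split => //; left.
- by move=> s j nj h; apply: tail; exists s, j; split => //; right.
Qed.

(** Each of the n cells costs a factor 1/2 on either side for being furnished,
    and a factor 1/4 for both sides together for having no far point, whence
    16^- n for the window. *)
Definition reg_prob n (x : reg_index n) : R :=
  match x with
  | None => expR (- slab_rate) * (4^-1) ^+ n
  | Some None => mu * expR (- mu)
  | Some (Some (_, k)) => if (k < M)%N then 1 - expR (- mu) else 2^-1
  end.

Definition success_rate : R := expR (- slab_rate) * (mu * expR (- mu)) * (1 - expR (- mu)) ^+ (2 * M).

Lemma reg_prob_ge tau n D (x : reg_index n) :
  ((reg_prob x)%:E <= P (count (reg tau D x) @^-1` reg_count x))%E.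
Proof.
case: x => [[[s k]|]|] /=.
- rewrite (prob_count_gt0 xi_poisson (tbox_borel ell M IK s tau k.+1)) lee_fin lam_tbox//.
  case: ifP => kM; first by rewrite mul1r.
  have -> : expR (- ((ell%:R - 1) * mu)) = expR (- (mu * (ell%:R - 1) / 2)) ^+ 2.
    by rewrite -expRM_natl; congr expR; field.
  have := expR_ge0 (- (mu * (ell%:R - 1) / 2)); have := empty_rate.
  by move: (expR _) => x; nra.
- by rewrite (prob_count1 xi_poisson (midbox_borel IK tau)) lam_midbox.
- have bF : @bounded_borel R (forbidden tau n `&` box D) by exact: (reg_borel tau D None).
  rewrite (prob_count0 xi_poisson bF) lee_fin.
  apply: (@le_trans _ _ (expR (- (slab_rate + 2 * n%:R * (ell%:R * delta))))); last first.
    by rewrite ler_expR lerN2 lam_forbidden.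
  rewrite opprD expRD ler_wpM2l ?expR_ge0//.
  have -> : expR (- (2 * n%:R * (ell%:R * delta))) = (expR (- (ell%:R * delta)) ^+ 2) ^+ n.
    by rewrite -!expRM_natl; congr expR; ring.
  rewrite lerXn2r ?nnegrE ?exprn_ge0 ?expR_ge0//.
  have := expR_ge1Dx (- (ell%:R * delta)).
  have : ell%:R * delta <= 2^-1.
    have d0 : 0 <= ell%:R * delta by rewrite mulr_ge0// fine_ge0.
    apply: le_trans far_rate; rewrite ler_peMl//.
    have : 1 <= 128 ^+ 7 :> R by rewrite exprn_ege1// ler1n.
    by rewrite (exprS _ 7); move: (128 ^+ 7) => x; lra.
  have key (x y : R) : y <= 2^-1 -> 1 - y <= x -> 4^-1 <= x ^+ 2 by nra.
  by move=> h1 h2; exact: key h1 h2.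
Qed.

Lemma window_prob tau n D : ((success_rate * (16^-1) ^+ n)%:E <= P (window tau n D))%E.
Proof.
have := independent_counts xi_poisson (@reg_count n) finset.setT (reg_borel tau D) (@reg_disjoint tau n D).
rewrite (_ : [set i | i \in finset.setT] = setT); last by apply/seteqP; split => // x; rewrite /= inE.
move=> WE; rewrite /window WE.
have p0 x : 0 <= reg_prob (x : reg_index n).
  have e1 : expR (- mu) <= 1 by rewrite -expR0 ler_expR oppr_le0 ltW.
  case: x => [[[s k]|]|] /=.
  - by case: ifP => _; rewrite ?subr_ge0// invr_ge0.
  - by rewrite mulr_ge0 ?expR_ge0// ltW.
  - by rewrite mulr_ge0 ?expR_ge0// exprn_ge0// invr_ge0.
apply: (@le_trans _ _ (\prod_(x in finset.setT) (reg_prob (x : reg_index n)))%:E).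
  rewrite (eq_bigl xpredT); last by move=> x; rewrite inE.
  rewrite !big_option /=.
  rewrite (eq_bigr (fun sk : bool * 'I_(M + n) => if (sk.2 < M)%N then 1 - expR (- mu) else 2^-1)); last by case.
  rewrite -(pair_bigA _ (fun (s : bool) (k : 'I_(M + n)) => if (k < M)%N then 1 - expR (- mu) else 2^-1 : R)).
  have inner (c : R) : \prod_(k < M + n) (if (k < M)%N then c else 2^-1) = c ^+ M * 2^-1 ^+ n.
    rewrite big_split_ord /=; congr (_ * _).
      by rewrite (eq_bigr (fun=> c)) ?prodr_const ?card_ord// => k _; rewrite ltn_ord.
    by rewrite (eq_bigr (fun=> 2^-1)) ?prodr_const ?card_ord// => k _; rewrite ltnNge leq_addr.
  rewrite big_bool /= inner lee_fin /success_rate.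
  have -> : 16^-1 ^+ n = 4^-1 ^+ n * (2^-1 ^+ n * 2^-1 ^+ n) :> R.
    by rewrite -!exprMn; congr (_ ^+ _); field.
  by rewrite mul2n -addnn exprD; apply: eq_weak_le; ring.
have key (s : seq (reg_index n)) :
    ((\prod_(x <- s) reg_prob x)%:E <=
      \prod_(x <- s) P (count (reg tau D x) @^-1` reg_count x))%E.
  elim: s => [|x s ih]; first by rewrite !big_nil.
  rewrite !big_cons EFinM; apply: lee_pmul => //; last exact: reg_prob_ge.
    by rewrite lee_fin.
  by rewrite lee_fin prodr_ge0.
rewrite (eq_bigl xpredT); last by move=> x; rewrite inE.
rewrite [leRHS](eq_bigl xpredT); last by move=> x; rewrite inE.
exact: key.
Qed.

(** The windows are 1 apart, so the closed regions of different ones are disjoint. *)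
Definition window_length n : R := 4 * M%:R + 4 + 2 * (ell%:R * n%:R).

Definition base (T : R) n (i : nat) : R :=
  T + 2 * M%:R + 1 + ell%:R * n%:R + i%:R * window_length n.

Lemma forbidden_time T n i p : forbidden (base T n i) n p ->
  T + i%:R * window_length n <= p.1 <= T + i.+1%:R * window_length n - 1.
Proof.
have M0 := ler0n R M.
have n0 : 0 <= ell%:R * n%:R :> R by rewrite mulr_ge0.
rewrite -natr1 mulrDl mul1r; set w := i%:R * window_length n.
move=> [[[/= h _]|[/= h _]] _]; move: h; rewrite /slab_end /= /base -/w /window_length; lra.
Qed.

Lemma reg_time T n D i x p : @reg (base T n i) n D x p ->
  T + i%:R * window_length n <= p.1 <= T + i.+1%:R * window_length n - 1.
Proof.
have M0 := ler0n R M.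
have n0 : 0 <= ell%:R * n%:R :> R by rewrite mulr_ge0.
rewrite -natr1 mulrDl mul1r; set w := i%:R * window_length n.
have range p1 : - slab_end (side true (base T n i)) - ell%:R * n%:R <= p1 <=
    slab_end (base T n i) + ell%:R * n%:R -> T + w <= p1 <= T + (w + window_length n) - 1.
  by rewrite /slab_end /= /base -/w /window_length; lra.
have wnd_le k : (k <= M + n)%N -> (wnd (0 : R) k).2 <= slab_end (0 : R) + ell%:R * n%:R.
  move=> kMn; rewrite /wnd; case: leqP => kM /=.
    by apply: slab_window_le => //; rewrite ler_nat.
  apply: cell_window_le; first exact: ler0n.
  by rewrite natr1 ler_nat -subSn// leq_subLR addSn ltnS.
have wndT tau k : (wnd tau k).2 = tau + (wnd 0 k).2 /\ (wnd tau k).1 = tau + (wnd 0 k).1.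
  by rewrite /wnd; case: ifP => _ /=; rewrite /slab_end; split; ring.
case: x => [[[s k]|]|] /=.
- move=> [/andP[]]; have := wnd_le k.+1 (ltn_ord k).
  have := wnd_ge M ell2 (side s (base T n i)) (ltn0Sn k).
  rewrite (wndT (side s _) k.+1).2 (wndT (side s _) k.+1).1 /= => h1 h2 h3 h4 _; apply: range.
  rewrite /slab_end /= in h2 *.
  by move: h1 h2 h3 h4; case: (s) => /=; move: (base T n i) => b; lra.
- move=> [/andP[/= h1 h2] _]; apply: range; rewrite /slab_end /=.
  by move: h1 h2; move: (base T n i) => b; lra.
- by move=> [/forbidden_time]; rewrite -natr1 mulrDl mul1r.
Qed.

Lemma windows_independent T n D (r : nat) (s : seq 'I_r) : uniq s ->
  P (\bigcap_(i in [set` s]) window (base T n i) n D) =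
  (\prod_(i <- s) fine (P (window (base T n i) n D)))%:E.
Proof.
move=> us.
pose A (y : 'I_r * reg_index n) := reg (base T n y.1) D y.2.
pose U (y : 'I_r * reg_index n) := reg_count y.2.
have bA y : @bounded_borel R (A y) by exact: reg_borel.
have tA : trivIset [set: 'I_r * reg_index n] A.
  apply/trivIsetP => -[i x] [j y] _ _ ne; rewrite /A /=.
  have [ij|ij] := eqVneq i j.
    move: (@reg_disjoint (base T n j) n D) => /trivIsetP; rewrite ij; apply => //.
    by apply: contra ne => /eqP ->; rewrite ij.
  apply/seteqP; split => // p [/reg_time/andP[h1 h2] /reg_time/andP[h3 h4]].
  have wl0 : 0 <= window_length n.
    by rewrite /window_length !addr_ge0// !mulr_ge0.
  have sep (a b : nat) : (a < b)%N -> a.+1%:R * window_length n <= b%:R * window_length n.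
    by move=> ab; rewrite ler_wpM2r// ler_nat.
  move: ij; rewrite neq_ltn => /orP[/sep|/sep]; lra.
have W1 (i : 'I_r) : window (base T n i) n D = \bigcap_(y in [set y | y \in finset.finset (fun y : 'I_r * reg_index n => y.1 == i)]) (count (A y) @^-1` U y).
  apply/seteqP; split => w h; last by move=> x _; apply: (h (i, x)); rewrite /= inE.
  by move=> [j x]; rewrite /= inE /= => /eqP ->; exact: h.
have PW (i : 'I_r) : P (window (base T n i) n D) = (\prod_(x : reg_index n) P (count (A (i, x)) @^-1` U (i, x)))%E.
  rewrite W1 (independent_counts xi_poisson)//.
  rewrite (eq_bigl (fun y : 'I_r * reg_index n => (y.1 == i) && true)); last by move=> y; rewrite inE andbT.
  rewrite (eq_bigr (fun y => P (count (A (y.1, y.2)) @^-1` U (y.1, y.2)))); last by case.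
  by rewrite -(pair_big_dep (fun j : 'I_r => j == i) (fun _ _ => true) (fun (j : 'I_r) (x : reg_index n) => P (count (A (j, x)) @^-1` U (j, x)))) /= big_pred1_eq.
have -> : \bigcap_(i in [set` s]) window (base T n i) n D =
    \bigcap_(y in [set y | y \in finset.finset (fun y : 'I_r * reg_index n => y.1 \in s)]) (count (A y) @^-1` U y).
  apply/seteqP; split => w h.
    by move=> [j x]; rewrite /= inE /= => js; exact: h.
  by move=> i /= si x _; apply: (h (i, x)); rewrite /= inE.
rewrite (independent_counts xi_poisson)//.
rewrite (eq_bigl (fun y : 'I_r * reg_index n => (y.1 \in s) && true)); last by move=> y; rewrite inE andbT.
rewrite (eq_bigr (fun y => P (count (A (y.1, y.2)) @^-1` U (y.1, y.2)))); last by case.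
rewrite -(pair_big_dep (fun j : 'I_r => j \in s) (fun _ _ => true) (fun (j : 'I_r) (x : reg_index n) => P (count (A (j, x)) @^-1` U (j, x)))) /=.
rewrite -prodEFin big_uniq//=; apply: eq_bigr => i _.
by rewrite -PW fineK// fin_num_measure//; exact: measurable_window.
Qed.

End window_trials.

(** * Good points in every long time interval *)

Section parameters.
Context (R : realType) (m : {finite_measure set (measurableTypeR R) -> \bar R}).
Implicit Types (D n : nat).

Lemma far_strip_sub (K K' : R) : K <= K' -> far_strip K' `<=` far_strip K.
Proof. by move=> KK' x; apply: le_lt_trans. Qed.

Lemma le_far (K K' : R) : K <= K' -> fine (m (far_strip K')) <= fine (m (far_strip K)).
Proof.
move=> KK'; apply: fine_le; rewrite ?fin_num_measure//; try exact: measurable_far.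
by apply: le_measure; rewrite ?inE; [exact: measurable_far|exact: measurable_far|exact: far_strip_sub].
Qed.

Lemma far_small (e : R) : 0 < e -> exists D, fine (m (far_strip D%:R)) <= e.
Proof.
move=> e0.
pose F n : set (measurableTypeR R) := far_strip n%:R.
have F0 : \bigcap_n F n = set0.
  apply/seteqP; split => // x h; have := h (Num.truncn `|x|).+1 I.
  by rewrite /F /far_strip /= ltNge ltW// truncnS_gt.
have mF n : measurable (F n) by exact: measurable_far.
have : (m \o F) x @[x --> \oo] --> m (\bigcap_n F n).
  apply: nonincreasing_cvg_mu => //.
  - by rewrite -ge0_fin_numE// fin_num_measure.
  - by rewrite F0.
  - by move=> n k nk; apply/subsetPset/far_strip_sub; rewrite ler_nat.
rewrite F0 measure0 => /fine_cvgP[_ /cvgr_lt/(_ _ e0)[N _ hN]].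
by exists N; apply/ltW/(hN N) => /=.
Qed.

(** The line is covered by countably many strips. *)
Lemma positive_strip : m setT <> 0%E -> exists i0 : R, 0 < fine (m (strip i0)).
Proof.
move=> m0; apply: contrapT => h; apply: m0.
have h0 (i0 : R) : m (strip i0) = 0%E.
  apply: contrapT => ne; apply: h; exists i0; apply: fine_gt0; apply/andP; split.
    by rewrite lt0e measure_ge0 andbT; apply/eqP.
  by rewrite -ge0_fin_numE//; apply: fin_num_measure; exact: measurable_strip.
pose F n : set (measurableTypeR R) := strip (n%:R / 2) `|` strip (- n%:R / 2).
have neg n : m.-negligible (F n).
  have nI i0 : m.-negligible (strip i0).
    by exists (strip i0); split; [exact: measurable_strip|exact: h0|exact: subset_refl].
  by apply: negligibleU; exact: nI.
have FT : \bigcup_n F n = setT.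
  apply/seteqP; split => // x _.
  have [x0|x0] := leP 0 x.
    exists (Num.truncn (x * 2)) => //; left; rewrite /strip /inI /=.
    have : (Num.truncn (x * 2))%:R <= x * 2 by rewrite truncn_le mulr_ge0//.
    have := truncnS_gt (x * 2); rewrite -(natr1 (Num.truncn _)).
    by lra.
  pose k := Num.truncn (- x * 2).
  have k1 : k%:R <= - x * 2 by rewrite truncn_le mulr_ge0// oppr_ge0 ltW.
  have k2 : - x * 2 < k%:R + 1 by rewrite natr1; exact: truncnS_gt.
  have [xk|xk] := eqVneq (- x * 2) k%:R.
    by exists k => //; right; rewrite /strip /inI /=; lra.
  exists k.+1 => //; right; rewrite /strip /inI /= -(natr1 k).
  have : k%:R < - x * 2 by rewrite lt_neqAle eq_sym xk.
  by lra.
have : m.-negligible (\bigcup_n F n) by exact: negligible_bigcup.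
by rewrite FT => /negligibleP -> //.
Qed.

(** Cells long enough for empty ones to be rare, a strip wide enough for points
   outside to be rarer still, and a slab long enough to pay for the way in. *)
Lemma good_parameters : m setT <> 0%E -> exists (i0 K : R) (ell M : nat),
  [/\ (2 <= ell)%N, forall x, inI i0 x -> `|x| <= K, 5 * K ^+ 2 <= M%:R,
      0 < fine (m (strip i0)) &
      2 * expR (- (fine (m (strip i0)) * (ell%:R - 1) / 2)) <= 64^-1 /\
      (128 ^+ 8 - 1) * (ell%:R * fine (m (far_strip K))) <= 2^-1].
Proof.
have c0 : 0 < (128 : R) ^+ 8 by exact: exprn_gt0.
move: ((128 : R) ^+ 8) c0 => c c0.
move=> /positive_strip[i0 mu0]; set mu := fine _ in mu0 *.
pose ell := (Num.truncn (256 / mu)).+3.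
have ell_mu : 256 <= mu * (ell%:R - 1).
  rewrite mulrC -ler_pdivrMr// lerBrDr /ell.
  have := truncnS_gt (256 / mu); set k := Num.truncn _ => h.
  apply: (@le_trans _ _ (k.+2)%:R); last by rewrite ler_nat.
  by rewrite -(natr1 k.+1) lerD2r ltW.
have cl0 : 0 < c * ell%:R by rewrite mulr_gt0.
have [D mD] : exists D, fine (m (far_strip D%:R)) <= (c * ell%:R * 2)^-1.
  by apply: far_small; rewrite invr_gt0 mulr_gt0.
pose K : R := Num.max D%:R (`|i0| + 2^-1).
exists i0, K, ell, (Num.truncn (5 * K ^+ 2)).+1; split => //.
- move=> x /andP[h1 h2]; rewrite /K le_max; apply/orP; right.
  have [x0|x0] := leP 0 x; [rewrite ger0_norm//|rewrite ltr0_norm//].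
    by have := ler_norm i0; lra.
  by have := ler_norm (- i0); rewrite normrN; lra.
- exact/ltW/truncnS_gt.
split.
  have e1 : expR 128 * expR (- (mu * (ell%:R - 1) / 2)) <= 1 :> R.
    by rewrite -expRD expR_le1; lra.
  have e2 : 128 <= expR 128 :> R by have := expR_ge1Dx (128 : R); lra.
  have := expR_ge0 (- (mu * (ell%:R - 1) / 2)).
  move: e1 e2; move: (expR (- _)) (expR 128) => y z; nra.
have mK : fine (m (far_strip K)) <= (c * ell%:R * 2)^-1.
  by apply: le_trans mD; apply: le_far; rewrite /K le_max lexx.
have m0 : 0 <= fine (m (far_strip K)) by rewrite fine_ge0.
apply: (@le_trans _ _ (c * (ell%:R * fine (m (far_strip K))))).
  by rewrite ler_wpM2r ?mulr_ge0// gerBl.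
rewrite mulrA; apply: le_trans (ler_wpM2l (ltW cl0) mK) _.
by rewrite invfM mulrA divff ?mul1r// gt_eqF.
Qed.

End parameters.

Lemma trial_bound (R : realType) (s N x y z : R) : 0 <= s -> 0 <= x ->
  N * x <= 1 -> y <= x -> x <= z -> s * (N * x) * x + y <= (s + 2) * z.
Proof.
move=> s0 x0 Nx yx xz.
have h1 : s * (N * x) <= s by rewrite ler_piMr.
have h2 := ler_wpM2r x0 h1.
have h3 : s * x <= s * z by rewrite ler_wpM2l.
by move: (s * (N * x) * x) (s * x) (s * z) h2 h3 (mulrDl s 2 z) => a b c h2 h3 ->; lra.
Qed.

Lemma base_bounds (R : realType) (T x y z w L : R) : 0 <= x -> 0 <= y -> 0 <= z ->
  w = 4 * x + 4 + 2 * y -> z + w <= L ->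
  T <= T + 2 * x + 1 + y + z /\ T + 2 * x + 1 + y + z + 1 <= T + L.
Proof. by move=> x0 y0 z0 -> h; split; lra. Qed.

Section good_points.
Context (R : realType) (m : {finite_measure set (measurableTypeR R) -> \bar R}).
Context d (Omega : measurableType d) (P : probability Omega R).
Variable xi : Omega -> configuration R.
Hypothesis xi_poisson : poisson_point_field m P xi.
Variables (i0 K : R) (ell M : nat).

Local Notation mu := (fine (m (strip i0))).
Local Notation delta := (fine (m (far_strip K))).

Hypothesis ell2 : (2 <= ell)%N.
Hypothesis IK : forall x, inI i0 x -> `|x| <= K.
Hypothesis empty_rate : 2 * expR (- (mu * (ell%:R - 1) / 2)) <= 64^-1.
Hypothesis far_rate : (128 ^+ 8 - 1) * (ell%:R * delta) <= 2^-1.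
Hypothesis mu_gt0 : 0 < mu.

Local Notation rho := (success_rate m i0 K M).

Lemma rho_gt0 : 0 < rho.
Proof.
have e1 : expR (- mu) < 1 by rewrite expR_lt1 oppr_lt0.
by rewrite /success_rate !mulr_gt0 ?expR_gt0// exprn_gt0// subr_gt0.
Qed.

(** With r of the order of n 16^n the probability that all windows fail is about
    exp (- n), while the expected number of bad tails is about
    n 16^n / 64^n. *)
Lemma trial_numbers (e : R) : 0 < e -> exists n r : nat,
  (1 - rho * 16^-1 ^+ n) ^+ r <= e /\ r%:R * 64^-1 ^+ n <= e.
Proof.
move=> e0; have r0 := rho_gt0.
pose n := Num.truncn ((rho^-1 + 2) / e).
have ne : (rho^-1 + 2) / n.+1%:R <= e.
  by rewrite ler_pdivrMr// mulrC -ler_pdivrMr//; exact/ltW/truncnS_gt.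
pose q := rho * 16^-1 ^+ n.
have q0 : 0 < q by rewrite mulr_gt0// exprn_gt0.
pose r := (Num.truncn (n.+1%:R / q)).+1.
have r1 : n.+1%:R / q <= r%:R by exact/ltW/truncnS_gt.
have r2 : r%:R <= n.+1%:R / q + 1.
  by rewrite /r -natr1 lerD2r truncn_le divr_ge0// ltW.
have ri0 : 0 < rho^-1 by rewrite invr_gt0.
have nR0 : 0 < n.+1%:R :> R by [].
have n1 : n.+1%:R^-1 <= (rho^-1 + 2) / n.+1%:R.
  by rewrite ler_peMl ?invr_ge0//; lra.
have q1 : q <= 1.
  rewrite -lee_fin.
  have h := window_prob xi_poisson M ell2 IK empty_rate far_rate mu_gt0 0 n 0.
  apply: (le_trans h); apply: probability_le1.
  exact: (measurable_window xi_poisson ell M IK).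
exists n, r; split.
  apply: le_trans ne; apply: le_trans n1.
  apply: (@le_trans _ _ (expR (- q) ^+ r)).
    rewrite lerXn2r ?nnegrE ?subr_ge0 ?expR_ge0//.
    exact: expR_ge1Dx.
  rewrite -expRM_natl mulrN expRN lef_pV2 ?posrE ?expR_gt0//.
  apply: (@le_trans _ _ (expR n.+1%:R)).
    by have := expR_ge1Dx (n.+1%:R : R); lra.
  by rewrite ler_expR -ler_pdivrMr.
apply: le_trans ne.
have x0 : 0 < 2^-1 ^+ n :> R by rewrite exprn_gt0.
have xn : n.+1%:R * 2^-1 ^+ n <= 1 :> R.
  rewrite exprVn ler_pdivrMr ?exprn_gt0// mul1r -natrX ler_nat.
  exact: ltn_expl.
have x1 : 2^-1 ^+ n <= 1 :> R by rewrite exprn_ile1// invf_le1// ler1n.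
have xinv : 2^-1 ^+ n <= n.+1%:R^-1 :> R by rewrite -[leRHS]mul1r ler_pdivlMr// mulrC.
have E64 : 64^-1 ^+ n = (2^-1 ^+ n) ^+ 6 :> R by rewrite exprAC; congr (_ ^+ _); field.
have E16 : 64^-1 ^+ n = 16^-1 ^+ n * (2^-1 ^+ n) ^+ 2 :> R.
  by rewrite [in RHS]exprAC -exprMn; congr (_ ^+ _); field.
apply: (@le_trans _ _ ((n.+1%:R / q + 1) * 64^-1 ^+ n)).
  by rewrite ler_wpM2r// exprn_ge0.
rewrite mulrDl mul1r.
have z0 : 16^-1 ^+ n != 0 :> R by rewrite expf_neq0// invr_neq0// pnatr_eq0.
have h1 : n.+1%:R / q * 64^-1 ^+ n = rho^-1 * (n.+1%:R * 2^-1 ^+ n) * 2^-1 ^+ n.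
  by rewrite E16 /q invfM -!mulrA (mulKf z0) expr2 mulrCA.
have h2 : 64^-1 ^+ n <= 2^-1 ^+ n :> R.
  by rewrite E64 -[leRHS]expr1; apply: ler_wiXn2l => //; exact: ltW.
by rewrite h1; apply: trial_bound h2 xinv => //; exact: ltW.
Qed.

(** Besides failing windows and bad tails, a third exception is a point outside
    the box D during the time considered; the latter being bounded, D makes it
    unlikely. *)
Lemma good_points_outer (e : R) : 0 < e -> exists L : R, forall T : R,
  outer_le P [set w | ~ exists tau p0, goodpoint i0 K ell M (xi w) tau p0 /\
    T <= p0.1 <= T + L] e.
Proof.
move=> e0; have e3 : 0 < e / 3 by rewrite divr_gt0.
have [n [r [h1 h2]]] := trial_numbers e3.
pose w := window_length R ell M n.
have M0 := ler0n R M.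
have ln0 : 0 <= ell%:R * n%:R :> R by rewrite mulr_ge0.
have w0 : 0 < w by rewrite /w /window_length ltr_wpDr ?ltr_wpDl ?mulr_ge0.
pose L := r%:R * w.
have L0 : 0 <= L by rewrite mulr_ge0// ltW.
exists L => T.
have [D0 hD0] : exists D, fine (m (far_strip D%:R)) <= e / 3 / (L + 1).
  by apply: far_small; rewrite divr_gt0//; lra.
pose D := maxn D0 (Num.truncn (`|T| + L)).+1.
have mD : fine (m (far_strip D%:R)) <= e / 3 / (L + 1).
  by apply: le_trans hD0; apply: le_far; rewrite ler_nat leq_maxl.
have TD : `|T| + L <= D%:R.
  by apply: le_trans (ltW (truncnS_gt _)) _; rewrite ler_nat leq_maxr.
have base_in (i : nat) : (i < r)%N -> T <= base ell M T n i /\ base ell M T n i + 1 <= T + L.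
  move=> ir; have iw : i%:R * w + w <= L.
    by rewrite -[X in _ + X]mul1r -mulrDl natr1 ler_wpM2r ?ler_nat// ltW.
  have iw0 : 0 <= i%:R * w by rewrite mulr_ge0// ltW.
  exact: base_bounds M0 ln0 iw0 erefl iw.
pose far : set Omega := [set w' | exists2 q, points (xi w') q & region false T (T + L) (far_strip D%:R) q].
pose fails : set Omega := \bigcap_(i in [set` index_enum 'I_r]) ~` window xi i0 K ell M (base ell M T n i) n D.
pose tails : set Omega := \bigcup_(i : 'I_r) bad_tail xi i0 K ell M (base ell M T n i) n.
apply: (@outer_le_sub _ _ _ _ _ ((fails `|` tails) `|` far)).
  move=> w' hw; apply: contrapT => /not_orP[/not_orP[nfails ntails] nfar]; apply: hw.
  have [i hi] : exists i : 'I_r, window xi i0 K ell M (base ell M T n i) n D w'.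
    apply: contrapT => nex; apply: nfails => i _ hi; apply: nex; by exists i.
  have [b1 b2] := base_in i (ltn_ord i).
  have [|| p0 gp0] := window_goodpoint ell2 IK hi.
  - move=> q wq fq; have := forbidden_time fq.
    have : i.+1%:R * w <= L by rewrite ler_wpM2r ?ler_nat// ltW.
    have : 0 <= i%:R * w by rewrite mulr_ge0// ltW.
    rewrite -/w => v1 v2 /andP[v3 v4].
    have q1 : T <= q.1 <= T + L by apply/andP; split; lra.
    have q2 : `|q.2| <= D%:R.
      rewrite leNgt; apply/negP => h; apply: nfar; exists q => //.
    have nT := ler_norm T; have nT' := ler_norm (- T); rewrite normrN in nT'.
    split; rewrite /= in_itv/=; last by rewrite -ler_norml.
    by apply/andP; split; lra.
  - by move=> hb; apply: ntails; exists i.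
  exists (base ell M T n i), p0; split => //.
  have [_ _ [[/andP[t1 t2] _] _ _ _ _] _] := gp0.
  by apply/andP; split; lra.
have -> : e = e / 3 + e / 3 + e / 3 by field.
apply: outer_leU; first apply: outer_leU.
- pose E (i : 'I_r) := window xi i0 K ell M (base ell M T n i) n D.
  have mE i : measurable (E i) by exact: (measurable_window xi_poisson ell M IK).
  have ind := independent_complements mE (windows_independent xi_poisson M ell2 IK T n D (r := r)).
  exists fails; split => //.
    by apply: fin_bigcap_measurable => [|i _]; [apply/finite_seqP; exists (index_enum 'I_r)|exact: (measurableC (mE i))].
  rewrite /fails ind ?index_enum_uniq// lee_fin; apply: le_trans h1.
  apply: (@le_trans _ _ (\prod_(i < r) (1 - rho * 16^-1 ^+ n))); last first.
    by rewrite prodr_const card_ord.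
  apply: ler_prod => i _; apply/andP; split.
    by rewrite subr_ge0 -lee_fin fineK; [exact: (probability_le1 P (mE i))|exact: (fin_num_measure P _ (mE i))].
  rewrite lerD2l lerN2 -lee_fin fineK; last exact: (fin_num_measure P _ (mE i)).
  exact: (window_prob xi_poisson M ell2 IK empty_rate far_rate mu_gt0).
- apply: outer_le_trans h2 _.
  have -> : r%:R * 64^-1 ^+ n = \sum_(i < r) 64^-1 ^+ n :> R.
    by rewrite sumr_const card_ord mulr_natl.
  apply: outer_le_bigU => i.
  exact: (bad_tail_outer xi_poisson M ell2 IK empty_rate far_rate).
have mf := measurable_far (D%:R : R).
apply: (hit_outer xi_poisson); [exact: measurable_region| |exact: ltW].
rewrite intensity_region//; last by rewrite lerDl.
rewrite lee_fin addrAC subrr add0r.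
apply: (@le_trans _ _ (L * (e / 3 / (L + 1)))); first by rewrite ler_wpM2l.
rewrite mulrA ler_pdivrMr; last by lra.
by rewrite mulrC ler_wpM2l ?(ltW e3)//; lra.
Qed.

(** The length L of the interval searched does not depend on its origin. *)
Lemma good_points_ae (T : R) :
  {ae P, forall w, (exists tau p0, goodpoint i0 K ell M (xi w) tau p0 /\ T < p0.1) /\
    (exists tau p0, goodpoint i0 K ell M (xi w) tau p0 /\ p0.1 < - T)}.
Proof.
apply: outer_le_negligible => c c0; have c2 : 0 < c / 2 by rewrite divr_gt0.
have [L hL] := good_points_outer c2.
have -> : c = c / 2 + c / 2 by field.
apply: outer_le_sub (outer_leU (hL (T + 1)) (hL (- T - L - 1))).
move=> w /= nh; apply: contrapT => /not_orP[/contrapT[t1 [p1 [g1 h1]]] /contrapT[t2 [p2 [g2 h2]]]].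
apply: nh; split; [exists t1, p1|exists t2, p2]; split => //.
  by move: h1 => /andP[]; lra.
by move: h2 => /andP[]; lra.
Qed.

End good_points.

(** * Time slabs and small cells *)

Section slab_finiteness.
Context (R : realType) (m : {finite_measure set (measurableTypeR R) -> \bar R}).
Context d (Omega : measurableType d) (P : probability Omega R).
Variable xi : Omega -> configuration R.
Hypothesis xi_poisson : poisson_point_field m P xi.

(** A Poisson variable has exponentially small tails, so that at least k points in
    a slab, for every k, is negligible although slabs are unbounded. *)
Lemma slab_finite_ae : {ae P, forall w, slab_finite (xi w)}.
Proof.
have H n : P.-negligible [set w | ~ finite_set (xi w `&` [set p | - n%:R < p.1 < n%:R])].
  apply: outer_le_negligible => c c0.
  pose A : set (measurableTypeR R * measurableTypeR R) := `[- n%:R, n%:R]%classic `*` setT.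
  have mA : measurable A by apply: measurableX; [exact: measurable_itv|exact: measurableT].
  pose L : R := (n%:R - - n%:R) * fine (m setT).
  have AL : (intensity m A <= L%:E)%E by rewrite /A intensity_itv//; have := ler0n R n; lra.
  pose k := Num.truncn (expR ((2 - 1) * L) / c).
  apply: (@outer_le_trans _ _ _ _ _ (expR ((2 - 1) * L) / 2 ^+ k.+1)).
    rewrite ler_pdivrMr ?exprn_gt0// [c * _]mulrC -ler_pdivrMr//.
    have k2 : k.+1%:R <= 2 ^+ k.+1 :> R by rewrite -natrX ler_nat ltnW// ltn_expl.
    by apply: le_trans k2; exact/ltW/truncnS_gt.
  apply: outer_le_sub (many_outer xi_poisson k.+1 mA AL _); last by lra.
  move=> w /= /(infinite_set_fset k.+1)[F FA kF].
  exists (take k.+1 F); split.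
  - by apply: take_uniq; exact: fset_uniq.
  - by rewrite size_takel.
  move=> q /mem_take /FA[wq /andP[/ltW q1 /ltW q2]]; split => //.
  by split => //=; rewrite in_itv/= q1.
have : {ae P, forall w, forall n : nat, finite_set (xi w `&` [set p | - n%:R < p.1 < n%:R])}.
  exact: ae_foralln.
apply: filterS => w h a b.
pose n := maxn (Num.truncn `|a|).+1 (Num.truncn `|b|).+1.
have an : `|a| <= n%:R.
  by apply: le_trans (ltW (truncnS_gt _)) _; rewrite ler_nat leq_maxl.
have bn : `|b| <= n%:R.
  by apply: le_trans (ltW (truncnS_gt _)) _; rewrite ler_nat leq_maxr.
apply: sub_finite_set (h n) => p [wp /andP[ap pb]]; split => //.
move: an bn; rewrite !ler_norml => /andP[h1 _] /andP[_ h2].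
by rewrite /= (le_lt_trans h1 ap) (lt_le_trans pb h2).
Qed.

End slab_finiteness.

Section cells.
Context {R : realType}.
Local Notation T2 := (measurableTypeR R * measurableTypeR R)%type.
Implicit Types (h : R) (c : int * int) (p q : R * R).

(** The half-open squares of a grid of mesh h. *)
Definition cell h c : set T2 :=
  `[c.1%:~R * h, (c.1%:~R + 1) * h[%classic `*` `[c.2%:~R * h, (c.2%:~R + 1) * h[%classic.

Definition cell_of h p : int * int := (Num.floor (p.1 / h), Num.floor (p.2 / h)).

Lemma cell_ofP h p c : 0 < h -> cell h c p <-> c = cell_of h p.
Proof.
move=> h0.
have key (x : R) (i : int) : i%:~R * h <= x < (i%:~R + 1) * h <-> i = Num.floor (x / h).
  rewrite -ler_pdivlMr// -ltr_pdivrMr//; split=> [|->].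
    by rewrite -intrD1 => /floor_def.
  by rewrite floor_le_tmp /= -intrD1 floorD1_gt.
rewrite /cell /cell_of; case: c => i j /=; rewrite !in_itv /=.
by split=> [[/key -> /key ->]//|[-> ->]]; split; apply/key.
Qed.

Lemma measurable_cell h c : measurable (cell h c).
Proof. by apply: measurableX; exact: measurable_itv. Qed.

Lemma cell_bounded h c : bounded_set (cell h c : set (R * R)).
Proof.
pose M (i : int) := `|i%:~R * h| + `|(i%:~R + 1) * h|.
apply: (@bounded_setP _ _ (M c.1 + M c.2)).
have key (x : R) i : i%:~R * h <= x < (i%:~R + 1) * h -> `|x| <= M i.
  move=> /andP[h1 h2]; rewrite /M.
  have n1 := ler_norm (- (i%:~R * h)); rewrite normrN in n1.
  have n2 := ler_norm ((i%:~R + 1) * h).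
  have n3 := normr_ge0 (i%:~R * h); have n4 := normr_ge0 ((i%:~R + 1) * h).
  by rewrite ler_norml; apply/andP; split; lra.
have M0 i : 0 <= M i by rewrite /M addr_ge0.
move=> p [/=]; rewrite !in_itv/= => /key h1 /key h2.
by split; [rewrite (le_trans h1)// lerDl|rewrite (le_trans h2)// lerDr].
Qed.

Lemma cell_borel h c (A : set T2) : measurable A -> bounded_borel (cell h c `&` A).
Proof.
move=> mA; split; first by apply: measurableI => //; exact: measurable_cell.
have [M [Mr hM]] := cell_bounded h c.
by exists M; split => // x xM p [cp _]; exact: hM cp.
Qed.

Lemma cellT_borel h c : bounded_borel (cell h c).
Proof. by split; [exact: measurable_cell|exact: cell_bounded]. Qed.

Lemma cell_disjoint h c c' : 0 < h -> c != c' -> cell h c `&` cell h c' = set0.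
Proof.
move=> h0 cc'; apply/seteqP; split => // p [/(cell_ofP _ _ h0) cE /(cell_ofP _ _ h0) c'E].
by move: cc'; rewrite cE c'E eqxx.
Qed.

End cells.

(** * The point of a cell and its time *)

Section positions.
Context (R : realType) (m : {finite_measure set (measurableTypeR R) -> \bar R}).
Context d (Omega : measurableType d) (P : probability Omega R).
Variable xi : Omega -> configuration R.
Hypothesis xi_poisson : poisson_point_field m P xi.
Variable h : R.
Hypothesis h0 : 0 < h.

Local Notation count := (count_in xi).
Local Notation cell := (cell h).
Local Notation T2 := (measurableTypeR R * measurableTypeR R)%type.
Local Notation lam := (@lam R m).
Implicit Types (c : int * int) (A : set T2) (w : Omega).

(** The point of a cell that has exactly one point; the value (0, 0) otherwise makes
    it a random variable. *)
Definition pos c w : R * R :=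
  if count (cell c) w == 1%N then xget (0, 0) (xi w `&` cell c) else (0, 0).

Definition single c A : set Omega := [set w | count (cell c) w = 1%N /\ A (pos c w)].

Lemma pos_spec c w : count (cell c) w = 1%N -> xi w `&` cell c = [set pos c w].
Proof.
move=> c1; have [p pE] := npoints1 (@points_locally_finite _ (xi w) _ (cell_bounded h c)) c1.
rewrite /pos c1 eqxx pE.
have xp : [set p] (xget (0, 0) [set p]) by apply: (xgetI _ (x := p)).
by rewrite [xget _ _]xp.
Qed.

(** One point in the cell, and it is in A: one point in the part of the cell in A
    and none outside A. This reduces the law of [pos] to counts. *)
Lemma singleE c A : single c A =
  (count (cell c `&` A) @^-1` [set 1%N]) `&` (count (cell c `\` A) @^-1` [set 0%N]).
Proof.
have fin w B : B `<=` cell c -> finite_set (xi w `&` B).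
  move=> Bc; apply: sub_finite_set (@points_locally_finite _ (xi w) _ (cell_bounded h c)).
  by move=> p [wp /Bc].
apply/seteqP; split=> w /=.
  move=> [c1 Ap]; have pE := pos_spec c1.
  have [wp cp] : (xi w `&` cell c) (pos c w) by rewrite pE.
  split.
    rewrite /count_in (_ : _ `&` _ = [set` [:: pos c w]]) ?npoints_seq//.
    apply/seteqP; split => [q [wq [cq _]]|q /=].
      have : (xi w `&` cell c) q by []. 
      by rewrite pE => ->; rewrite /= mem_head.
    by rewrite inE => /eqP ->.
  rewrite /count_in (_ : _ `&` _ = [set` [::]]) ?npoints_seq//.
  apply/seteqP; split => // q [wq [cq nAq]].
  have : (xi w `&` cell c) q by [].
  by rewrite pE => qE; exfalso; apply: nAq; rewrite qE.
move=> [c1 c0].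
have [p pE] := npoints1 (fin w (cell c `&` A) (@subIsetl _ _ _)) c1.
have [wp [cp Ap]] : (xi w `&` (cell c `&` A)) p by rewrite pE.
have cE : xi w `&` cell c = [set` [:: p]].
  apply/seteqP; split => [q [wq cq]|q /=]; last by rewrite inE => /eqP ->.
  have [Aq|nAq] := pselect (A q).
    have : (xi w `&` (cell c `&` A)) q by [].
    by rewrite pE => ->; rewrite /= mem_head.
  have : (xi w `&` (cell c `\` A)) q by [].
  by rewrite (npoints0 (fin w (cell c `\` A) (@subDsetl _ _ _)) c0).
have c1' : count (cell c) w = 1%N by rewrite /count_in cE npoints_seq.
split => //; have := pos_spec c1'; rewrite cE => pE'.
have : [set` [:: p]] p by rewrite /= mem_head.
by rewrite pE' => <-.
Qed.

Lemma cellD_borel c A : measurable A -> @bounded_borel R (cell c `\` A).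
Proof. by move=> mA; rewrite setDE; apply: cell_borel; exact: measurableC. Qed.

Lemma measurable_single c A : measurable A -> measurable (single c A).
Proof.
move=> mA; rewrite singleE; apply: measurableI; apply: (measurable_count xi_poisson).
  exact: cell_borel.
exact: cellD_borel.
Qed.

Lemma lam_cellD c A : measurable A ->
  lam (cell c `&` A) + lam (cell c `\` A) = lam (cell c).
Proof.
move=> mA; have fin B : @bounded_borel R B -> B `<=` cell c -> intensity m B \is a fin_num.
  move=> [mB _] Bc; rewrite ge0_fin_numE ?intensity_ge0//.
  apply: le_lt_trans (le_intensity m mB (measurable_cell h c) Bc) _.
  rewrite /cell intensity_rect; [|exact: measurable_itv|exact: measurable_itv].
  rewrite lebesgue_measure_itv/= lte_fin ltr_pM2r// ltrDl ltr01 -EFinB.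
  by rewrite -(fineK (fin_num_measure m _ (measurable_itv _))) -EFinM ltry.
rewrite /lam -fineD; [|apply: fin; [exact: cell_borel|exact: subIsetl]|apply: fin; [exact: cellD_borel|exact: subDsetl]].
congr fine; rewrite -measureU//.
- by rewrite setDE -setIUr setUv setIT.
- exact: (cell_borel h c mA).1.
- exact: (cellD_borel c mA).1.
by apply/seteqP; split => // p [[_ Ap] [_ /(_ Ap)]].
Qed.

(** Given that each of the cells has exactly one point, these points are
    independent and their laws are proportional to the intensity. *)
Lemma prob_singles (cs : seq (int * int)) (B : int * int -> set T2) : uniq cs ->
  (forall c, measurable (B c)) ->
  P (\bigcap_(c in [set` cs]) single c (B c)) =
  (\prod_(c <- cs) (lam (cell c `&` B c) * expR (- lam (cell c))))%:E.
Proof.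
move=> ucs mB.
pose n := size cs; pose cc (k : 'I_n) := nth (0, 0) cs k.
pose A (x : 'I_n * bool) : set (R * R) :=
  if x.2 then cell (cc x.1) `&` B (cc x.1) else cell (cc x.1) `\` B (cc x.1).
pose U (x : 'I_n * bool) : set nat := if x.2 then [set 1%N] else [set 0%N].
have bA x : @bounded_borel R (A x).
  by rewrite /A; case: x.2; [exact: cell_borel|exact: cellD_borel].
have subA x : A x `<=` cell (cc x.1).
  by rewrite /A; case: x.2; [exact: subIsetl|exact: subDsetl].
have tA : trivIset [set: 'I_n * bool] A.
  apply/trivIsetP => x y _ _ xy.
  have [e|ne] := eqVneq x.1 y.1.
    move: xy; case: x y e => i b [j b'] /= ->; rewrite /A /=.
    case: b b' => -[] /=; rewrite ?eqxx// => _; apply/seteqP; split => // p.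
      by move=> [[_ Ap] [_ /(_ Ap)]].
    by move=> [[_ nAp] [_ /nAp]].
  have cxy : cc x.1 != cc y.1.
    by apply: contra ne; rewrite /cc nth_uniq// => /eqP/val_inj ->.
  apply/seteqP; split => // p [/subA px /subA py].
  by rewrite -(cell_disjoint h0 cxy).
have := independent_counts xi_poisson U finset.setT bA tA.
rewrite (_ : \bigcap_(i in _) _ = \bigcap_(c in [set` cs]) single c (B c)); last first.
  apply/seteqP; split => w hw.
    move=> c /= ccs; rewrite singleE.
    have ic : (index c cs < n)%N by rewrite index_mem.
    have cE : cc (Ordinal ic) = c by rewrite /cc /= nth_index.
    split.
      by have := hw (Ordinal ic, true); rewrite /A /U /= cE; apply; rewrite finset.in_setT.
    by have := hw (Ordinal ic, false); rewrite /A /U /= cE; apply; rewrite finset.in_setT.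
  move=> [k b] _; have := hw (cc k) (mem_nth _ (ltn_ord k)).
  by rewrite singleE /A /U => -[h1 h2]; case: b.
move=> ->.
rewrite [LHS](eq_bigl xpredT); last by move=> x; rewrite finset.in_setT.
rewrite [LHS](eq_bigr (fun x : 'I_n * bool => P (count (A (x.1, x.2)) @^-1` U (x.1, x.2)))); last by case.
rewrite -(pair_bigA _ (fun (k : 'I_n) (b : bool) => P (count (A (k, b)) @^-1` U (k, b)))) /=.
rewrite (big_nth (0, 0)) big_mkord -prodEFin; apply: eq_bigr => k _.
rewrite big_bool /A /U /= -/(cc k).
rewrite (prob_count1 xi_poisson); last exact: cell_borel.
rewrite (prob_count0 xi_poisson); last exact: cellD_borel.
by rewrite -EFinM -mulrA -expRD -opprD lam_cellD.
Qed.

Lemma measurable_pos c : measurable_fun [set: Omega] (pos c : Omega -> T2).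
Proof.
move=> _ A mA; rewrite setTI.
have -> : pos c @^-1` A = single c A `|`
    (~` (count (cell c) @^-1` [set 1%N]) `&` [set _ | A (0, 0)]).
  apply/seteqP; split => w /=.
    move=> Ap; have [c1|c1] := pselect (count (cell c) w = 1%N); [by left|right].
    by split => //; move: Ap; rewrite /pos; case: eqP.
  by move=> [[_ //]|[c1 A0]]; rewrite /pos; case: eqP.
apply: measurableU; first exact: measurable_single.
apply: measurableI.
  by apply: measurableC; apply: (measurable_count xi_poisson); exact: cellT_borel.
by have [A0|A0] := pselect (A (0, 0)); [rewrite (_ : [set _ | _] = setT)|rewrite (_ : [set _ | _] = set0)] => //; apply/seteqP; split.
Qed.

Section one_cell.
Variable c0 : int * int.

(** A family of events closed under intersection, generating the information on
    the points of all cells except the time of the point of c0; its position is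
    included. *)
Definition other_info : set (set Omega) := [set E | exists cs B J,
  [/\ uniq cs, c0 \notin cs, forall c, measurable (B c : set T2),
      measurable (J : set (measurableTypeR R)) &
      E = [set w | J (pos c0 w).2] `&` \bigcap_(c in [set` cs]) single c (B c)]].

Lemma measurable_snd_in (J : set (measurableTypeR R)) : measurable J ->
  measurable ([set p | J p.2] : set T2).
Proof.
move=> mJ; rewrite (_ : [set p | _] = setT `*` J); first exact: measurableX.
by apply/seteqP; split => p //= [].
Qed.

Lemma measurable_fst_in (J : set (measurableTypeR R)) : measurable J ->
  measurable ([set p | J p.1] : set T2).
Proof.
move=> mJ; rewrite (_ : [set p | _] = J `*` setT); first exact: measurableX.
by apply/seteqP; split => p //= [].
Qed.

Lemma other_info_measurable : other_info `<=` measurable.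
Proof.
move=> _ [cs [B [J [_ _ mB mJ ->]]]]; apply: measurableI.
  rewrite -[X in measurable X]setTI.
  exact: (measurable_pos c0 measurableT (measurable_snd_in mJ)).
apply: fin_bigcap_measurable => [|c _]; first by apply/finite_seqP; exists cs.
exact: measurable_single.
Qed.

Lemma other_infoT : other_info setT.
Proof.
exists [::], (fun=> setT), setT; split => //.
by rewrite set_nil bigcap_set0 setIT; apply/seteqP; split.
Qed.

Lemma other_info_setI : setI_closed other_info.
Proof.
move=> _ _ [cs [B [J [u1 n1 mB mJ ->]]]] [cs' [B' [J' [u2 n2 mB' mJ' ->]]]].
exists (undup (cs ++ cs')), (fun c => (if c \in cs then B c else setT) `&` (if c \in cs' then B' c else setT)), (J `&` J'); split.
- exact: undup_uniq.
- by rewrite mem_undup mem_cat negb_or n1.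
- by move=> c; apply: measurableI; case: ifP.
- exact: measurableI.
apply/seteqP; split => w.
  move=> [[Jw h1] [J'w h2]]; split; first by split.
  move=> c /=; rewrite mem_undup mem_cat => cc; split.
    by move: cc => /orP[/h1[]|/h2[]].
  by split; [case: ifP => // /h1[]|case: ifP => // /h2[]].
move=> [[Jw J'w] h1]; split; split => // c cc.
  have /h1[c1 [Bc _]] : c \in undup (cs ++ cs') by rewrite mem_undup mem_cat [c \in cs]cc.
  by split => //; move: Bc; rewrite [c \in cs]cc.
have /h1[c1 [_ Bc]] : c \in undup (cs ++ cs') by rewrite mem_undup mem_cat [c \in cs']cc orbT.
by split => //; move: Bc; rewrite [c \in cs']cc.
Qed.

Variables (n : nat).
Hypothesis n_gt0 : (0 < n)%N.

Definition slice (k : nat) : set R :=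
  `[c0.1%:~R * h + k%:R * (h / n%:R), c0.1%:~R * h + k.+1%:R * (h / n%:R)[%classic.

Definition in_slice k : set Omega := single c0 [set p | slice k p.1].

Lemma measurable_slice k : measurable (slice k : set (measurableTypeR R)).
Proof. exact: measurable_itv. Qed.

Lemma measurable_in_slice k : measurable (in_slice k).
Proof. by apply: measurable_single; apply: measurable_fst_in; exact: measurable_slice. Qed.

Let step0 : 0 < h / n%:R. Proof. by rewrite divr_gt0// ltr0n. Qed.

Lemma lam_slice k (J : set (measurableTypeR R)) : (k < n)%N -> measurable J ->
  lam (cell c0 `&` [set p | slice k p.1 /\ J p.2]) =
  h / n%:R * fine (m (`[c0.2%:~R * h, (c0.2%:~R + 1) * h[%classic `&` J)).
Proof.
move=> kn mJ.
have hn : n%:R * (h / n%:R) = h by rewrite mulrC divfK// pnatr_eq0 -lt0n.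
have -> : cell c0 `&` [set p | slice k p.1 /\ J p.2] =
    slice k `*` (`[c0.2%:~R * h, (c0.2%:~R + 1) * h[%classic `&` J) :> set T2.
  apply/seteqP; split => -[t x] /=; rewrite /cell /slice /= !in_itv/=.
    by move=> [[_ cx] [st Jx]].
  move=> [/[dup] st /andP[t1 t2] [cx Jx]]; split => //; split => //.
  have : k.+1%:R * (h / n%:R) <= n%:R * (h / n%:R) by rewrite ler_wpM2r ?ler_nat// ltW.
  have : 0 <= k%:R * (h / n%:R) by rewrite mulr_ge0// ltW.
  rewrite hn mulrDl mul1r => k1 k2; apply/andP; split; first by rewrite (le_trans _ t1)// lerDl.
  by rewrite (lt_le_trans t2)// lerD2l.
rewrite /lam intensity_rect; [|exact: measurable_slice|by apply: measurableI => //; exact: measurable_itv].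
rewrite /slice lebesgue_measure_itv/= lte_fin ltrD2l ltr_pM2r// ltr_nat ltnSn -EFinB.
have -> : c0.1%:~R * h + k.+1%:R * (h / n%:R) - (c0.1%:~R * h + k%:R * (h / n%:R)) = h / n%:R.
  by rewrite -natr1 mulrDl mul1r; ring.
rewrite -[X in (_ * X)%E](fineK (fin_num_measure m _ _)) //.
by apply: measurableI => //; exact: measurable_itv.
Qed.

(** The intensity of a slice of c0 over J does not depend on the slice, so both
    sides agree on the generating events by [prob_singles]; hence they agree on
    the sigma-algebra. *)
Lemma slices_same_law k E : (k < n)%N -> <<s other_info >> E ->
  P (E `&` in_slice k) = P (E `&` in_slice 0).
Proof.
move=> kn sE.
apply: (@g_sigma_algebra_measure_unique _ _ _ other_info other_info_measurable
  (fun=> setT) _ _ (mrestr P (measurable_in_slice k)) (mrestr P (measurable_in_slice 0))) => //.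
- by move=> _; exact: other_infoT.
- by apply/seteqP; split => // w _; exists 0%N.
- exact: other_info_setI.
- move=> _ [cs [B [J [u1 n1 mB mJ ->]]]].
  pose B' j c := if c == c0 then [set p | slice j p.1 /\ J p.2] else B c.
  have mB' j c : measurable (B' j c : set T2).
    rewrite /B'; case: ifP => // _; apply: measurableI.
      by apply: measurable_fst_in; exact: measurable_slice.
    exact: measurable_snd_in.
  have E' j : ([set w | J (pos c0 w).2] `&` \bigcap_(c in [set` cs]) single c (B c)) `&` in_slice j =
      \bigcap_(c in [set` c0 :: cs]) single c (B' j c).
    apply/seteqP; split => w.
      move=> [[Jw h1] [c1 sw]] c /=; rewrite inE /B'.
      have [->|cc0] := eqVneq c c0; first by split.
      by move=> /= /h1.
    move=> h1; have := h1 c0 (mem_head _ _); rewrite /B' eqxx => -[c1 [sw Jw]].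
    split; last by split.
    split => // c ccs; have := h1 c; rewrite /= inE ccs orbT /B' => /(_ isT).
    by case: eqP => // cE; move: n1; rewrite -cE ccs.
  rewrite /= /mrestr !E' !prob_singles//=; try by rewrite n1.
  congr (_%:E); rewrite !big_cons; congr (_ * _ * _).
    by rewrite /B' eqxx !lam_slice// (leq_trans _ kn).
  apply: eq_big_seq => c ccs; rewrite /B'.
  by case: eqP => // cE; move: n1; rewrite -cE ccs.
- move=> _; apply: (@le_lt_trans _ _ 1%E); last exact: ltry.
  by apply: probability_le1; apply: measurableI => //; exact: measurable_in_slice.
Qed.

End one_cell.
End positions.

(** * Bending times *)

Section measurable_energy.
Context (R : realType) d (T : measurableType d).

(** Inversion is the power with exponent -1 on nonnegative numbers. *)
Lemma measurable_inv_nneg (f : T -> R) : (forall w, 0 <= f w) ->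
  measurable_fun [set: T] f -> measurable_fun [set: T] (fun w => (f w)^-1).
Proof.
move=> f0 mf; rewrite (_ : (fun _ => _) = (fun w => f w `^ (-1))).
  exact: (measurableT_comp (measurable_powR (-1)) mf).
by apply/funext => w; rewrite powR_inv1.
Qed.

Definition measurable_point (f : T -> R * R) :=
  measurable_fun [set: T] (fun w => (f w).1) /\ measurable_fun [set: T] (fun w => (f w).2).

Lemma measurable_leg f g : measurable_point f -> measurable_point g ->
  measurable_fun [set: T] (fun w => leg (f w) (g w)).
Proof.
move=> [f1 f2] [g1 g2]; rewrite /leg; apply: measurable_funM.
  by apply: measurable_funX; exact: measurable_funB.
apply: measurable_inv_nneg; first by move=> w; rewrite mulr_ge0.
apply: measurable_funM; first exact: measurable_cst.
by apply: measurableT_comp => //; exact: measurable_funB.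
Qed.

Lemma measurable_energy (I : eqType) (F : I -> T -> R * R) (p : T -> R * R) (cs : seq I) :
  measurable_point p -> (forall c, c \in cs -> measurable_point (F c)) ->
  measurable_fun [set: T] (fun w => energy (p w) [seq F c w | c <- cs]).
Proof.
elim: cs p => [|c cs ih] p mp mF /=; first exact: measurable_cst.
have mc : measurable_point (F c) by apply: mF; exact: mem_head.
apply: measurable_funD; first exact: measurable_leg.
by apply: ih => // c' c'cs; apply: mF; rewrite inE c'cs orbT.
Qed.

End measurable_energy.

Section bending.
Context (R : realType).

(** The two solutions s of p^2 / (2 (s - a)) + q^2 / (2 (b - s)) = k, according
    to the sign e of the square root. *)
Definition bend_time (e a b p q k : R) : R :=
  let B := q ^+ 2 - p ^+ 2 - 2 * k * (a + b) in
  let C := p ^+ 2 * b - q ^+ 2 * a + 2 * k * (a * b) in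
  (e * Num.sqrt (B ^+ 2 - 8 * k * C) - B) / `|4 * k|.

(** Clearing denominators gives 2 k s^2 + B s + C = 0, with k > 0 because p or q
    is nonzero. *)
Lemma bending_time (a s b p q k : R) : a < s -> s < b ->
  ~ (p = 0 /\ q = 0) ->
  p ^+ 2 / (2 * (s - a)) + q ^+ 2 / (2 * (b - s)) = k ->
  s = bend_time 1 a b p q k \/ s = bend_time (- 1) a b p q k.
Proof.
move=> as_ sb pq kE; rewrite /bend_time mul1r mulN1r.
set B := q ^+ 2 - p ^+ 2 - 2 * k * (a + b).
set C := p ^+ 2 * b - q ^+ 2 * a + 2 * k * (a * b).
set r := Num.sqrt (B ^+ 2 - 8 * k * C).
have k0 : 0 < k.
  rewrite -kE; have da : 0 < 2 * (s - a) by lra.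
  have db : 0 < 2 * (b - s) by lra.
  have [p0|p0] := eqVneq p 0.
    have q0 : q != 0 by apply/eqP => q0; apply: pq.
    by rewrite ltr_wpDl ?divr_ge0 ?sqr_ge0 ?ltW// divr_gt0// exprn_even_gt0.
  by rewrite ltr_pwDl ?divr_ge0 ?sqr_ge0 ?ltW// divr_gt0// exprn_even_gt0.
have quad : 2 * k * s ^+ 2 + B * s + C = 0.
  have sa0 : s - a != 0 by rewrite subr_eq0 gt_eqF.
  have bs0 : b - s != 0 by rewrite subr_eq0 gt_eqF.
  have e : p ^+ 2 * (b - s) + q ^+ 2 * (s - a) = 2 * k * (s - a) * (b - s).
    by rewrite -kE; field; rewrite bs0 sa0.
  rewrite (_ : _ + C = p ^+ 2 * (b - s) + q ^+ 2 * (s - a) - 2 * k * (s - a) * (b - s)).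
    by rewrite e subrr.
  by rewrite /B /C; ring.
have D : B ^+ 2 - 8 * k * C = (4 * k * s + B) ^+ 2.
  have -> : C = - (2 * k * s ^+ 2 + B * s) by apply/eqP; rewrite -addr_eq0 addrC quad.
  by ring.
have r2 : r = `|4 * k * s + B| by rewrite /r D sqrtr_sqr.
have k4 : `|4 * k| = 4 * k by rewrite gtr0_norm// mulr_gt0.
have k40 : 4 * k != 0 by rewrite gt_eqF// mulr_gt0.
have sE x : x = 4 * k * s + B -> s = (x - B) / (4 * k).
  by move=> ->; rewrite addrK mulrC mulKf.
rewrite k4 r2; case: (ger0P (4 * k * s + B)) => _; [left|right]; apply: sE => //.
by rewrite opprK.
Qed.

Lemma measurable_bend_time d (T : measurableType d) (e : R) (a b p q k : T -> R) :
  measurable_fun [set: T] a -> measurable_fun [set: T] b ->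
  measurable_fun [set: T] p -> measurable_fun [set: T] q ->
  measurable_fun [set: T] k ->
  measurable_fun [set: T] (fun w => bend_time e (a w) (b w) (p w) (q w) (k w)).
Proof.
move=> ma mb mp mq mk; rewrite /bend_time.
have mc (c : R) : measurable_fun [set: T] (fun=> c) by exact: measurable_cst.
have mB : measurable_fun [set: T] (fun w => q w ^+ 2 - p w ^+ 2 - 2 * k w * (a w + b w)).
  apply: measurable_funB; first by apply: measurable_funB; exact: measurable_funX.
  by apply: measurable_funM; [exact: measurable_funM|exact: measurable_funD].
have mC : measurable_fun [set: T] (fun w => p w ^+ 2 * b w - q w ^+ 2 * a w + 2 * k w * (a w * b w)).
  apply: measurable_funD; last by apply: measurable_funM; exact: measurable_funM.
  by apply: measurable_funB; apply: measurable_funM => //; exact: measurable_funX.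
apply: measurable_funM; last first.
  apply: measurable_inv_nneg => //.
  by apply: measurableT_comp => //; exact: measurable_funM.
apply: measurable_funB => //; apply: measurable_funM => //.
apply: (measurableT_comp (continuous_measurable_fun (@sqrt_continuous R))).
apply: measurable_funB; first exact: measurable_funX.
by apply: measurable_funM => //; exact: measurable_funM.
Qed.

End bending.

(** * The time of a point is not determined by the other points *)

Section ties.
Context (R : realType) (m : {finite_measure set (measurableTypeR R) -> \bar R}).
Context d (Omega : measurableType d) (P : probability Omega R).
Variable xi : Omega -> configuration R.
Hypothesis xi_poisson : poisson_point_field m P xi.
Variable h : R.
Hypothesis h0 : 0 < h.

Local Notation count := (count_in xi).
Local Notation cell := (cell h).
Local Notation T2 := (measurableTypeR R * measurableTypeR R)%type.
Local Notation pos := (pos xi h).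
Implicit Types (c : int * int) (w : Omega).

Lemma slice_inj c n k k' (t : R) : (0 < n)%N -> slice h c n k t -> slice h c n k' t -> k = k'.
Proof.
move=> n0; have s0 : 0 < h / n%:R by rewrite divr_gt0// ltr0n.
have key i j : slice h c n i t -> slice h c n j t -> (i <= j)%N.
  rewrite /slice /= !in_itv/= => /andP[h1 _] /andP[_ h2].
  by have := le_lt_trans h1 h2; rewrite ltrD2l ltr_pM2r// ltr_nat ltnS.
by move=> h1 h2; apply/eqP; rewrite eqn_leq !key.
Qed.

Lemma slice_cover c n (p : R * R) : (0 < n)%N -> cell c p -> exists2 k, (k < n)%N & slice h c n k p.1.
Proof.
move=> n0; have s0 : 0 < h / n%:R by rewrite divr_gt0// ltr0n.
rewrite /cell /= => -[+ _] /=; rewrite in_itv/= => /andP[t1 t2].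
set x := (p.1 - c.1%:~R * h) / (h / n%:R).
have x0 : 0 <= x by rewrite divr_ge0 ?(ltW s0)// subr_ge0.
have xE : p.1 = c.1%:~R * h + x * (h / n%:R) by rewrite /x divfK ?gt_eqF// addrC subrK.
have k1 := truncnS_gt x; have k2 : (Num.truncn x)%:R <= x by rewrite truncn_le.
exists (Num.truncn x).
  rewrite -(@ltr_nat R); apply: le_lt_trans k2 _; rewrite /x ltr_pdivrMr//.
  by rewrite [ltRHS]mulrC divfK ?pnatr_eq0 -?lt0n//; move: t2; rewrite mulrDl mul1r; lra.
by rewrite /slice /= in_itv/= xE lerD2l ltrD2l ler_pM2r// ltr_pM2r// k2 k1.
Qed.

Section one_cell.
Variable c0 : int * int.

Local Notation G := (g_sigma_algebraType (other_info xi h c0)).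

Lemma measurable_other (E : set Omega) : <<s other_info xi h c0 >> E -> measurable E.
Proof.
by apply: smallest_sub; [exact: sigma_algebra_measurable|exact: (other_info_measurable xi_poisson)].
Qed.

(** Cut the cell into n slices. Given everything else the slice of the time is
    uniform, so the time and Z are both in the slice k with the same probability
    as the time in the slice 0 and Z in the slice k. Summing over k, the
    probability of an equality is at most that of the slice 0, which is of the
    order of 1 / n. *)
Lemma time_null (Z : Omega -> R) : measurable_fun [set: G] (Z : G -> R) ->
  P.-negligible [set w | count (cell c0) w = 1%N /\ (pos c0 w).1 = Z w].
Proof.
move=> mZ; apply: outer_le_negligible => e e0.
pose x := fine (m (`[c0.2%:~R * h, (c0.2%:~R + 1) * h[%classic `&` setT)).
have x0 : 0 <= x by rewrite fine_ge0.
pose n := (Num.truncn (h * x / e)).+1.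
have n0 : (0 < n)%N by [].
have nx : h / n%:R * x <= e.
  rewrite mulrAC ler_pdivrMr ?ltr0n// -ler_pdivrMl// [leLHS]mulrC.
  exact/ltW/truncnS_gt.
pose E k : set Omega := [set w | slice h c0 n k (Z w)].
have sE k : <<s other_info xi h c0 >> (E k).
  have := mZ measurableT _ (measurable_slice h c0 n k); rewrite setTI; exact.
have mE k := measurable_other (sE k).
have mS k := measurable_in_slice xi_poisson h c0 n k.
have tE j : trivIset [set: 'I_n] (fun k : 'I_n => E k `&` in_slice xi h c0 n j).
  by apply/trivIsetP => i k _ _; apply: contraNeq => /set0P[w [[iw _] [kw _]]]; apply/eqP/val_inj; exact: slice_inj iw kw.
have tE' : trivIset [set: 'I_n] (fun k : 'I_n => E k `&` in_slice xi h c0 n k).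
  by apply/trivIsetP => i k _ _; apply: contraNeq => /set0P[w [[iw _] [kw _]]]; apply/eqP/val_inj; exact: slice_inj iw kw.
exists (\big[setU/set0]_(k < n) (E k `&` in_slice xi h c0 n k)); split.
- by apply: bigsetU_measurable => k _; exact: measurableI.
- move=> w [c1 sZ].
  have [_ cw] : (xi w `&` cell c0) (pos c0 w) by rewrite (pos_spec c1).
  have [k kn sk] := slice_cover n0 cw.
  rewrite -(bigcup_mkord n (fun k => E k `&` in_slice xi h c0 n k)); exists k => //; split; last by split.
  by rewrite /E /= -sZ.
rewrite measure_bigsetU_ord//; last by move=> k; exact: measurableI.
rewrite (eq_bigr (fun k : 'I_n => P (E k `&` in_slice xi h c0 n 0))); last first.
  by move=> k _; apply: (slices_same_law xi_poisson h0).
rewrite -measure_bigsetU_ord//; last by move=> k; exact: measurableI.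
apply: (@le_trans _ _ (P (in_slice xi h c0 n 0))).
  apply: le_measure; rewrite ?inE//; first by apply: bigsetU_measurable => k _; exact: measurableI.
  by rewrite -(bigcup_mkord n (fun k => E k `&` in_slice xi h c0 n 0)) => w [k _ [_]].
pose B (_ : int * int) : set T2 := [set p | slice h c0 n 0 p.1 /\ setT p.2].
have mB c : measurable (B c).
  by apply: measurableI; [apply: measurable_fst_in; exact: measurable_slice|exact: measurable_snd_in].
have := prob_singles xi_poisson h0 (isT : uniq [:: c0]) mB.
rewrite set_cons1 bigcap_set1 big_seq1 /B lam_slice// -/x => PE.
have -> : in_slice xi h c0 n 0 = single xi h c0 (B c0).
  by apply/seteqP; split => w; [move=> [c1 sw]; split|move=> [c1 [sw _]]; split].
rewrite PE lee_fin (le_trans _ nx)// ler_piMr ?mulr_ge0 ?divr_ge0 ?(ltW h0)//.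
by rewrite -expR0 ler_expR oppr_le0; exact: lam_ge0.
Qed.

(** The value (0, 0) stands for the absence of a unique point, so the events
    that contain it are treated through their complements. *)
Lemma measurable_pos_other c : c != c0 ->
  @measurable_point R _ G (fun w => pos c w).
Proof.
move=> cc0.
have key (A : set T2) : measurable A -> <<s other_info xi h c0 >> (pos c @^-1` A).
  move=> mA.
  have sub (B : set T2) : measurable B -> <<s other_info xi h c0 >> (single xi h c B).
    move=> mB; apply: sub_sigma_algebra; exists [:: c], (fun=> B), setT; split => //.
      by rewrite inE eq_sym.
    by rewrite set_cons1 bigcap_set1 setIC; apply/seteqP; split => w; [split|case].
  have [A0|A0] := pselect (A (0, 0)); last first.
    rewrite (_ : _ @^-1` _ = single xi h c A); first exact: sub.
    apply/seteqP; split => w /=; last by case.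
    by rewrite /pos; case: eqP => // c1 Aw; split => //; rewrite /pos c1 eqxx.
  rewrite (_ : _ @^-1` _ = ~` single xi h c (~` A)).
    have := @measurableC _ G (single xi h c (~` A)).
    by apply; apply: sub; exact: measurableC.
  apply/seteqP; split => w /=; first by move=> Aw [_].
  move=> nw; have [//|nA] := pselect (A (pos c w)).
  have [c1|c1] := pselect (count (cell c) w = 1%N); first by exfalso; apply: nw.
  by rewrite /pos; case: eqP.
split => _ J mJ; rewrite setTI.
  exact: (key _ (measurable_fst_in mJ)).
exact: (key _ (measurable_snd_in mJ)).
Qed.

Lemma measurable_place : measurable_fun [set: G] ((fun w => (pos c0 w).2) : G -> R).
Proof.
move=> _ J mJ; rewrite setTI; apply: sub_sigma_algebra.
exists [::], (fun=> setT), J; split => //.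
by rewrite set_nil bigcap_set0 setIT.
Qed.

End one_cell.
End ties.

(** * Absence of ties *)

Section one_vertex.
Context {R : realType}.
Implicit Types (P Q v : R * R) (l : seq (R * R)).

Lemma energy_vertex P l1 v l2 Q : energy P (rcons (l1 ++ v :: l2) Q) =
  energy P l1 + (leg (last P l1) v + (leg v (head Q l2) + energy (head Q l2) (behead (rcons l2 Q)))).
Proof. by rewrite rcons_cat energy_cat; case: l2. Qed.

Lemma path_vertex P l1 v l2 Q : path earlier P (rcons (l1 ++ v :: l2) Q) ->
  (last P l1).1 < v.1 /\ v.1 < (head Q l2).1.
Proof.
rewrite rcons_cat cat_path => /andP[_]; case: l2 => [|q l2] /= /andP[h1 /andP[h2 _]] //.
Qed.

End one_vertex.

Section isolation.
Context {R : realType}.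
Implicit Types (w : configuration R) (p q : R * R).

Local Notation side n := (n.+1%:R^-1 : R).

Lemma cell_diam h (p q : R * R) : 0 < h -> cell_of h p = cell_of h q ->
  `|p.1 - q.1| < h /\ `|p.2 - q.2| < h.
Proof.
move=> h0 pq; have [/= p1 p2] := (cell_ofP p (cell_of h p) h0).2 erefl.
have [/= q1 q2] := (cell_ofP q (cell_of h p) h0).2 pq.
have key (i x y : R) : x \in `[i * h, (i + 1) * h[ -> y \in `[i * h, (i + 1) * h[ -> `|x - y| < h.
  by rewrite !in_itv/= mulrDl mul1r => /andP[? ?] /andP[? ?]; rewrite ltr_norml; apply/andP; split; lra.
by split; [exact: key p1 q1|exact: key p2 q2].
Qed.

Lemma separated (t : seq (R * R)) p : exists N, forall n q, (N <= n)%N -> q \in t -> 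
  cell_of (side n) q = cell_of (side n) p -> q = p.
Proof.
elim: t => [|q t [N ih]]; first by exists 0%N.
pose dl := `|q.1 - p.1| + `|q.2 - p.2|.
exists (maxn N (Num.truncn (2 / dl))) => n x; rewrite geq_max inE => /andP[Nn tn].
case/orP => [/eqP ->|xt]; last exact: ih.
have h0 : 0 < side n by rewrite invr_gt0.
move=> /(cell_diam h0)[d1 d2]; have [//|qp] := pselect (q = p).
have dl0 : 0 < dl.
  rewrite lt_neqAle addr_ge0// andbT eq_sym paddr_eq0// !normr_eq0 !subr_eq0.
  by apply/negP => /andP[/eqP e1 /eqP e2]; apply: qp; rewrite (surjective_pairing q) e1 e2 -surjective_pairing.
have : dl < 2 * side n by rewrite /dl mulr2n mulrDl mul1r ltrD.
rewrite ltr_pdivlMr ?ltr0n// mulrC -ltr_pdivlMr// ltNge => /negP[].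
by apply/ltW; apply: lt_le_trans (truncnS_gt _) _; rewrite ler_nat ltnS.
Qed.

Lemma isolated_point w p : points w p -> exists N, forall n, (N <= n)%N ->
  w `&` cell (side n) (cell_of (side n) p) = [set p].
Proof.
move=> wp; pose B : set (R * R) := [set q | `|q.1 - p.1| < 1 /\ `|q.2 - p.2| < 1].
have bB : bounded_set B.
  apply: (@bounded_setP _ _ (1 + `|p.1| + `|p.2|)) => q [q1 q2].
  have n1 := ler_normD (q.1 - p.1) p.1; have n2 := ler_normD (q.2 - p.2) p.2.
  rewrite !subrK in n1 n2; have := normr_ge0 p.1; have := normr_ge0 p.2.
  by split; lra.
have /finite_seqP[t tE] := @points_locally_finite _ w _ bB.
have [N hN] := separated t p; exists N => n Nn.
have h0 : 0 < side n by rewrite invr_gt0.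
have h1 : side n <= 1 by rewrite invf_le1// ler1n.
apply/seteqP; split => q /=; last by move=> ->; split => //; apply/cell_ofP.
move=> [wq /(cell_ofP _ _ h0)/esym cq]; apply: (hN n) => //.
have [d1 d2] := cell_diam h0 cq.
have : (w `&` B) q by split => //; split; exact: lt_le_trans h1.
by rewrite tE.
Qed.

(** For a small mesh, depending on the finite set of points. *)
Lemma isolated_points w (S : seq (R * R)) : (forall p, p \in S -> points w p) ->
  exists n, forall p, p \in S -> w `&` cell (side n) (cell_of (side n) p) = [set p].
Proof.
move=> wS; suff [N hN] : exists N, forall n, (N <= n)%N -> forall p, p \in S ->
    w `&` cell (side n) (cell_of (side n) p) = [set p] by exists N; exact: hN.
elim: S wS => [|p S ih] wS; first by exists 0%N.
have [|N hN] := ih; first by move=> q qS; apply: wS; rewrite inE qS orbT.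
have [|N' hN'] := @isolated_point w p; first by apply: wS; exact: mem_head.
exists (maxn N N') => n; rewrite geq_max => /andP[Nn N'n] q.
by rewrite inE => /orP[/eqP ->|]; [exact: hN'|exact: hN].
Qed.

End isolation.

Lemma countable_negligible d (T : measurableType d) (R : realType) (mu : {measure set T -> \bar R})
  (I : countType) (F : I -> set T) : (forall i, mu.-negligible (F i)) ->
  mu.-negligible (\bigcup_(i in setT) F i).
Proof.
move=> nF; have nU : mu.-negligible (\bigcup_k (if @choice.unpickle I k is Some i then F i else set0)).
  by apply: negligible_bigcup => k; case: choice.unpickle => [i|]; [exact: nF|exact: negligible_set0].
apply: negligibleS nU => w [i _ Fi]; exists (choice.pickle i) => //=.
by rewrite choice.pickleK.
Qed.

Section no_ties.
Context (R : realType) (m : {finite_measure set (measurableTypeR R) -> \bar R}).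
Context d (Omega : measurableType d) (P : probability Omega R).
Variable xi : Omega -> configuration R.
Hypothesis xi_poisson : poisson_point_field m P xi.
Local Notation count := (count_in xi).

(** A tie between the polygons through the points of given cells, c0 being the
    cell of the vertex that distinguishes them; z is the difference. *)
Definition tie h (c0 cP cQ : int * int) (l1 l2 l' : seq (int * int)) (z : int) : set Omega :=
  [set w | let p c := pos xi h c w in
    [/\ count (cell h c0) w = 1%N,
        path earlier (p cP) (rcons (map p l1 ++ p c0 :: map p l2) (p cQ)),
        ~ flat_at (p cP) (map p l1) (p c0) (map p l2) (p cQ) &
        energy (p cP) (rcons (map p l1 ++ p c0 :: map p l2) (p cQ)) -
        energy (p cP) (rcons (map p l') (p cQ)) = z%:~R]].

(** Only the two legs at the vertex depend on its time. *)
Lemma tie_null h c0 cP cQ l1 l2 l' z : 0 < h ->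
  c0 \notin cP :: cQ :: l1 ++ l2 ++ l' -> P.-negligible (tie h c0 cP cQ l1 l2 l' z).
Proof.
move=> h0 nc0.
have mp c : c \in cP :: cQ :: l1 ++ l2 ++ l' ->
    @measurable_point R _ (g_sigma_algebraType (other_info xi h c0)) (fun w => pos xi h c w).
  by move=> cc; apply: measurable_pos_other; apply: contra nc0 => /eqP <-.
have in1 : {subset cP :: l1 <= cP :: cQ :: l1 ++ l2 ++ l'}.
  by move=> c; rewrite !inE !mem_cat => /orP[->//|->]; rewrite !orbT.
have in2 : {subset cQ :: l2 <= cP :: cQ :: l1 ++ l2 ++ l'}.
  by move=> c; rewrite !inE !mem_cat => /orP[->|->]; rewrite !orbT.
have in3 : {subset cQ :: l' <= cP :: cQ :: l1 ++ l2 ++ l'}.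
  by move=> c; rewrite !inE !mem_cat => /orP[->|->]; rewrite !orbT.
pose cu := last cP l1; pose cq := head cQ l2.
have [mu1 mu2] := mp cu (in1 _ (mem_last _ _)).
have cqin : cq \in cQ :: l2.
  by rewrite /cq; case: (l2) => [|c l] /=; rewrite !inE eqxx ?orbT.
have [mq1 mq2] := mp cq (in2 _ cqin).
have my := @measurable_place _ _ _ xi h c0.
pose k w := z%:~R + energy (pos xi h cP w) (map (pos xi h ^~ w) (rcons l' cQ))
  - energy (pos xi h cP w) (map (pos xi h ^~ w) l1)
  - energy (pos xi h cq w) (map (pos xi h ^~ w) (behead (rcons l2 cQ))).
have mk : measurable_fun [set: g_sigma_algebraType (other_info xi h c0)] k.
  have mE c l : c \in cP :: cQ :: l1 ++ l2 ++ l' ->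
      {subset l <= cP :: cQ :: l1 ++ l2 ++ l'} ->
      measurable_fun [set: g_sigma_algebraType (other_info xi h c0)]
        (fun w => energy (pos xi h c w) (map (pos xi h ^~ w) l)).
    by move=> cc lc; apply: (@measurable_energy R _ (g_sigma_algebraType (other_info xi h c0)) _ (pos xi h) (pos xi h c) l) => [|c' c'l]; apply: mp => //; exact: lc.
  apply: measurable_funB; first apply: measurable_funB.
  - apply: measurable_funD; first exact: measurable_cst.
    apply: mE; first exact: mem_head.
    by move=> c; rewrite mem_rcons; exact: in3.
  - apply: mE; first exact: mem_head.
    by move=> c cl; apply: in1; rewrite inE cl orbT.
  - apply: mE; first exact: in2.
    by move=> c /mem_behead; rewrite mem_rcons; exact: in2.
pose Z e w := bend_time e (pos xi h cu w).1 (pos xi h cq w).1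
  ((pos xi h c0 w).2 - (pos xi h cu w).2) ((pos xi h cq w).2 - (pos xi h c0 w).2) (k w).
have mZ e : measurable_fun [set: g_sigma_algebraType (other_info xi h c0)] (Z e).
  by apply: measurable_bend_time => //; exact: measurable_funB.
apply: negligibleS (negligibleU (time_null xi_poisson h0 (mZ 1)) (time_null xi_poisson h0 (mZ (- 1)))).
move=> w [c1 pth nflat tE].
have [uv vq] := path_vertex pth; move: tE nflat; rewrite /flat_at energy_vertex.
have uE : last (pos xi h cP w) (map (pos xi h ^~ w) l1) = pos xi h cu w by exact: last_map.
have qE : head (pos xi h cQ w) (map (pos xi h ^~ w) l2) = pos xi h cq w by rewrite /cq; case: (l2).
rewrite !qE in vq *; rewrite !uE in uv *.
have rE l c : rcons (map (pos xi h ^~ w) l) (pos xi h c w) = map (pos xi h ^~ w) (rcons l c).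
  by rewrite map_rcons.
rewrite !rE behead_map => tE nflat.
have := @bending_time R _ _ _ ((pos xi h c0 w).2 - (pos xi h cu w).2) ((pos xi h cq w).2 - (pos xi h c0 w).2) (k w) uv vq.
case.
- by move=> [/eqP + /eqP]; rewrite !subr_eq0 => /eqP e1 /eqP e2; apply: nflat.
- rewrite -!legE//; rewrite /k -tE; ring.
- by left.
- by right.
Qed.

(** There are countably many choices of a mesh 1 / (n + 1), of cells and of an
    integer; given a tie, a small mesh isolates the points concerned. *)
Lemma no_tie_ae : {ae P, forall w, no_tie (xi w)}.
Proof.
pose I := (nat * (int * int) * (int * int) * (int * int) *
  seq (int * int) * seq (int * int) * seq (int * int) * int)%type.
pose F (i : I) : set Omega :=
  let: (n, c0, cP, cQ, l1, l2, l', z) := i in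
  if c0 \in cP :: cQ :: l1 ++ l2 ++ l' then set0 else tie n.+1%:R^-1 c0 cP cQ l1 l2 l' z.
have nF i : P.-negligible (F i).
  move: i => [[[[[[[n c0] cP] cQ] l1] l2] l'] z]; rewrite /F.
  by case: ifPn => nc; [exact: negligible_set0|apply: tie_null => //; rewrite invr_gt0].
apply: negligibleS (countable_negligible nF) => w; apply: contra_notP => nw.
move=> p q l1 v l2 l' wp wq [pth sub] [pth' sub'] vl' nflat z tE; apply: nw.
pose S := p :: q :: v :: l1 ++ l2 ++ l'.
have wS x : x \in S -> points (xi w) x.
  rewrite !inE !mem_cat => /or4P[/eqP ->|/eqP ->|/eqP ->|/or3P[xl|xl|xl]] //.
  - by apply: sub; rewrite /= mem_cat mem_head orbT.
  - by apply: sub; rewrite /= mem_cat xl.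
  - by apply: sub; rewrite /= mem_cat inE xl !orbT.
  - exact: sub'.
have [n iso] := isolated_points wS.
have h0 : (0 : R) < n.+1%:R^-1 by rewrite invr_gt0.
pose f (x : R * R) := cell_of n.+1%:R^-1 x.
have count1 x : x \in S -> count (cell n.+1%:R^-1 (f x)) w = 1%N.
  move=> xS; rewrite /count_in iso// (_ : [set x] = [set` [:: x]]) ?npoints_seq//.
  by rewrite set_cons1.
have posf x : x \in S -> pos xi n.+1%:R^-1 (f x) w = x.
  move=> xS; have := pos_spec (count1 _ xS); rewrite iso// => /esym e.
  by have : [set pos xi n.+1%:R^-1 (f x) w] (pos xi n.+1%:R^-1 (f x) w) by []; rewrite e.
have fv x : x \in S -> f x = f v -> x = v.
  by move=> xS e; rewrite -(posf x xS) e posf// !inE eqxx !orbT.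
have vS : v \notin p :: q :: l1 ++ l2 ++ l'.
  have := path_earlier_uniq pth; rewrite rcons_uniq cat_uniq /= mem_cat !inE !negb_or.
  move=> /andP[/and3P[_ qv _] /and3P[_ /andP[vl1 _] /andP[vl2 _]]].
  rewrite !mem_cat !negb_or vl1 vl2 vl' [v == q]eq_sym qv !andbT.
  have /allP/(_ v) := order_path_min (@earlier_trans R) pth.
  rewrite mem_rcons !inE mem_cat mem_head !orbT => /(_ isT).
  by apply: contraTneq => ->; rewrite earlier_irr.
have mapf l : {subset l <= S} -> map (fun c => pos xi n.+1%:R^-1 c w) (map f l) = l.
  move=> lS; rewrite -map_comp -[RHS]map_id; apply/eq_in_map => x xl /=; exact: posf (lS _ xl).
have s1 : {subset l1 <= S} by move=> x xl; rewrite !inE !mem_cat xl !orbT.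
have s2 : {subset l2 <= S} by move=> x xl; rewrite !inE !mem_cat xl !orbT.
have s3 : {subset l' <= S} by move=> x xl; rewrite !inE !mem_cat xl !orbT.
exists (n, f v, f p, f q, map f l1, map f l2, map f l', z) => //; rewrite /F ifN.
  rewrite /tie /= !mapf// !posf ?inE ?eqxx ?orbT//; split => //.
  by apply: count1; rewrite !inE eqxx !orbT.
rewrite -!map_cat -2!map_cons; apply/mapP => -[x xS /esym e].
move: (vS); rewrite -(fv x _ e) ?xS//.
by move: xS; rewrite !inE => /or3P[->|->|->]; rewrite ?orbT.
Qed.

End no_ties.

(** * Existence and uniqueness *)

Lemma goodpoint_attracting (R : realType) (i0 K : R) (ell M : nat) (w : configuration R) tau p :
  (2 <= ell)%N -> (forall x, inI i0 x -> `|x| <= K) -> 5 * K ^+ 2 <= M%:R ->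
  goodpoint i0 K ell M w tau p -> attracting w p /\ `|p.2| <= K.
Proof.
move=> ell2 IK MK gp; have [wp _ [[_ pI] _ _ _ _] _] := gp.
split; last exact: IK.
by split => // r; have := goodpoint_attracts ell2 IK MK r gp.
Qed.

Theorem theorem8p1 (R : realType)
  (m : {finite_measure set (measurableTypeR R) -> \bar R})
  (m_neq0 : m [set: R] <> 0%E)
  (d : measure_display) (Omega : measurableType d) (P : probability Omega R)
  (P_complete : measure_is_complete P)
  (xi : Omega -> configuration R)
  (xi_poisson : poisson_point_field m P xi) :
  {ae P, forall w : Omega,
    exists! g : R -> R, global_minimizer (xi w) g /\ recurrent g}.
Proof.
have [i0 [K [ell [M [ell2 IK MK mu0 [er fr]]]]]] := good_parameters m_neq0.
have good : {ae P, forall w, forall n : nat,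
    (exists tau p0, goodpoint i0 K ell M (xi w) tau p0 /\ n%:R < p0.1) /\
    (exists tau p0, goodpoint i0 K ell M (xi w) tau p0 /\ p0.1 < - n%:R)}.
  by apply/ae_foralln => n; exact: (good_points_ae xi_poisson M ell2 IK er fr mu0 n%:R).
near=> w; apply: (@recurrent_exists_unique R (xi w) K).
- by near: w; exact: (slab_finite_ae xi_poisson).
- by near: w; exact: (no_tie_ae xi_poisson).
- have gw : forall n : nat, (exists tau p0, goodpoint i0 K ell M (xi w) tau p0 /\ n%:R < p0.1) /\
    (exists tau p0, goodpoint i0 K ell M (xi w) tau p0 /\ p0.1 < - n%:R) by near: w.
  move=> T; have [[tau [p [gp Tp]]] _] := gw (Num.truncn T).+1.
  have [ap pK] := goodpoint_attracting ell2 IK MK gp.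
  by exists p; split => //; exact: lt_trans (truncnS_gt T) Tp.
- have gw : forall n : nat, (exists tau p0, goodpoint i0 K ell M (xi w) tau p0 /\ n%:R < p0.1) /\
    (exists tau p0, goodpoint i0 K ell M (xi w) tau p0 /\ p0.1 < - n%:R) by near: w.
  move=> T; have [_ [tau [p [gp Tp]]]] := gw (Num.truncn T).+1.
  have [ap pK] := goodpoint_attracting ell2 IK MK gp.
  by exists p; split => //; apply: lt_trans Tp _; rewrite ltrN2 truncnS_gt.
Unshelve. all: by end_near.
Qed.
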